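(* Let $d\ge 2$. Let $\mathcal{D}_n^A$ be the Weyl random cone of type $A_{n-1}$ built from random vectors in $\mathbb{R}^d$ that are almost surely in type $A$ general position, and let $\mathcal{D}_n^B$ be the Weyl random cone of type $B_n$ built from random vectors in $\mathbb{R}^d$ that are almost surely in type $B$ general position. The expected conic intrinsic volumes are $$\mathbb{E}\,\upsilon_0(\mathcal{D}_n^A)=\frac{D^A(n,d)-D^A(n,d-1)}{2D^A(n,d)},\qquad \mathbb{E}\,\upsilon_j(\mathcal{D}_n^A)=\frac{1}{D^A(n,d)}\genfrac{[}{]}{0pt}{}{n}{n-d+j},\quad j=1,\ldots,d,$$ $$\mathbb{E}\,\upsilon_0(\mathcal{D}_n^B)=\frac{D^B(n,d)-D^B(n,d-1)}{2D^B(n,d)},\qquad \mathbb{E}\,\upsilon_j(\mathcal{D}_n^B)=\frac{B[n,n-d+j]}{D^B(n,d)},\quad j=1,\ldots,d.$$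
   Context: Type $A$ general position: $y_1,\ldots,y_n\in\mathbb{R}^d$ with $n\ge d+1$ such that for every permutation $\sigma$ of $\{1,\ldots,n\}$ any $d$ of the vectors $y_{\sigma(1)}-y_{\sigma(2)},\ldots,y_{\sigma(n-1)}-y_{\sigma(n)}$ are linearly independent. Type $B$ general position: $y_1,\ldots,y_n\in\mathbb{R}^d$ with $n\ge d$ such that for every $\varepsilon\in\{\pm1\}^n$ and every permutation $\sigma$ of $\{1,\ldots,n\}$ any $d$ of the vectors $\varepsilon_1y_{\sigma(1)}-\varepsilon_2y_{\sigma(2)},\ldots,\varepsilon_{n-1}y_{\sigma(n-1)}-\varepsilon_ny_{\sigma(n)},\,\varepsilon_ny_{\sigma(n)}$ are linearly independent. For $x\in\mathbb{R}^d\setminus\{0\}$ let $x^\perp=\{v\in\mathbb{R}^d:\langle v,x\rangle=0\}$. The Weyl tessellation $\mathcal{W}^A(y_1,\ldots,y_n)$ (resp. $\mathcal{W}^B(y_1,\ldots,y_n)$) is the set of cones obtained as closures of the connected components of the complement in $\mathbb{R}^d$ of the union of the hyperplanes $(y_i-y_j)^\perp$, $1\le i<j\le n$ (resp. of the hyperplanes $(y_i+y_j)^\perp$, $(y_i-y_j)^\perp$, $1\le i<j\le n$, and $y_i^\perp$, $1\le i\le n$). Given (possibly dependent) random vectors $Y_1,\ldots,Y_n$ in $\mathbb{R}^d$ a.s. in type $A$ (resp. type $B$) general position, the Weyl random cone $\mathcal{D}_n^A$ (resp. $\mathcal{D}_n^B$) is obtained by choosing uniformly at random one of the cones of $\mathcal{W}=\mathcal{W}^A(Y_1,\ldots,Y_n)$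 (resp. $\mathcal{W}=\mathcal{W}^B(Y_1,\ldots,Y_n)$); that is, for a functional $\varphi$ of cones its expectation at the random cone is $\mathbb{E}\big[\frac{1}{\#\mathcal{W}}\sum_{C\in\mathcal{W}}\varphi(C)\big]$. Conic intrinsic volumes: for a polyhedral cone $C\subset\mathbb{R}^d$ let $\Pi_C(x)$ be the unique point of $C$ closest to $x\in\mathbb{R}^d$, and let $\mathcal{F}_j(C)$ be the set of $j$-dimensional faces of $C$ (faces are obtained by replacing some, possibly none, of the half-spaces defining $C$ by their boundaries). Then $\upsilon_j(C):=\sum_{F\in\mathcal{F}_j(C)}\mathbb{P}(\Pi_C(g)\in\operatorname{relint}F)$, $j=0,\ldots,d$, where $g$ is a standard Gaussian vector in $\mathbb{R}^d$ and $\operatorname{relint}F$ is the interior of $F$ relative to its linear hull. $\genfrac{[}{]}{0pt}{}{n}{k}$ and $B[n,k]$ are defined by $t(t+1)\cdots(t+n-1)=\sum_{k=1}^n\genfrac{[}{]}{0pt}{}{n}{k}t^k$ and $(t+1)(t+3)\cdots(t+2n-1)=\sum_{k=0}^nB[n,k]t^k$, and are zero for $k$ outside $\{1,\ldots,n\}$, resp. $\{0,\ldots,n\}$. Put $D^A(m,k):=2\sum_{i\ge0}\genfrac{[}{]}{0pt}{}{m}{m-k+1+2i}$ and $D^B(m,k):=2\sum_{i\ge0}B[m,m-k+1+2i]$. *)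

(* Defs.v *)
From HB Require Import structures.
From mathcomp Require Import all_boot all_order all_algebra all_fingroup.
From mathcomp Require Import finmap.
From mathcomp Require Import all_classical all_reals all_analysis.

Set Implicit Arguments.
Unset Strict Implicit.
Unset Printing Implicit Defensive.

Import Order.TTheory GRing.Theory Num.Theory.
Import numFieldNormedType.Exports.
Local Open Scope classical_set_scope.
Local Open Scope ring_scope.

(* The library norm on 'rV[R]_d is the sup norm, which induces the Euclidean  *)
(* topology but a different metric projection.                                *)

Definition dotv (R : realType) (d : nat) (u v : 'rV[R]_d) : R :=
  \sum_(k < d) u 0 k * v 0 k.

Definition enorm (R : realType) (d : nat) (u : 'rV[R]_d) : R :=
  Num.sqrt (dotv u u).

Definition hyperplane (R : realType) (d : nat) (x : 'rV[R]_d) : set 'rV[R]_d :=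
  [set v | dotv v x = 0].

(* The least subspace containing F always exists, so the default fullv is     *)
(* never used.                                                                *)

Definition linear_hull (R : realType) (d : nat) (F : set 'rV[R]_d) :
    {vspace 'rV[R]_d} :=
  xget fullv [set U : {vspace 'rV[R]_d} | F `<=` [set` U] /\
    forall V : {vspace 'rV[R]_d}, F `<=` [set` V] -> (U <= V)%VS].

Definition set_dim (R : realType) (d : nat) (F : set 'rV[R]_d) : nat :=
  \dim (linear_hull F).

Definition relint (R : realType) (d : nat) (F : set 'rV[R]_d) :
    set 'rV[R]_d :=
  [set x | F x /\ \forall y \near x, y \in linear_hull F -> F y].

(* The cone cut out by the half-spaces {v | <v, a i> <= 0}, and the face of   *)
(* it obtained by turning the half-spaces indexed by I into their boundaries. *)

Definition hcone (R : realType) (d m : nat) (a : 'I_m -> 'rV[R]_d) :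
    set 'rV[R]_d :=
  [set v | forall i, dotv v (a i) <= 0].

Definition hface (R : realType) (d m : nat) (a : 'I_m -> 'rV[R]_d)
    (I : {set 'I_m}) : set 'rV[R]_d :=
  hcone a `&` [set v | forall i, i \in I -> dotv v (a i) = 0].

(* The set of faces of a polyhedral cone does not depend on the half-spaces   *)
(* chosen to define it, so these may be quantified existentially.             *)

Definition is_face (R : realType) (d : nat) (C F : set 'rV[R]_d) : Prop :=
  exists (m : nat) (a : 'I_m -> 'rV[R]_d) (I : {set 'I_m}),
    [/\ forall i, a i != 0, C = hcone a & F = hface a I].

Definition faces (R : realType) (d : nat) (j : nat) (C : set 'rV[R]_d) :
    set (set 'rV[R]_d) :=
  [set F | is_face C F /\ set_dim F = j].

(* Metric projection; the minimizer exists and is unique for C closed,        *)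
(* convex and nonempty, in particular for polyhedral cones.                   *)

Definition mproj (R : realType) (d : nat) (C : set 'rV[R]_d) (x : 'rV[R]_d) :
    'rV[R]_d :=
  xget 0 [set p | C p /\ forall q, C q -> enorm (x - p) <= enorm (x - q)].

(* The standard Gaussian law on R^d, as the d-fold product of N(0, 1): vectors*)
(* are tuples here because these carry the product sigma-algebra.             *)

Definition cons_pair (R : realType) (d : nat)
    (p : measurableTypeR R * d.-tuple (measurableTypeR R)) :
    d.+1.-tuple (measurableTypeR R) :=
  [tuple of p.1 :: p.2].

Lemma measurable_cons_pair (R : realType) (d : nat) :
  measurable_fun setT (@cons_pair R d).
Proof. exact: measurable_cons. Qed.

HB.instance Definition _ (R : realType) (d : nat) :=
  isMeasurableFun.Build _ _ _ _ (@cons_pair R d) (@measurable_cons_pair R d).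

Fixpoint std_gaussian (R : realType) (d : nat) :
    probability (d.-tuple (measurableTypeR R)) R :=
  match d with
  | 0 => dirac [tuple]
  | d'.+1 => distribution (normal_prob 0 1 \x std_gaussian R d')%E
               (@cons_pair R d')
  end.

Definition row_of_tuple (R : realType) (d : nat) (g : d.-tuple R) : 'rV[R]_d :=
  \row_k tnth g k.

(* The event below is a Borel set when C is a polyhedral cone, and its        *)
(* probability is finite, so that fine loses nothing.                         *)

Definition intrinsic_volume (R : realType) (d : nat) (j : nat)
    (C : set 'rV[R]_d) : R :=
  \sum_(F \in faces j C)
    fine (std_gaussian R d [set g | relint F (mproj C (row_of_tuple g))]).

Definition general_position_A (R : realType) (d n : nat)
    (y : 'I_n -> 'rV[R]_d) : Prop :=
  (d.+1 <= n)%N /\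
  forall (s : 'S_n) (S : {set 'I_n}),
    #|S| = d -> (forall i, i \in S -> (i.+1 < n)%N) ->
    free [seq y (s i) - y (s (ordS i)) | i in S].

(* Signs are encoded by booleans. When i.+1 < n, ordS i is i + 1.             *)

Definition general_position_B (R : realType) (d n : nat)
    (y : 'I_n -> 'rV[R]_d) : Prop :=
  (d <= n)%N /\
  forall (e : 'I_n -> bool) (s : 'S_n) (S : {set 'I_n}),
    #|S| = d ->
    free [seq (-1) ^+ e i *: y (s i)
              - (if (i.+1 < n)%N then (-1) ^+ e (ordS i) *: y (s (ordS i))
                 else 0) | i in S].

Definition hyperplanes_A (R : realType) (d n : nat) (y : 'I_n -> 'rV[R]_d) :
    set 'rV[R]_d :=
  \bigcup_(p in [set p : 'I_n * 'I_n | (p.1 < p.2)%N])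
    hyperplane (y p.1 - y p.2).

Definition hyperplanes_B (R : realType) (d n : nat) (y : 'I_n -> 'rV[R]_d) :
    set 'rV[R]_d :=
  \bigcup_(p in [set p : 'I_n * 'I_n | (p.1 < p.2)%N])
    (hyperplane (y p.1 + y p.2) `|` hyperplane (y p.1 - y p.2))
  `|` \bigcup_(i in [set: 'I_n]) hyperplane (y i).

Definition tessellation (R : realType) (d : nat) (H : set 'rV[R]_d) :
    set (set 'rV[R]_d) :=
  [set closure (connected_component (~` H) x) | x in ~` H].

Definition weyl_A (R : realType) (d n : nat) (y : 'I_n -> 'rV[R]_d) :=
  tessellation (hyperplanes_A y).

Definition weyl_B (R : realType) (d n : nat) (y : 'I_n -> 'rV[R]_d) :=
  tessellation (hyperplanes_B y).

Definition random_vector (dO : measure_display) (Omega : measurableType dO)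
    (R : realType) (d : nat) (Y : Omega -> 'rV[R]_d) : Prop :=
  forall k : 'I_d, measurable_fun setT (fun w => Y w 0 k).

Definition cone_average (R : realType) (d : nat) (W : set (set 'rV[R]_d))
    (phi : set 'rV[R]_d -> R) : R :=
  (#|` fset_set W|%:R)^-1 * \sum_(C \in W) phi C.

(* Expectation of phi at a cone chosen uniformly at random in the finite      *)
(* random set W of cones.                                                     *)

Definition expectation_cone (dO : measure_display) (Omega : measurableType dO)
    (R : realType) (P : probability Omega R) (d : nat)
    (W : Omega -> set (set 'rV[R]_d)) (phi : set 'rV[R]_d -> R) : \bar R :=
  ('E_P[fun w => cone_average (W w) phi])%E.

(* Coefficients of t(t+1)...(t+n-1) and (t+1)(t+3)...(t+2n-1), extended by 0  *)
(* to all k : int.                                                            *)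

Definition stirlingA (R : realType) (n : nat) (k : int) : R :=
  if k is Posz k' then (\prod_(i < n) ('X + (i%:R)%:P) : {poly R})`_k' else 0.

Definition stirlingB (R : realType) (n : nat) (k : int) : R :=
  if k is Posz k' then
    (\prod_(i < n) ('X + ((i.*2.+1)%:R)%:P) : {poly R})`_k'
  else 0.

(* The sums over i >= 0 are truncated at i < k: for i >= k the index          *)
(* m - k + 1 + 2i exceeds m and the terms vanish.                             *)

Definition DA (R : realType) (m k : nat) : R :=
  2 * \sum_(i < k) stirlingA R m (m%:Z - k%:Z + 1 + 2 * i%:Z).

Definition DB (R : realType) (m k : nat) : R :=
  2 * \sum_(i < k) stirlingB R m (m%:Z - k%:Z + 1 + 2 * i%:Z).

(* Main.v *)
From HB Require Import structures.
From mathcomp Require Import all_boot all_order all_algebra all_fingroup.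
From mathcomp Require Import finmap.
From mathcomp Require Import all_classical all_reals all_analysis.
From mathcomp Require Import lra ring zify.
Require Import Defs.

Set Implicit Arguments.
Unset Strict Implicit.
Unset Printing Implicit Defensive.

Import Order.TTheory GRing.Theory Num.Theory.
Import numFieldNormedType.Exports.
Local Open Scope classical_set_scope.
Local Open Scope ring_scope.

(** Both types are treated together: the boolean [B] is true in type B and
    false in type A.  Fix vectors [y] in general position.  Sorting the (signed)
    scalar products of a point with the vectors shows that the cones of the
    tessellation are the cones [gcone (chain y t) (normals n B)] for the signed
    permutations [t] whose open cone is nonempty ([tessellation_walls],
    [cone_inj]).  So the average over the tessellation is a ratio of a sum over
    these [t], the [chambers], by their number.  Numerator and denominator turn
    out to depend on [n] and [d] only, so that the expectation is that of an
    almost surely constant function.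

    Intrinsic volumes.  By the Karush-Kuhn-Tucker conditions, the projection of
    [x] on a cone lies in the relative interior of the face with active set [I]
    exactly when [x] lies in a polyhedral [region] of the normal fan.  Hence the
    sum over the chambers of the volumes of index [j] is the Gaussian mean of
    the number of pairs of a signed permutation and a set [I] of size [d - j]
    whose region contains [x].  For [0 < j] that number is the same at every
    generic point, the coefficient of index [n - d + j] of
    t(t+1)...(t+n-1), respectively of (t+1)(t+3)...(t+2n-1) ([count_flags]);
    the only fact about the Gaussian measure that is used is that it does not
    charge hyperplanes.

    The count at a generic point.  The chains of [y] are the images of the
    chains of the standard basis under a linear map, and for pairs of a given
    span of face normals the count in dimension [d] equals the count at a
    suitable point of the coordinate space of dimension [n] ([transfer]).
    There, projecting on the chamber of the permutation [s] groups the entries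
    of [s] into runs on which the projection is constant; turning every run
    into a cycle gives a permutation whose cycles determine the span, and for a
    fixed generic point this correspondence is a bijection ([word_cycle_inj]).
    In type B the projection moreover kills the runs whose mean is nonnegative,
    which amounts to selecting cycles by a sign; a sign-flipping involution
    makes that selection independent of the point ([count_rule]).  It remains
    to count permutations by cycles ([count_cycles]).

    The number of chambers.  Let [w] be this number, [w'] the number for the
    vectors projected to the hyperplane orthogonal to a generic [x], and [N(x)]
    the number of chambers whose polar cone contains [x].  A chamber either has
    [x] or [- x] in its polar cone or meets the hyperplane, so
    w = N(x) + N(- x) + w' ([chambers_cut]); and a chamber whose polar cone does
    not contain [x] has a unique nonzero face on which [x] projects, so w - N(x)
    is a sum of coefficients, the same for [x] and [- x] ([chambers_polar]).
    Thus w + w' is twice that sum, which is the recursion satisfied by [DA]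
    and [DB] ([chamber_number_rec]).

    Finally the volume of index 0 is the complement to 1 of the other ones, and
    by the recursion its sum over the chambers is (w - w') / 2. *)

(** * Orthogonal projections in coordinates *)

Lemma dotvE (R : realType) d (u v : 'rV[R]_d) : dotv u v = (u *m v^T) 0 0.
Proof. by rewrite /dotv mxE; apply: eq_bigr => k _; rewrite mxE. Qed.

Lemma dotvC (R : realType) d (u v : 'rV[R]_d) : dotv u v = dotv v u.
Proof. by apply: eq_bigr => k _; rewrite mulrC. Qed.

Lemma dotvDl (R : realType) d (u v w : 'rV[R]_d) :
  dotv (u + v) w = dotv u w + dotv v w.
Proof. by rewrite !dotvE mulmxDl mxE. Qed.

Lemma dotvDr (R : realType) d (u v w : 'rV[R]_d) :
  dotv w (u + v) = dotv w u + dotv w v.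
Proof. by rewrite dotvC dotvDl !(dotvC w). Qed.

Lemma dotvZl (R : realType) d a (u w : 'rV[R]_d) :
  dotv (a *: u) w = a * dotv u w.
Proof. by rewrite !dotvE -scalemxAl mxE. Qed.

Lemma dotvZr (R : realType) d a (u w : 'rV[R]_d) :
  dotv w (a *: u) = a * dotv w u.
Proof. by rewrite dotvC dotvZl dotvC. Qed.

Lemma dotvNl (R : realType) d (u w : 'rV[R]_d) : dotv (- u) w = - dotv u w.
Proof. by rewrite -scaleN1r dotvZl mulN1r. Qed.

Lemma dotvNr (R : realType) d (u w : 'rV[R]_d) : dotv w (- u) = - dotv w u.
Proof. by rewrite dotvC dotvNl dotvC. Qed.

Lemma dotvBl (R : realType) d (u v w : 'rV[R]_d) :
  dotv (u - v) w = dotv u w - dotv v w.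
Proof. by rewrite dotvDl dotvNl. Qed.

Lemma dotvBr (R : realType) d (u v w : 'rV[R]_d) :
  dotv w (u - v) = dotv w u - dotv w v.
Proof. by rewrite dotvDr dotvNr. Qed.

Lemma dotv0l (R : realType) d (w : 'rV[R]_d) : dotv 0 w = 0.
Proof. by rewrite -(scale0r w) dotvZl mul0r. Qed.

Lemma dotv0r (R : realType) d (w : 'rV[R]_d) : dotv w 0 = 0.
Proof. by rewrite dotvC dotv0l. Qed.

Lemma dotv_suml (R : realType) d (I : Type) (r : seq I) (P : pred I)
    (F : I -> 'rV[R]_d) w :
  dotv (\sum_(i <- r | P i) F i) w = \sum_(i <- r | P i) dotv (F i) w.
Proof.
by apply: (big_morph (fun u => dotv u w) (fun u v => dotvDl u v w) (dotv0l w)).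
Qed.

Lemma dotv_sumr (R : realType) d (I : Type) (r : seq I) (P : pred I)
    (F : I -> 'rV[R]_d) w :
  dotv w (\sum_(i <- r | P i) F i) = \sum_(i <- r | P i) dotv w (F i).
Proof. by rewrite dotvC dotv_suml; apply: eq_bigr => i _; rewrite dotvC. Qed.

Lemma dotvv_ge0 (R : realType) d (u : 'rV[R]_d) : 0 <= dotv u u.
Proof. by apply: sumr_ge0 => k _; rewrite -expr2 sqr_ge0. Qed.

Lemma dotvv_eq0 (R : realType) d (u : 'rV[R]_d) : (dotv u u == 0) = (u == 0).
Proof.
apply/eqP/eqP => [u0|->]; last exact: dotv0l.
apply/rowP => k; rewrite mxE; apply/eqP; rewrite -sqrf_eq0 expr2.
by apply/eqP/(psumr_eq0P _ u0) => // j _; rewrite -expr2 sqr_ge0.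
Qed.

Lemma dotvv_gt0 (R : realType) d (u : 'rV[R]_d) : (0 < dotv u u) = (u != 0).
Proof. by rewrite lt_def dotvv_ge0 dotvv_eq0 andbT. Qed.

Lemma dotvBB (R : realType) d (u v : 'rV[R]_d) :
  dotv (u - v) (u - v) = dotv u u - 2 * dotv u v + dotv v v.
Proof. by rewrite dotvBl !dotvBr (dotvC v u); ring. Qed.

Definition indep (R : realType) d (K : finType) (b : K -> 'rV[R]_d)
    (I : {set K}) : Prop :=
  forall l : K -> R, \sum_(i in I) l i *: b i = 0 -> {in I, forall i, l i = 0}.

Lemma indepS (R : realType) d (K : finType) (b : K -> 'rV[R]_d)
    (I J : {set K}) :
  I \subset J -> indep b J -> indep b I.
Proof.
move=> /fintype.subsetP IJ bJ l l0 i iI.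
have := bJ (fun i => if i \in I then l i else 0) _ i (IJ _ iI).
rewrite iI; apply; rewrite -[RHS]l0 big_mkcond [RHS]big_mkcond /=.
apply: eq_bigr => k _; case: ifPn => [//|kJ]; first by case: ifP; rewrite ?scale0r.
by case: ifP => // /IJ; rewrite (negbTE kJ).
Qed.

(** Gram-Schmidt; a generator whose residual vanishes is already in the span of
    the previous ones and imposes no new condition. *)
Lemma orthogonal_decomposition (R : realType) d (K : finType)
    (b : K -> 'rV[R]_d) (I : {set K}) (v : 'rV[R]_d) :
  exists l : K -> R,
    {in I, forall j, dotv (v - \sum_(i in I) l i *: b i) (b j) = 0}.
Proof.
suff H (s : seq K) : uniq s -> forall v, exists l : K -> R,
    {in s, forall j, dotv (v - \sum_(i <- s) l i *: b i) (b j) = 0}.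
  have [l lP] := H (enum I) (enum_uniq _) v; exists l => j jI.
  by have := lP j; rewrite big_enum; apply; rewrite mem_enum.
elim: s => [_ w|j s IH /= /andP[js us] w]; first by exists (fun=> 0).
have [lw lwP] := IH us w; have [lj ljP] := IH us (b j).
set rw := w - _ in lwP; set rj := b j - _ in ljP.
pose c := dotv rw rj / dotv rj rj.
exists (fun i => if i == j then c else lw i - c * lj i).
have -> : w - \sum_(i <- j :: s) (if i == j then c else lw i - c * lj i) *: b i
   = rw - c *: rj.
  rewrite big_cons eqxx /rw /rj.
  have -> : \sum_(i <- s) (if i == j then c else lw i - c * lj i) *: b i =
     \sum_(i <- s) lw i *: b i - c *: \sum_(i <- s) lj i *: b i.
    rewrite scaler_sumr -sumrB big_seq [RHS]big_seq; apply: eq_bigr => i si.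
    case: eqVneq => [ij|_]; first by rewrite -ij si in js.
    by rewrite scalerBl scalerA.
  by rewrite scalerBr !opprB opprD opprB !addrA [LHS](ACl (1*4*3*2)).
have rjs : dotv (rw - c *: rj) rj = 0.
  rewrite dotvBl dotvZl /c.
  have [/eqP rj0|rj0] := boolP (rj == 0).
    by rewrite rj0 !dotv0r mulr0 subrr.
  by rewrite divfK ?subrr // dotvv_eq0.
have orth i : i \in s -> dotv (rw - c *: rj) (b i) = 0.
  by move=> si; rewrite dotvBl dotvZl lwP // ljP // mulr0 subrr.
move=> i; rewrite inE => /orP[/eqP->|]; last exact: orth.
have -> : b j = rj + \sum_(i <- s) lj i *: b i by rewrite /rj subrK.
rewrite dotvDr rjs add0r dotv_sumr big_seq big1 // => k sk.
by rewrite dotvZr orth // mulr0.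
Qed.

Definition proj_coef (R : realType) d (K : finType) (b : K -> 'rV[R]_d)
    (I : {set K}) (v : 'rV[R]_d) : K -> R :=
  sval (cid (orthogonal_decomposition b I v)).

Definition residual (R : realType) d (K : finType) (b : K -> 'rV[R]_d)
    (I : {set K}) (v : 'rV[R]_d) : 'rV[R]_d :=
  v - \sum_(i in I) proj_coef b I v i *: b i.

Lemma residual_orth (R : realType) d (K : finType) (b : K -> 'rV[R]_d)
    (I : {set K}) v i :
  i \in I -> dotv (residual b I v) (b i) = 0.
Proof. by rewrite /residual /proj_coef; case: cid => l /= lP; exact: lP. Qed.

Lemma residualK (R : realType) d (K : finType) (b : K -> 'rV[R]_d)
    (I : {set K}) v :
  v = residual b I v + \sum_(i in I) proj_coef b I v i *: b i.
Proof. by rewrite subrK. Qed.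

Lemma dotv_span0 (R : realType) d (K : finType) (b : K -> 'rV[R]_d)
    (I : {set K}) (l : K -> R) p :
  {in I, forall i, dotv p (b i) = 0} -> dotv p (\sum_(i in I) l i *: b i) = 0.
Proof.
by move=> pI; rewrite dotv_sumr big1 // => i iI; rewrite dotvZr pI // mulr0.
Qed.

(** The component of [b i] orthogonal to the other generators.  For [i] in [I]
    the functional [dotv ^~ (height b I i)] reads off a positive multiple of
    the coefficient of [b i] in the projection onto the span of [I], and for
    [i] outside [I] the scalar product of [b i] with the residual: a single
    family of functionals describes all the regions below. *)
Definition height (R : realType) d (K : finType) (b : K -> 'rV[R]_d)
    (I : {set K}) (i : K) : 'rV[R]_d :=
  residual b (I :\ i) (b i).

Lemma height_orth (R : realType) d (K : finType) (b : K -> 'rV[R]_d)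
    (I : {set K}) i j :
  j \in I -> j != i -> dotv (height b I i) (b j) = 0.
Proof. by move=> jI ji; apply: residual_orth; rewrite !inE ji. Qed.

Lemma height_self (R : realType) d (K : finType) (b : K -> 'rV[R]_d)
    (I : {set K}) i :
  dotv (height b I i) (b i) = dotv (height b I i) (height b I i).
Proof.
rewrite {1}(residualK b (I :\ i) (b i)) dotvDr -/(height b I i).
by rewrite dotv_span0 ?addr0 // => j; exact: residual_orth.
Qed.

Lemma height_neq0 (R : realType) d (K : finType) (b : K -> 'rV[R]_d)
    (I : {set K}) i : indep b (i |: I) -> height b I i != 0.
Proof.
move=> bI; apply/eqP => h0.
have := bI (fun j => if j == i then 1 else - proj_coef b (I :\ i) (b i) j) _ i.
rewrite !inE eqxx => /(_ _ isT) H; suff /eqP : (1 : R) = 0 by rewrite oner_eq0.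
apply: H; rewrite (bigD1 i) /= ?inE ?eqxx // scale1r -[RHS]h0 /height /residual.
congr (_ + _); rewrite -sumrN; apply: eq_big => j.
  by rewrite !inE andb_orl andbN /= andbC.
by move=> /andP[_ /negbTE->]; rewrite scaleNr.
Qed.

Lemma dotv_height_in (R : realType) d (K : finType) (b : K -> 'rV[R]_d)
    (I : {set K}) (p : 'rV[R]_d) (l : K -> R) i :
  {in I, forall j, dotv p (b j) = 0} -> i \in I ->
  dotv (p + \sum_(j in I) l j *: b j) (height b I i) =
  l i * dotv (height b I i) (height b I i).
Proof.
move=> pI iI; rewrite dotvDl {1}/height /residual dotvBr pI // dotv_span0.
  rewrite subr0 add0r dotvC dotv_sumr (bigD1 i) //= big1 ?addr0 => [|j].
    by rewrite dotvZr height_self.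
  by case/andP=> jI ji; rewrite dotvZr height_orth ?mulr0.
by move=> j /finset.setD1P[_]; exact: pI.
Qed.

Lemma dotv_height_out (R : realType) d (K : finType) (b : K -> 'rV[R]_d)
    (I : {set K}) (p : 'rV[R]_d) (l : K -> R) i :
  {in I, forall j, dotv p (b j) = 0} -> i \notin I ->
  dotv (p + \sum_(j in I) l j *: b j) (height b I i) = dotv p (b i).
Proof.
move=> pI iI; rewrite dotvDl {1}/height /residual dotvBr dotv_span0.
  rewrite subr0 [X in _ + X]dotvC dotv_span0 ?addr0 // => j jI.
  by rewrite height_orth //; apply: contraNneq iI => <-.
by move=> j /finset.setD1P[_]; exact: pI.
Qed.

(** * Cones and the normal fan *)

Definition gcone (R : realType) d (K : finType) (b : K -> 'rV[R]_d)
    (M : {set K}) : set 'rV[R]_d :=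
  [set v | {in M, forall i, dotv v (b i) <= 0}].

(** By the Karush-Kuhn-Tucker conditions, [projects b M I x p] says that [p] is
    the metric projection of [x] on [gcone b M] and that [I] is the set of the
    constraints that are active at [p]. *)
Definition projects (R : realType) d (K : finType) (b : K -> 'rV[R]_d)
    (M I : {set K}) (x p : 'rV[R]_d) : Prop :=
  exists l : K -> R,
    [/\ x = p + \sum_(i in I) l i *: b i, {in I, forall i, 0 <= l i},
        {in I, forall i, dotv p (b i) = 0}
      & {in M :\: I, forall i, dotv p (b i) < 0}].

Definition region (R : realType) d (K : finType) (b : K -> 'rV[R]_d)
    (M I : {set K}) : set 'rV[R]_d :=
  [set x | exists p, projects b M I x p].

(** The multipliers and the slacks of the Karush-Kuhn-Tucker conditions are
    linear in [x], so that a region is a polyhedral cone; this makes it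
    measurable, and locally constant away from finitely many hyperplanes. *)
Lemma regionP (R : realType) d (K : finType) (b : K -> 'rV[R]_d)
    (M I : {set K}) (x : 'rV[R]_d) :
  indep b I ->
  region b M I x <-> {in I, forall i, 0 <= dotv x (height b I i)} /\
                     {in M :\: I, forall i, dotv x (height b I i) < 0}.
Proof.
move=> bI; split => [[p [l [-> l0 pI pM]]]|[h1 h2]].
  split=> i; first by move=> iI; rewrite dotv_height_in // mulr_ge0 ?l0 ?dotvv_ge0.
  by move=> /[dup] /finset.setDP[_ iI] iM; rewrite dotv_height_out // pM.
have xE := residualK b I x.
have rI : {in I, forall i, dotv (residual b I x) (b i) = 0}.
  by move=> i; exact: residual_orth.
exists (residual b I x), (proj_coef b I x); split=> // i iI.
  have := h1 i iI; rewrite {1}xE dotv_height_in // pmulr_lge0 // dotvv_gt0.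
  by apply: height_neq0; rewrite (finset.setUidPr _) ?finset.sub1set.
have := h2 i iI; case/finset.setDP: (iI) => _ iI'.
by rewrite {1}xE dotv_height_out.
Qed.

Lemma projects_polar (R : realType) d (K : finType) (b : K -> 'rV[R]_d)
    (M I : {set K}) (x p q : 'rV[R]_d) :
  I \subset M -> projects b M I x p -> gcone b M q -> dotv (x - p) q <= 0.
Proof.
move=> IM [l [-> l0 pI pM]] qC; rewrite addrAC subrr add0r dotv_suml.
apply: sumr_le0 => i iI; rewrite dotvZl dotvC mulr_ge0_le0 ?l0 //.
exact/qC/(fintype.subsetP IM).
Qed.

Lemma projects_orth (R : realType) d (K : finType) (b : K -> 'rV[R]_d)
    (M I : {set K}) (x p : 'rV[R]_d) :
  projects b M I x p -> dotv (x - p) p = 0.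
Proof.
by move=> [l [-> l0 pI pM]]; rewrite addrAC subrr add0r dotvC dotv_span0.
Qed.

Lemma projects_gcone (R : realType) d (K : finType) (b : K -> 'rV[R]_d)
    (M I : {set K}) (x p : 'rV[R]_d) :
  projects b M I x p -> gcone b M p.
Proof.
move=> [l [_ _ pI pM]] i iM; have [iI|iI] := boolP (i \in I).
  by rewrite pI.
by rewrite ltW // pM // inE iI.
Qed.

Lemma projects_active (R : realType) d (K : finType) (b : K -> 'rV[R]_d)
    (M I : {set K}) (x p : 'rV[R]_d) :
  I \subset M -> projects b M I x p -> I = [set i in M | dotv p (b i) == 0].
Proof.
move=> IM [l [_ _ pI pM]]; apply/setP => i; rewrite inE.
apply/idP/andP => [iI|[iM p0]]; first by rewrite (fintype.subsetP IM) // pI.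
apply/negPn/negP => iI; have := pM i; rewrite inE iI iM => /(_ isT).
by rewrite (eqP p0) ltxx.
Qed.

(** Both points are nearest to [x] in the convex cone. *)
Lemma projects_uniq (R : realType) d (K : finType) (b : K -> 'rV[R]_d)
    (M I I' : {set K}) (x p p' : 'rV[R]_d) :
  I \subset M -> I' \subset M ->
  projects b M I x p -> projects b M I' x p' -> p = p'.
Proof.
move=> IM IM' xp xp'; apply/eqP; rewrite -subr_eq0 -dotvv_eq0 eq_le dotvv_ge0.
rewrite andbT.
have := projects_polar IM xp (projects_gcone xp').
have := projects_polar IM' xp' (projects_gcone xp).
have := projects_orth xp; have := projects_orth xp'.
rewrite !(dotvBl, dotvBr) (dotvC p' p); lra.
Qed.

Lemma region_uniq (R : realType) d (K : finType) (b : K -> 'rV[R]_d)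
    (M I I' : {set K}) (x : 'rV[R]_d) :
  I \subset M -> I' \subset M -> region b M I x -> region b M I' x -> I = I'.
Proof.
move=> IM IM' [p xp] [p' xp'].
by rewrite (projects_active IM xp) (projects_active IM' xp') (projects_uniq IM IM' xp xp').
Qed.

(** * Generic points *)

Lemma scalar_avoid (R : realType) (s : seq R) (c : R) :
  0 < c -> exists2 t : R, 0 < t < c & t \notin s.
Proof.
elim: s c => [|b s IH] c c0.
  by exists (c / 2) => //; rewrite divr_gt0 // ltr_pdivrMr // ltr_pMr ?ltr1n.
have [|t /andP[t0 tc] ts] := IH (if 0 < b then Num.min b c else c).
  by case: ifP => // b0; rewrite lt_min b0.
have [b0|b0] := ltP 0 b.
  move: tc; rewrite b0 lt_min => /andP[tb tc]; exists t; rewrite ?t0 //.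
  by rewrite inE negb_or ts andbT lt_eqF.
move: tc; rewrite [0 < b]ltNge b0 /= => tc; exists t; rewrite ?t0 //.
by rewrite inE negb_or ts andbT gt_eqF // (le_lt_trans b0).
Qed.

(** A vector space is not a finite union of hyperplanes. *)
Lemma vector_avoid (R : realType) d (ws : seq 'rV[R]_d) :
  all (fun w => w != 0) ws ->
  exists x : 'rV[R]_d, all (fun w => dotv x w != 0) ws.
Proof.
elim: ws => [_|w ws IH /= /andP[w0 /IH[x xP]]]; first by exists 0.
have [t /andP[t0 _] tP] :=
  scalar_avoid [seq - dotv x u / dotv w u | u <- w :: ws] (@ltr01 R).
exists (x + t *: w); change (all (fun u => dotv (x + t *: w) u != 0) (w :: ws)).
apply/allP => u uws; apply/eqP; rewrite dotvDl dotvZl => /eqP.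
have [/eqP wu0|wu0] := boolP (dotv w u == 0).
  move: uws; rewrite wu0 mulr0 addr0 inE => /orP[/eqP uw|/(allP xP)/negbTE-> //].
  by move/eqP: wu0; rewrite uw dotvv_eq0 (negbTE w0).
rewrite addr_eq0 => /eqP xu; move/negP: tP; apply; apply/mapP; exists u => //.
by rewrite xu opprK mulfK.
Qed.

(** Move [x] a little along a vector that is orthogonal to no element of [ws],
    by a length that avoids finitely many values. *)
Lemma perturb (R : realType) d (x : 'rV[R]_d) (us ws : seq 'rV[R]_d) :
  all (fun w => w != 0) ws -> all (fun u => dotv x u != 0) us ->
  exists x' : 'rV[R]_d, all (fun w => dotv x' w != 0) ws /\
    {in us, forall u, (0 < dotv x' u) = (0 < dotv x u) /\
                      (dotv x' u < 0) = (dotv x u < 0)}.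
Proof.
move=> ws0 us0; have [z zP] := vector_avoid ws0.
have [t t0] : exists2 t : R, 0 < t & forall s, 0 < s < t ->
   {in us, forall u, (0 < dotv (x + s *: z) u) = (0 < dotv x u) /\
                      (dotv (x + s *: z) u < 0) = (dotv x u < 0)}.
  elim: us us0 => [_|u us IH /= /andP[xu /IH[t t0 tP]]]; first by exists 1.
  exists (Num.min t (`|dotv x u| / (1 + `|dotv z u|))).
    by rewrite lt_min t0 divr_gt0 ?normr_gt0 // ltr_pwDl.
  move=> s /andP[s0]; rewrite lt_min => /andP[st sb] v; rewrite inE => /orP[/eqP->|].
    move: sb; rewrite ltr_pdivlMr ?ltr_pwDl // => sb.
    have : `|s * dotv z u| < `|dotv x u|.
      by rewrite normrM gtr0_norm //; apply: le_lt_trans sb; rewrite ler_pM2l ?lerDr.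
    rewrite dotvDl dotvZl; move: (s * dotv z u) (dotv x u) xu => a c c0.
    by case: (ltrgtP c 0) c0 => // c0 _; [rewrite (ltr0_norm c0)|rewrite (gtr0_norm c0)];
      rewrite ltr_norml => /andP[? ?]; split; apply/idP/idP; lra.
  by apply: tP; rewrite s0.
move=> tP; have [c c0 cP] :=
  scalar_avoid [seq - dotv x w / dotv z w | w <- ws] t0.
exists (x + c *: z); split; last exact: tP.
apply/allP => w wws; rewrite dotvDl dotvZl addr_eq0; apply/eqP => xw.
move/negP: cP; apply; apply/mapP; exists w => //.
by rewrite xw opprK mulfK // (allP zP).
Qed.

(** * Existence of the metric projection *)

Lemma small_step (R : realType) (K : finType) (M : {set K}) (c e : K -> R) :
  {in M, forall i, c i < 0} ->
  exists2 t : R, 0 < t &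
    forall s, 0 <= s <= t -> {in M, forall i, c i + s * e i < 0}.
Proof.
move=> cM; suff [t t0 tP] : exists2 t : R, 0 < t &
    {in enum M, forall i, t * `|e i| < - c i}.
  exists t => // s /andP[s0 st] i iM; rewrite -ltrBrDl sub0r.
  have := tP i; rewrite mem_enum => /(_ iM); apply: le_lt_trans.
  apply: (@le_trans _ _ (s * `|e i|)); first by rewrite ler_wpM2l ?ler_norm.
  by rewrite ler_wpM2r.
have : {in enum M, forall i, c i < 0} by move=> i; rewrite mem_enum => /cM.
elim: (enum M) => [_|j s IH cs]; first by exists 1.
have [|t t0 tP] := IH; first by move=> i si; apply: cs; rewrite inE si orbT.
have cj : 0 < - c j by rewrite oppr_gt0 cs ?inE ?eqxx.
have q0 : 0 < - c j / (1 + `|e j|) by rewrite divr_gt0 ?ltr_pwDl.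
exists (Num.min t (- c j / (1 + `|e j|))); first by rewrite lt_min t0.
move=> i; rewrite inE => /orP[/eqP->|si]; last first.
  by apply: le_lt_trans (tP i si); rewrite ler_wpM2r // ge_min lexx.
apply: (@le_lt_trans _ _ (- c j / (1 + `|e j|) * `|e j|)).
  by rewrite ler_wpM2r // ge_min lexx orbT.
by rewrite -mulrA gtr_pMr // mulrC ltr_pdivrMr ?ltr_pwDl // mul1r ltrDr.
Qed.

Lemma cvg_sum (R : realType) (T : topologicalType) (K : Type) (s : seq K)
    (F : K -> T -> R) (v : T) :
  (forall k, F k u @[u --> v] --> F k v) ->
  \sum_(k <- s) F k u @[u --> v] --> \sum_(k <- s) F k v.
Proof.
move=> FP; elim: s => [|k s IH].
  rewrite (_ : (fun u => \sum_(k <- [::]) F k u) = fun=> 0).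
    by rewrite big_nil; exact: cvg_cst.
  by apply/funext => u; rewrite big_nil.
rewrite (_ : (fun u => \sum_(k <- k :: s) F k u) =
             fun u => F k u + \sum_(k <- s) F k u).
  by rewrite big_cons; exact: cvgD.
by apply/funext => u; rewrite big_cons.
Qed.

Lemma continuous_dotvl (R : realType) d (w : 'rV[R]_d) :
  continuous (fun v : 'rV[R]_d => dotv v w).
Proof.
move=> v; apply: (@cvg_sum R _ _ _ (fun k (u : 'rV[R]_d) => u 0 k * w 0 k)) => k.
by apply: (@continuousM R _ (fun u : 'rV[R]_d => u 0 k) (fun=> w 0 k) v);
  [exact: coord_continuous|exact: cst_continuous].
Qed.

Lemma continuous_dotvv (R : realType) d (x : 'rV[R]_d) :
  continuous (fun v : 'rV[R]_d => dotv (x - v) (x - v)).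
Proof.
move=> v.
apply: (@cvg_sum R _ _ _ (fun k (u : 'rV[R]_d) => (x - u) 0 k * (x - u) 0 k)) => k.
have xk : continuous_at v (fun u : 'rV[R]_d => (x - u) 0 k).
  rewrite (_ : (fun u : 'rV[R]_d => (x - u) 0 k) = fun u => x 0 k - u 0 k).
    by apply: (@continuousB _ _ _ (fun=> x 0 k) (fun u : 'rV[R]_d => u 0 k) v);
      [exact: cst_continuous|exact: coord_continuous].
  by apply/funext => u; rewrite !mxE.
exact: (continuousM xk xk).
Qed.

Lemma closed_gcone (R : realType) d (K : finType) (b : K -> 'rV[R]_d)
    (M : {set K}) : closed (gcone b M).
Proof.
rewrite (_ : gcone b M = \bigcap_(i in [set i | i \in M])
    ((fun v => dotv v (b i)) @^-1` [set r | r <= 0])); last first.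
  by apply/seteqP; split => v vC i iM; exact: vC.
apply: closed_bigI => i _; apply: closed_comp; last exact: closed_le.
by move=> v _; exact: continuous_dotvl.
Qed.

(** The distance to [x] attains its minimum on the compact part of the cone that
    is no farther from [x] than the origin. *)
Lemma gcone_nearest (R : realType) d (K : finType) (b : K -> 'rV[R]_d)
    (M : {set K}) (x : 'rV[R]_d) :
  exists2 p, gcone b M p &
    forall q, gcone b M q -> dotv (x - p) (x - p) <= dotv (x - q) (x - q).
Proof.
pose f (q : 'rV[R]_d) := dotv (x - q) (x - q).
pose A := gcone b M `&` [set q | f q <= f 0].
have C0 : gcone b M 0 by move=> i _; rewrite dotv0l.
have A0 : A !=set0 by exists 0; split => /=.
have clA : closed A.
  apply: closedI; first exact: closed_gcone.
  apply: (@closed_comp _ _ f [set r | r <= f 0]); last exact: closed_le.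
  by move=> v _; exact: continuous_dotvv.
have coord (u : 'rV[R]_d) k : dotv u u <= f 0 -> `|u 0 k| <= 1 + f 0.
  move=> uf; have uk : u 0 k * u 0 k <= dotv u u.
    by rewrite /dotv (bigD1 k) //= lerDl sumr_ge0 // => i _; rewrite -expr2 sqr_ge0.
  have f0 : 0 <= f 0 by exact: dotvv_ge0.
  by rewrite ler_norml; apply/andP; split; nra.
have cA : compact A.
  pose m := 2 * (1 + f 0).
  have box : compact [set v : 'rV[R]_d | forall i, v ord0 i \in `[- m, m]].
    apply: (@rV_compact _  _ (fun=> `[- m, m]%classic)) => _.
    exact: segment_compact.
  apply: subclosed_compact clA box _ => v [_ vf] i.
  have := coord _ i vf; have := coord x i; rewrite /f subr0 lexx => /(_ isT).
  rewrite -/(f 0) !mxE in_itv /= /m !ler_norml /f subr0; lra.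
have [|p pA pmin] := @compact_EVT_min _ R f A A0 cA.
  by apply: continuous_subspaceT; exact: continuous_dotvv.
move: pA; rewrite inE => -[pC pf]; exists p => // q qC.
have [qf|qf] := leP (f q) (f 0); first by apply: pmin; rewrite inE.
exact/ltW/(le_lt_trans pf).
Qed.

(** Only the constraints active at the minimizer matter for small
    displacements; if these are independent, testing their dual basis gives
    the multipliers without Farkas' lemma. *)
Lemma nearest_projects (R : realType) d (K : finType) (b : K -> 'rV[R]_d)
    (M : {set K}) (x p : 'rV[R]_d) :
  gcone b M p ->
  (forall q, gcone b M q -> dotv (x - p) (x - p) <= dotv (x - q) (x - q)) ->
  indep b [set i in M | dotv p (b i) == 0] ->
  projects b M [set i in M | dotv p (b i) == 0] x p.
Proof.
move=> pC pmin; set I := [set i in M | _] => bI.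
(* otherwise a small displacement along [u] would come closer to [x] *)
have step u : {in I, forall i, dotv u (b i) <= 0} -> dotv (x - p) u <= 0.
  move=> uI; have [|t t0 tP] :=
      @small_step R K (M :\: I) (fun i => dotv p (b i)) (fun i => dotv u (b i)).
    move=> i /finset.setDP[iM]; rewrite inE iM /= => pi0.
    by rewrite lt_neqAle pi0 pC.
  rewrite leNgt; apply/negP => w0.
  have uu := dotvv_ge0 u.
  pose s := Num.min t (dotv (x - p) u / (1 + dotv u u)).
  have s0 : 0 < s by rewrite lt_min t0 divr_gt0 // ltr_pwDl.
  have su : s * (1 + dotv u u) <= dotv (x - p) u.
    by rewrite -ler_pdivlMr ?ltr_pwDl // ge_min lexx orbT.
  have st : s <= t by rewrite ge_min lexx.
  have : gcone b M (p + s *: u).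
    move=> i iM; rewrite dotvDl dotvZl; have [iI|iI] := boolP (i \in I).
      have := iI; rewrite inE => /andP[_ /eqP->]; rewrite add0r.
      by rewrite mulr_ge0_le0 ?(ltW s0) ?uI.
    by apply/ltW/tP; [rewrite st ltW|apply/finset.setDP].
  move/pmin; rewrite opprD addrA (dotvBB (x - p)) dotvZl !dotvZr; nra.
have wE := residualK b I (x - p).
set r := residual b I (x - p) in wE; set l := proj_coef b I (x - p) in wE.
have rI : {in I, forall i, dotv r (b i) = 0} by move=> i; exact: residual_orth.
have r0 : r = 0.
  apply/eqP; rewrite -dotvv_eq0 eq_le dotvv_ge0 andbT.
  have := step r; rewrite {1}wE dotvDl [X in _ + X]dotvC dotv_span0 // addr0.
  by apply=> i iI; rewrite rI.
exists l; split.
- by apply/eqP; rewrite addrC -subr_eq {1}wE r0 add0r.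
- move=> i iI; have := step (- height b I i).
  rewrite wE r0 dotvNr dotv_height_in //; last by move=> j _; rewrite dotv0l.
  rewrite oppr_le0 pmulr_lge0; last first.
    by rewrite dotvv_gt0 height_neq0 // (finset.setUidPr _) ?finset.sub1set.
  apply=> j jI; rewrite dotvNl oppr_le0; have [->|ji] := eqVneq j i.
    by rewrite height_self dotvv_ge0.
  by rewrite height_orth.
- by move=> i; rewrite inE => /andP[_ /eqP].
- move=> i /finset.setDP[iM]; rewrite inE iM /= => pi0.
  by rewrite lt_neqAle pi0 pC.
Qed.

(** The active set of the nearest point is the index of the region. *)
Lemma region_exists (R : realType) d (K : finType) (b : K -> 'rV[R]_d)
    (M : {set K}) (x : 'rV[R]_d) :
  indep b M -> exists2 I : {set K}, I \subset M & region b M I x.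
Proof.
move=> bM; have [p pC pmin] := gcone_nearest b M x.
exists [set i in M | dotv p (b i) == 0].
  by apply/fintype.subsetP => i; rewrite inE => /andP[].
exists p; apply: nearest_projects => //; apply: indepS bM.
by apply/fintype.subsetP => i; rewrite inE => /andP[].
Qed.

(** * Signed chains *)

Definition signed_perm (n : nat) := ({ffun 'I_n -> bool} * 'S_n)%type.

(** For both types the chamber of the signed permutation [t] is cut out by the
    vectors of the chain of [t]; in type A the sign pattern is trivial and the
    last vector is left out. *)
Definition chain (R : realType) d n (y : 'I_n -> 'rV[R]_d) (t : signed_perm n)
    (i : 'I_n) : 'rV[R]_d :=
  (-1) ^+ t.1 (t.2 i) *: y (t.2 i)
    - (if (i.+1 < n)%N then (-1) ^+ t.1 (t.2 (ordS i)) *: y (t.2 (ordS i))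
       else 0).

Definition normals (n : nat) (B : bool) : {set 'I_n} :=
  [set i : 'I_n | B || (i.+1 < n)%N].

Definition evec (R : realType) n (a : 'I_n) : 'rV[R]_n := delta_mx 0 a.

Arguments evec : clear implicits.

Lemma ordS_val n (i : 'I_n) : (i.+1 < n)%N -> ordS i = i.+1 :> nat.
Proof. by move=> lt_in; rewrite /= modn_small. Qed.

Definition scoord (R : realType) n (t : signed_perm n) (c : 'rV[R]_n)
    (i : 'I_n) : R :=
  (-1) ^+ t.1 (t.2 i) * c 0 (t.2 i).

Definition cum (R : realType) n (t : signed_perm n) (c : 'rV[R]_n)
    (i : 'I_n) : R :=
  \sum_(k < n | (k <= i)%N) scoord t c k.

Lemma dotv_evec (R : realType) n (c : 'rV[R]_n) a : dotv c (evec R n a) = c 0 a.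
Proof.
rewrite /dotv (bigD1 a) //= big1 ?addr0 => [|k /negbTE ka]; rewrite mxE eqxx.
  by rewrite eqxx mulr1.
by rewrite /= ka mulr0.
Qed.

Lemma dotv_chain_evec (R : realType) n (t : signed_perm n) (c : 'rV[R]_n) i :
  dotv c (chain (evec R n) t i) =
  scoord t c i - (if (i.+1 < n)%N then scoord t c (ordS i) else 0).
Proof.
rewrite dotvBr dotvZr dotv_evec; congr (_ - _).
by case: ifP => _; rewrite ?dotv0r // dotvZr dotv_evec.
Qed.

Lemma scoordD (R : realType) n (t : signed_perm n) (c c' : 'rV[R]_n) i :
  scoord t (c + c') i = scoord t c i + scoord t c' i.
Proof. by rewrite /scoord mxE mulrDr. Qed.

Lemma scoordZ (R : realType) n (t : signed_perm n) a (c : 'rV[R]_n) i :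
  scoord t (a *: c) i = a * scoord t c i.
Proof. by rewrite /scoord mxE mulrCA. Qed.

Lemma scoordB (R : realType) n (t : signed_perm n) (c c' : 'rV[R]_n) i :
  scoord t (c - c') i = scoord t c i - scoord t c' i.
Proof. by rewrite /scoord !mxE mulrBr. Qed.

Lemma scoord_sum (R : realType) n (t : signed_perm n) (I : Type) (r : seq I)
    (P : pred I) (F : I -> 'rV[R]_n) i :
  scoord t (\sum_(j <- r | P j) F j) i = \sum_(j <- r | P j) scoord t (F j) i.
Proof.
apply: (big_morph (fun c => scoord t c i)) => [c c'|]; first exact: scoordD.
by rewrite /scoord mxE mulr0.
Qed.

Lemma scoord_chain (R : realType) n (t : signed_perm n) (j i : 'I_n) :
  scoord t (chain (evec R n) t j) i =
  (j == i)%:R - ((j.+1 < n)%N && (ordS j == i))%:R.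
Proof.
have E k : scoord t ((-1) ^+ t.1 (t.2 k) *: evec R n (t.2 k)) i = (k == i)%:R.
  rewrite /scoord !mxE eqxx /= (inj_eq perm_inj) eq_sym.
  by case: eqVneq => [->|_]; rewrite ?mulr0 // mulr1 -expr2 sqrr_sign.
rewrite scoordB E; congr (_ - _).
by case: ifP => _ //=; rewrite /scoord mxE mulr0.
Qed.

Lemma cumD (R : realType) n (t : signed_perm n) (c c' : 'rV[R]_n) i :
  cum t (c + c') i = cum t c i + cum t c' i.
Proof. by rewrite /cum -big_split; apply: eq_bigr => k _; rewrite scoordD. Qed.

Lemma cum_sum (R : realType) n (t : signed_perm n) (I : {set 'I_n})
    (l : 'I_n -> R) (F : 'I_n -> 'rV[R]_n) i :
  cum t (\sum_(j in I) l j *: F j) i = \sum_(j in I) l j * cum t (F j) i.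
Proof.
rewrite /cum; under [LHS]eq_bigr do rewrite scoord_sum.
rewrite exchange_big /=; apply: eq_bigr => j _.
by rewrite mulr_sumr; apply: eq_bigr => k _; rewrite scoordZ.
Qed.

(** Partial sums along the chain form the basis dual to the chain of the
    standard basis, by telescoping. *)
Lemma cum_chain (R : realType) n (t : signed_perm n) (j i : 'I_n) :
  cum t (chain (evec R n) t j) i = (j == i)%:R.
Proof.
have S1 (k : 'I_n) : \sum_(m < n | (m <= i)%N) (k == m)%:R = (k <= i)%:R :> R.
  rewrite -natr_sum; congr _%:R; rewrite big_mkcond (bigD1 k) //= eqxx.
  rewrite big1 => [|m /negbTE mk]; first by case: leqP.
  by rewrite eq_sym mk; case: ifP.
rewrite /cum; under eq_bigr do rewrite scoord_chain.
rewrite sumrB S1; have [jn|jn] := boolP (j.+1 < n)%N => /=; last first.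
  have -> : (j <= i)%N = (j == i).
    rewrite -val_eqE /= eqn_leq; case: leqP => //= _.
    by rewrite -ltnS (leq_trans (ltn_ord i)) // leqNgt.
  by rewrite big1 ?subr0.
rewrite S1 ordS_val // -val_eqE /= [(j <= i)%N]leq_eqVlt.
by case: eqVneq => [->|]; rewrite ?ltnn ?subr0 //=; rewrite subrr.
Qed.

Lemma cum_lin (R : realType) n (t : signed_perm n) (I : {set 'I_n})
    (l : 'I_n -> R) i :
  cum t (\sum_(j in I) l j *: chain (evec R n) t j) i =
  if i \in I then l i else 0.
Proof.
rewrite cum_sum; under eq_bigr do rewrite cum_chain.
case: ifPn => iI; last first.
  rewrite big1 // => j jI; case: eqVneq => [ji|_]; last by rewrite mulr0.
  by rewrite -ji jI in iI.
rewrite (bigD1 i) //= eqxx mulr1 big1 ?addr0 // => j /andP[_ /negbTE->].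
by rewrite mulr0.
Qed.

Lemma cum_inj (R : realType) n (t : signed_perm n) (c c' : 'rV[R]_n) :
  cum t c =1 cum t c' -> c = c'.
Proof.
move=> cc'; suff H m : forall i : 'I_n, (i <= m)%N -> scoord t c i = scoord t c' i.
  apply/rowP => a; have := H _ ((t.2)^-1%g a) (leqnn _).
  by rewrite /scoord permKV => /(mulfI (negbT (signr_eq0 _ _))).
elim/ltn_ind: m => m IH i im; have := cc' i; rewrite /cum.
rewrite (bigD1 i) //= [in RHS](bigD1 i) //=.
rewrite (eq_bigr (scoord t c')) => [/addIr //|k /andP[ki ik]].
have ltki : (k < i)%N by rewrite ltn_neqAle ki andbT.
by apply: (IH k) => //; apply: leq_trans im.
Qed.

Lemma indep_chain_evec (R : realType) n (t : signed_perm n) (I : {set 'I_n}) :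
  indep (chain (evec R n) t) I.
Proof.
move=> l l0 i iI; have := cum_lin t I l i; rewrite iI l0 => <-.
by rewrite /cum big1 // => k _; rewrite /scoord mxE mulr0.
Qed.

Lemma cum_lin_exp (R : realType) n (t : signed_perm n) (I : {set 'I_n})
    (c : 'rV[R]_n) :
  (forall i, i \notin I -> cum t c i = 0) ->
  c = \sum_(i in I) cum t c i *: chain (evec R n) t i.
Proof.
move=> c0; apply: (@cum_inj _ _ t) => i.
by rewrite cum_lin; case: ifPn => // /c0.
Qed.

(** * From projections to permutations *)

(** A cyclic permutation of each maximal run of consecutive positions joined
    by [J].  The invariance clause is stated for functions with arbitrary
    values, so that it also expresses that the runs are stable. *)
Lemma run_cycle_exists n (J : {set 'I_n}) :
  J \subset normals n false ->
  exists g : 'S_n, {in J, forall i, g i = ordS i} /\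
    forall (T : Type) (f : 'I_n -> T),
      {in J, forall i, f (ordS i) = f i} -> forall i, f (g i) = f i.
Proof.
have [m] := ubnP #|J|; elim: m J => // m IH J; rewrite ltnS => Jm JM.
have [->|[j0 j0J]] := finset.set_0Vmem J.
  by exists 1%g; split=> [i|T f _ i]; rewrite ?perm1 // inE.
have [j jJ jmax] := arg_maxnP (fun i : 'I_n => nat_of_ord i) j0J.
have {}jJ : j \in J by [].
have valS i : i \in J -> ordS i = i.+1 :> nat.
  by move=> /(fintype.subsetP JM); rewrite inE; exact: ordS_val.
have ordE (u w : 'I_n) : (u == w) = (nat_of_ord u == nat_of_ord w) by [].
have J'J : J :\ j \subset J by apply: finset.subD1set.
have [|//|g [gJ gf]] := IH (J :\ j); last 1 first.
- have gjS : g (ordS j) = ordS j.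
    have inv : {in J :\ j, forall i, (ordS i == ordS j) = (i == ordS j)}.
      move=> i; rewrite !inE => /andP[ij iJ]; rewrite !ordE !valS //.
      have lt_ij : (i < j)%N by rewrite ltn_neqAle -ordE ij; exact: jmax.
      by rewrite eqSS (ltn_eqF lt_ij) ltn_eqF // ltnS ltnW.
    by have := gf _ (fun i => i == ordS j) inv (ordS j); rewrite /= eqxx => /eqP.
  exists (tperm j (ordS j) * g)%g; split=> [i iJ|T f fJ i].
    rewrite permM; have [->|ij] := eqVneq i j; first by rewrite tpermL.
    have lt_ij : (i < j)%N by rewrite ltn_neqAle -ordE ij; exact: jmax.
    rewrite tpermD; first by rewrite gJ // !inE ij.
      by rewrite eq_sym.
    by rewrite ordE valS // gtn_eqF // ltnS ltnW.
  rewrite permM gf => [|k /finset.setD1P[_]]; last exact: fJ.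
  by case: tpermP => // [->|->]; rewrite fJ.
- by rewrite (leq_trans _ Jm) // [X in (_ < X)%N](cardsD1 j) jJ.
- exact: fintype.subset_trans JM.
Qed.

Definition run_cycle n (J : {set 'I_n}) : 'S_n :=
  if pselect (J \subset normals n false) is left JM
  then sval (cid (run_cycle_exists JM)) else 1%g.

Lemma run_cycleP n (J : {set 'I_n}) :
  J \subset normals n false ->
  {in J, forall i, run_cycle J i = ordS i} /\
  forall (T : Type) (f : 'I_n -> T),
    {in J, forall i, f (ordS i) = f i} -> forall i, f (run_cycle J i) = f i.
Proof. by rewrite /run_cycle; case: pselect => // JM _; case: cid. Qed.

(** The cycles of this permutation of the letters are the runs of the word [s]
    delimited by [J]. *)
Definition word_cycle n (s : 'S_n) (J : {set 'I_n}) : 'S_n :=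
  (run_cycle J ^ s)%g.

Lemma word_cycleE n (s : 'S_n) (J : {set 'I_n}) i :
  word_cycle s J (s i) = s (run_cycle J i).
Proof. by rewrite /word_cycle /conjg !permM permK. Qed.

(** In the coordinate space the projection [p] of [x] on the type A chamber of
    [t] is the isotonic regression of the signed entries of [x]: the signed
    entries of [p], its slopes, increase along the word and are constant on its
    runs; the multipliers, attached to the letters, are the slacks between the
    partial sums of the two sequences. *)
Definition slope (R : realType) n (t : signed_perm n) (p : 'rV[R]_n) (a : 'I_n)
  : R := (-1) ^+ t.1 a * p 0 a.

Definition slack (R : realType) n (s : 'S_n) (J : {set 'I_n}) (l : 'I_n -> R)
  (a : 'I_n) : R := if (s^-1%g a) \in J then l (s^-1%g a) else 0.

Section Walk.
Context (R : realType) (n : nat) (t : signed_perm n) (J : {set 'I_n}).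
Context (x p : 'rV[R]_n) (l : 'I_n -> R).
Context (JM : J \subset normals n false).
Context (xE : x = p + \sum_(i in J) l i *: chain (evec R n) t i).
Context (l_gt0 : {in J, forall i, 0 < l i}).
Context (pJ : {in J, forall i, dotv p (chain (evec R n) t i) = 0}).
Context (pM : {in normals n false :\: J,
                 forall i, dotv p (chain (evec R n) t i) < 0}).

Local Notation s := t.2.
Local Notation q := (slope t p).
Local Notation lam := (slack s J l).
Local Notation sigma := (word_cycle s J).

Lemma walk_ltn (i : 'I_n) : i \in J -> (i.+1 < n)%N.
Proof. by move=> /(fintype.subsetP JM); rewrite inE. Qed.

Lemma slope_in (i : 'I_n) : i \in J -> q (s (ordS i)) = q (s i).
Proof.
move=> iJ; have := pJ iJ; rewrite dotv_chain_evec walk_ltn //.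
by move=> /eqP; rewrite subr_eq0 => /eqP/esym.
Qed.

Lemma slope_out (i : 'I_n) : (i.+1 < n)%N -> i \notin J -> q (s i) < q (s (ordS i)).
Proof.
move=> lt_in iJ; have := pM (x := i); rewrite !inE iJ lt_in => /(_ isT).
by rewrite dotv_chain_evec lt_in subr_lt0.
Qed.

Lemma slope_le (i k : 'I_n) : (i <= k)%N -> q (s i) <= q (s k).
Proof.
move=> ik; have [m] := ubnP (k - i); elim: m i ik => // m IH i ik kim.
have [/val_inj-> //|lt_ik] := eqVneq (val i) (val k).
have {}lt_ik : (i < k)%N by rewrite ltn_neqAle lt_ik ik.
have lt_in : (i.+1 < n)%N by apply: leq_ltn_trans (ltn_ord k).
have Sk : q (s (ordS i)) <= q (s k).
  apply: IH; first by rewrite ordS_val.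
  rewrite ordS_val // subnS; move: lt_ik kim; rewrite -subn_gt0.
  by case: (k - i)%N.
apply: le_trans Sk; have [iJ|iJ] := boolP (i \in J); first by rewrite slope_in.
by rewrite ltW // slope_out.
Qed.

Lemma slope_lt (i k : 'I_n) : (i < k)%N -> i \notin J -> q (s i) < q (s k).
Proof.
move=> lt_ik iJ; have lt_in : (i.+1 < n)%N by apply: leq_ltn_trans (ltn_ord k).
by apply: lt_le_trans (slope_out lt_in iJ) (slope_le _); rewrite ordS_val.
Qed.

Lemma word_cycle_in (i : 'I_n) : i \in J -> sigma (s i) = s (ordS i).
Proof. by move=> iJ; rewrite word_cycleE (run_cycleP JM).1. Qed.

Lemma slope_cycle a : q (sigma a) = q a.
Proof.
rewrite -(permKV s a) word_cycleE.
exact: ((run_cycleP JM).2 _ (q \o s) slope_in).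
Qed.

Lemma slope_cycleX m a : q ((sigma ^+ m)%g a) = q a.
Proof.
by elim: m => [|m IH]; rewrite ?expg0 ?perm1 // expgSr permM slope_cycle.
Qed.

Lemma slope_porbit a b : b \in porbit sigma a -> q b = q a.
Proof. by case/porbitP => m ->; exact: slope_cycleX. Qed.

(** Between two positions with the same slope all steps are joined. *)
Lemma walk_iter (i k : 'I_n) : (i <= k)%N -> q (s i) = q (s k) ->
  forall m (j : 'I_n), j = (i + m)%N :> nat -> (j <= k)%N ->
  (sigma ^+ m)%g (s i) = s j.
Proof.
move=> ik qik; elim=> [|m IH] j jE jk.
  by rewrite expg0 perm1; congr (s _); apply/val_inj; rewrite /= jE addn0.
have lt_n : (i + m < n)%N.
  by rewrite (leq_trans _ (ltn_ord j)) // jE addnS.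
have -> : j = ordS (Ordinal lt_n).
  by apply: ord_inj; rewrite ordS_val /= ?jE ?addnS // -addnS -jE.
have lt_mk : (i + m < k)%N by rewrite (leq_trans _ jk) // jE addnS.
rewrite expgSr permM (IH (Ordinal lt_n)) //=; last exact: ltnW.
apply: word_cycle_in; apply/negPn/negP => /(slope_lt (i := Ordinal lt_n) lt_mk).
by rewrite -qik ltNge slope_le //= leq_addr.
Qed.

Lemma porbit_slope a b : (b \in porbit sigma a) = (q b == q a).
Proof.
apply/idP/eqP => [/slope_porbit //|].
rewrite -(permKV s a) -(permKV s b) => qba.
set i := s^-1%g a in qba *; set k := s^-1%g b in qba *.
have [ik|/ltnW ki] := leqP i k.
  have <- := walk_iter ik (esym qba) (esym (subnKC ik)) (leqnn k).
  exact: mem_porbit.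
rewrite porbit_sym.
have <- := walk_iter ki qba (esym (subnKC ki)) (leqnn i).
exact: mem_porbit.
Qed.

Lemma slack_ge0 a : 0 <= lam a.
Proof. by rewrite /slack; case: ifP => // /l_gt0/ltW. Qed.

Lemma slack_eq0 i : (lam (s i) == 0) = (i \notin J).
Proof. by rewrite /slack permK; case: ifPn => [/l_gt0/gt_eqF|_]; rewrite ?eqxx. Qed.

(** The last position whose entry lies in the cycle of [a]: were it joined to
    the next one, the next entry would lie in the same cycle. *)
Lemma walk_last a : exists i : 'I_n,
  [/\ s i \in porbit sigma a, i \notin J &
      forall k : 'I_n, s k \in porbit sigma a -> (k <= i)%N].
Proof.
have H : s (s^-1%g a) \in porbit sigma a by rewrite permKV porbit_id.
have [i iP imax] := @arg_maxnP _ (s^-1%g a) (fun k => s k \in porbit sigma a)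
  (fun i : 'I_n => nat_of_ord i) H.
exists i; split=> //; apply/negP => iJ.
have : (ordS i <= i)%N.
  by apply: imax; rewrite -word_cycle_in // porbit_slope slope_cycle -porbit_slope.
by rewrite ordS_val ?walk_ltn // ltnn.
Qed.

Lemma slack_zero a : exists2 b, b \in porbit sigma a & lam b = 0.
Proof.
by have [i [ia iJ _]] := walk_last a; exists (s i) => //; apply/eqP; rewrite slack_eq0.
Qed.

(** Inside a run, the slack of a letter minus that of the letter before it is
    the excess of the entry over the slope; at the start of a run the
    predecessor in the cycle is the last letter of the run, whose slack is 0. *)
Lemma walk_coboundary a :
  (-1) ^+ t.1 a * x 0 a - q a = lam a - lam (sigma^-1%g a).
Proof.
rewrite -(permKV s a); set k := s^-1%g a.
have -> : sigma^-1%g (s k) = s ((run_cycle J)^-1%g k).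
  by apply: (@perm_inj _ sigma); rewrite permKV word_cycleE permKV.
have := scoordD t p (\sum_(i in J) l i *: chain (evec R n) t i) k.
rewrite -xE {1}/scoord => ->; rewrite addrAC subrr add0r scoord_sum.
under eq_bigr do rewrite scoordZ scoord_chain mulrBr.
rewrite sumrB /slack !permK; congr (_ - _).
  case: ifPn => kJ; last first.
    rewrite big1 // => i iJ; case: eqVneq => [ik|_]; rewrite ?mulr0 //.
    by rewrite -ik iJ in kJ.
  rewrite (bigD1 k) //= eqxx mulr1 big1 ?addr0 // => i /andP[_ /negbTE->].
  by rewrite mulr0.
have E i : i \in J -> ((i.+1 < n)%N && (ordS i == k)) = (i == (run_cycle J)^-1%g k).
  move=> iJ; rewrite walk_ltn //= -(run_cycleP JM).1 //.
  by rewrite -(inj_eq (@perm_inj _ (run_cycle J)) i) permKV.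
rewrite (eq_bigr (fun i => l i * (i == (run_cycle J)^-1%g k)%:R)) => [|i iJ].
  set k' := (run_cycle J)^-1%g k; case: ifPn => kJ; last first.
    rewrite big1 // => i iJ; case: eqVneq => [ik|_]; rewrite ?mulr0 //.
    by rewrite -ik iJ in kJ.
  rewrite (bigD1 k') //= eqxx mulr1 big1 ?addr0 // => i /andP[_ /negbTE->].
  by rewrite mulr0.
by rewrite E.
Qed.

Lemma porbit_stable_sum (f : 'I_n -> R) (g : 'S_n) a :
  \sum_(b in porbit g a) f (g^-1%g b) = \sum_(b in porbit g a) f b.
Proof.
rewrite (reindex_inj (@perm_inj _ g)) /=; apply: eq_big => [b|b _]; last by rewrite permK.
by rewrite -!eq_porbit_mem -{2}(expg1 g) porbit_perm.
Qed.

(** So the slope of a run is the mean of its entries: it depends on the word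
    only through the cycle. *)
Lemma slope_average a :
  #|porbit sigma a|%:R * q a =
  \sum_(b in porbit sigma a) (-1) ^+ t.1 b * x 0 b.
Proof.
have -> : \sum_(b in porbit sigma a) (-1) ^+ t.1 b * x 0 b =
    \sum_(b in porbit sigma a) (q b + (lam b - lam (sigma^-1%g b))).
  by apply: eq_bigr => b _; rewrite -walk_coboundary addrC subrK.
rewrite big_split /= sumrB porbit_stable_sum subrr addr0.
rewrite (eq_bigr (fun=> q a)) => [|b]; last by move/slope_porbit.
by rewrite sumr_const mulr_natl.
Qed.

(** The order of the entries of [s] is determined by the slopes, the slacks and
    the permutation [sigma]. *)
Lemma walk_order a b :
  (s^-1%g a <= s^-1%g b)%N <->
  q a < q b \/ exists m, b = (sigma ^+ m)%g a /\
                 forall j, (j < m)%N -> lam ((sigma ^+ j)%g a) != 0.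
Proof.
rewrite -{2 3 4}(permKV s a) -{2 3}(permKV s b).
set i := s^-1%g a; set k := s^-1%g b; split=> [ik|].
  have := slope_le ik; rewrite le_eqVlt => /orP[/eqP qik|]; last by left.
  right; exists (k - i)%N; split=> [|j jki].
    by rewrite (walk_iter ik qik (esym (subnKC ik))).
  have lt_jk : (i + j < k)%N by rewrite -ltn_subRL.
  have lt_n : (i + j < n)%N by apply: ltn_trans (ltn_ord k).
  rewrite (walk_iter ik qik (j := Ordinal lt_n)) //=; last exact: ltnW.
  rewrite slack_eq0 negbK; apply/negPn/negP => /(slope_lt (i := Ordinal lt_n) lt_jk).
  by rewrite -qik ltNge slope_le //= leq_addr.
case=> [qik|[m [kE mP]]].
  by rewrite leqNgt; apply/negP => /ltnW/slope_le; rewrite leNgt qik.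
have H j : (j <= m)%N -> exists2 r : 'I_n, r = (i + j)%N :> nat & (sigma ^+ j)%g (s i) = s r.
  elim: j => [_|j IH jm]; first by exists i; rewrite ?addn0 // expg0 perm1.
  have [r rE sr] := IH (ltnW jm).
  have rJ : r \in J by have := mP j jm; rewrite sr slack_eq0 negbK.
  exists (ordS r); first by rewrite ordS_val ?walk_ltn // rE addnS.
  by rewrite expgSr permM sr word_cycle_in.
have [r rE] := H m (leqnn m).
by rewrite -kE => /perm_inj ->; rewrite rE leq_addr.
Qed.

End Walk.

Lemma perm_order_inj n (s s' : 'S_n) :
  (forall a b, (s^-1%g a <= s^-1%g b)%N = (s'^-1%g a <= s'^-1%g b)%N) -> s = s'.
Proof.
move=> ss'; have H (u : 'S_n) a : \sum_(b < n | ~~ (u^-1%g a <= u^-1%g b)%N) 1%N = u^-1%g a.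
  rewrite (reindex_inj (@perm_inj _ u)) /=.
  transitivity (\sum_(k < n | (k < u^-1%g a)%N) 1)%N.
    by apply: eq_bigl => k; rewrite permK -ltnNge.
  rewrite -(@big_ord_widen _ _ addn (u^-1%g a) n (fun=> 1%N)) 1?ltnW //.
  by rewrite sum1_card card_ord.
apply: invg_inj; apply/permP => a; apply: ord_inj.
rewrite -(H s a) -(H s' a); apply: eq_bigl => b.
by rewrite (ss' a b).
Qed.

Definition walk (R : realType) n (t : signed_perm n) (J : {set 'I_n})
    (x p : 'rV[R]_n) (l : 'I_n -> R) : Prop :=
  [/\ J \subset normals n false,
      x = p + \sum_(i in J) l i *: chain (evec R n) t i,
      {in J, forall i, 0 < l i},
      {in J, forall i, dotv p (chain (evec R n) t i) = 0}
    & {in normals n false :\: J,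
        forall i, dotv p (chain (evec R n) t i) < 0}].

(** For a fixed point [x], the cycles determine the word.  The slopes are the
    means over the cycles.  The difference of two slacks with the same
    coboundary is constant on the cycles; as both slacks are nonnegative and
    vanish somewhere on every cycle, they agree.  Slopes and slacks determine
    the order of the letters. *)
Lemma word_cycle_inj (R : realType) n (e : {ffun 'I_n -> bool}) (s s' : 'S_n)
    (J J' : {set 'I_n}) (x p p' : 'rV[R]_n) (l l' : 'I_n -> R) :
  walk (e, s) J x p l -> walk (e, s') J' x p' l' ->
  word_cycle s J = word_cycle s' J' -> s = s'.
Proof.
move=> [JM xE l0 pJ pM] [JM' xE' l0' pJ' pM'] ss'.
have qq a : slope (e, s) p a = slope (e, s') p' a.
  have := slope_average JM xE pJ a; have := slope_average JM' xE' pJ' a.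
  rewrite /= -ss' => <- /mulfI; apply; rewrite pnatr_eq0 -lt0n.
  by apply/card_gt0P; exists a; exact: porbit_id.
pose D a := slack s J l a - slack s' J' l' a.
have DE a : D ((word_cycle s J)^-1%g a) = D a.
  have := walk_coboundary JM xE a; have := walk_coboundary JM' xE' a.
  by rewrite /D /= qq -ss' => ->; lra.
have Dorb a b : b \in porbit (word_cycle s J) a -> D b = D a.
  case/porbitP => m ->; elim: m => [|m IH]; first by rewrite expg0 perm1.
  by rewrite expgSr permM -DE permK.
have ll a : slack s J l a = slack s' J' l' a.
  apply/eqP; rewrite -subr_eq0 -/(D a) eq_le; apply/andP; split.
    have [b bo b0] := slack_zero JM l0 pJ pM a.
    by rewrite -(Dorb _ _ bo) /D /= b0 sub0r oppr_le0 (slack_ge0 (e, s') l0').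
  have [b] := slack_zero JM' l0' pJ' pM' a; rewrite /= -ss' => bo b0.
  by rewrite -(Dorb _ _ bo) /D b0 subr0 (slack_ge0 (e, s) l0).
apply: perm_order_inj => a b; apply/idP/idP => /=.
  move/(walk_order JM l0 pJ pM a b) => H; apply/(walk_order JM' l0' pJ' pM' a b) => /=.
  rewrite -!qq -ss'; case: H => [|[m [mE mP]]]; first by left.
  by right; exists m; split=> // j jm; rewrite -ll mP.
move/(walk_order JM' l0' pJ' pM' a b) => H; apply/(walk_order JM l0 pJ pM a b) => /=.
rewrite !qq ss'; case: H => [|[m [mE mP]]]; first by left.
by right; exists m; split=> // j jm; rewrite ll mP.
Qed.

Definition cycle_sum (R : realType) n (c : 'rV[R]_n) (e : {ffun 'I_n -> bool})
    (g : 'S_n) (a : 'I_n) : R :=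
  \sum_(b in porbit g a) (-1) ^+ e b * c 0 b.

Definition span_of (R : realType) d (K : finType) (b : K -> 'rV[R]_d)
    (I : {set K}) : set 'rV[R]_d :=
  [set c | exists l : K -> R, c = \sum_(i in I) l i *: b i].

(** The span of the active normals of a face, in terms of cycles: [chi] selects
    the cycles whose signed sum has to vanish. *)
Definition flat (R : realType) n (e : {ffun 'I_n -> bool}) (g : 'S_n)
    (chi : pred 'I_n) : set 'rV[R]_n :=
  [set c | forall a, chi a -> cycle_sum c e g a = 0].

Arguments flat : clear implicits.

Definition chi_cycles n (g : 'S_n) (chi : pred 'I_n) : {set {set 'I_n}} :=
  porbit g @: [set a | chi a].

(** The active set of the projection on the chamber of either type: besides the
    joints [J] of the runs it contains, in type B, the steps between the runs
    that [chi] rejects, as the projection vanishes on these. *)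
Definition joined n (B : bool) (s : 'S_n) (J : {set 'I_n}) (chi : pred 'I_n) :
    {set 'I_n} :=
  [set i in normals n B | (i \in J) || ~~ chi (s i)].

Section Joined.
Context (R : realType) (n : nat) (B : bool) (t : signed_perm n) (J : {set 'I_n}).
Context (x p : 'rV[R]_n) (l : 'I_n -> R) (chi : pred 'I_n).
Context (W : walk t J x p l).
Context (chi_le : forall a b, slope t p a <= slope t p b -> chi b -> chi a).
Context (chi_A : ~~ B -> forall a, chi a).

Local Notation s := t.2.
Local Notation q := (slope t p).
Local Notation sigma := (word_cycle s J).
Local Notation I := (joined B s J chi).

Lemma joined_sub : I \subset normals n B.
Proof. by apply/fintype.subsetP => i; rewrite inE => /andP[]. Qed.

Lemma notin_joined (i : 'I_n) : (i \notin I) = (i \notin J) && chi (s i).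
Proof.
case: W => JM _ _ _ _; rewrite [i \in I]inE negb_and negb_or negbK [i \in normals n B]inE.
case: B chi_A => //= cA; rewrite cA // andbT.
have [iJ|//] := boolP (i \in J); last by rewrite orbT.
by have := fintype.subsetP JM i iJ; rewrite inE /= orbF => ->.
Qed.

Lemma joined_A : ~~ B -> I = J.
Proof.
move=> nB; apply/setP => i; apply/negb_inj; rewrite notin_joined chi_A //.
by rewrite andbT.
Qed.

(** At the end of a run, the positions up to [i] are those whose slope is at
    most that of [i]. *)
Lemma cum_slope (c : 'rV[R]_n) (i : 'I_n) : i \notin J ->
  cum t c i = \sum_(b | q b <= q (s i)) (-1) ^+ t.1 b * c 0 b.
Proof.
case: W => JM _ _ pJ pM iJ.
rewrite [RHS](reindex_inj (@perm_inj _ s)) /=; apply: eq_bigl => k.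
apply/idP/idP => [|qki]; first exact: (slope_le JM pJ pM).
by rewrite leqNgt; apply/negP => /(slope_lt JM pJ pM)/(_ iJ); rewrite ltNge qki.
Qed.

(** Partial sums are the coordinates in the basis of the chain, so the span of
    the joined steps is cut out by the vanishing of the partial sums at the ends
    of the selected runs, that is, of the sums over the selected runs. *)
Lemma span_flat : span_of (chain (evec R n) t) I = flat R n t.1 sigma chi.
Proof.
case: (W) => JM xE l0 pJ pM.
have orbE a b : (b \in porbit sigma a) = (q b == q a).
  exact: (porbit_slope JM pJ pM).
apply/seteqP; split=> [c [lc cE] a chia|c cflat].
  have cumI i : i \notin I -> cum t c i = 0.
    by move=> iI; rewrite cE cum_lin (negbTE iI).
  have [i [ia iJ imax]] := walk_last JM pJ pM a.
  have qia : q (s i) = q a by apply/eqP; rewrite -orbE.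
  have ci0 : cum t c i = 0.
    by apply: cumI; rewrite notin_joined iJ (chi_le _ chia) ?qia.
  rewrite cum_slope // qia in ci0.
  suff lt0 : \sum_(b | q b < q a) (-1) ^+ t.1 b * c 0 b = 0.
    rewrite /cycle_sum; move: ci0; rewrite (bigID (fun b => q b < q a)) /=.
    rewrite [X in X + _](eq_bigl (fun b => q b < q a)) ?lt0 ?add0r => [ci0|b].
      rewrite -[RHS]ci0; apply: eq_bigl => b; rewrite orbE; apply/eqP/andP => [->|[qba]].
        by rewrite lexx ltxx.
      by rewrite -leNgt => qab; apply/eqP; rewrite eq_le qba.
    by apply/andP/idP => [[]//|qb]; rewrite ltW.
  (* the last position with a smaller slope carries a vanishing partial sum *)
  have [/existsP[b0 qb0]|] := boolP [exists b, q b < q a]; last first.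
    by rewrite negb_exists => /forallP nq; rewrite big1 // => b; rewrite (negbTE (nq b)).
  have H0 : q (s (s^-1%g b0)) < q a by rewrite permKV.
  have [k qk kmax] := @arg_maxnP _ (s^-1%g b0) (fun k => q (s k) < q a)
    (fun k : 'I_n => nat_of_ord k) H0.
  have kJ : k \notin J.
    apply/negP => kJ; have : (ordS k <= k)%N by apply: kmax; rewrite (slope_in JM pJ).
    by rewrite ordS_val ?(walk_ltn JM) // ltnn.
  have := cumI k; rewrite notin_joined kJ (chi_le _ chia) ?(ltW qk) // => /(_ isT).
  rewrite cum_slope // => ck0; rewrite -[RHS]ck0; apply: eq_bigl => b.
  apply/idP/idP => [qb|].
    rewrite -(permKV s b); apply: (slope_le JM pJ pM); apply: kmax.
    by rewrite permKV.
  by move=> /le_lt_trans; exact.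
exists (cum t c); apply: cum_lin_exp => i; rewrite notin_joined => /andP[iJ chii].
rewrite cum_slope //.
rewrite (partition_big (porbit sigma) (mem (porbits sigma))) /= => [|b _]; last first.
  exact: imset_f.
apply: big1 => O /imsetP[b _ ->].
have [qb|qb] := leP (q b) (q (s i)).
  rewrite -[RHS](cflat b (chi_le qb chii)); apply: eq_bigl => a.
  rewrite eq_porbit_mem andb_idl // orbE => /eqP->; exact: qb.
rewrite big1 // => a /andP[qa]; rewrite eq_porbit_mem orbE => /eqP qab.
by move: qb; rewrite -qab ltNge qa.
Qed.

(** Every position either is joined or is the last one of a selected run. *)
Lemma card_joined : (#|I| + #|chi_cycles sigma chi|)%N = n.
Proof.
case: (W) => JM xE l0 pJ pM.
have orbE a b : (b \in porbit sigma a) = (q b == q a).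
  exact: (porbit_slope JM pJ pM).
rewrite -[RHS](card_ord n) -(cardsC I); congr addn.
have -> : chi_cycles sigma chi = (fun i => porbit sigma (s i)) @: ~: I.
  apply/setP => O; apply/imsetP/imsetP => [[a]|[i]].
    rewrite inE => chia ->; have [i [ia iJ _]] := walk_last JM pJ pM a.
    exists i; last by apply/esym/eqP; rewrite eq_porbit_mem.
    rewrite finset.in_setC notin_joined iJ (chi_le _ chia) //.
    by move: ia; rewrite orbE => /eqP->.
  by rewrite finset.in_setC notin_joined => /andP[iJ ci] ->; exists (s i); rewrite ?inE.
rewrite card_in_imset // => i k; rewrite !finset.in_setC !notin_joined.
move=> /andP[iJ _] /andP[kJ _].
move/eqP; rewrite eq_porbit_mem orbE => /eqP qik; apply: ord_inj.
have [lt_ik|lt_ki|//] := ltngtP i k.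
  by have := slope_lt JM pJ pM lt_ik iJ; rewrite qik ltxx.
by have := slope_lt JM pJ pM lt_ki kJ; rewrite qik ltxx.
Qed.

End Joined.

(** Projecting further onto the half-space of nonpositive slopes truncates the
    positive slopes; the cut-off mass is carried by the last vector of the
    chain. *)
Lemma region_joined (R : realType) n (t : signed_perm n) (J : {set 'I_n})
    (x p : 'rV[R]_n) (l : 'I_n -> R) :
  walk t J x p l ->
  region (chain (evec R n) t) (normals n true)
    (joined true t.2 J (fun a => slope t p a < 0)) x.
Proof.
move=> W; case: (W) => JM xE l0 pJ pM; set I := joined _ _ _ _.
have inI i : (i \notin I) = (i \notin J) && (slope t p (t.2 i) < 0).
  by rewrite (notin_joined W).
pose p' : 'rV[R]_n := \row_a ((-1) ^+ t.1 a * Num.min (slope t p a) 0).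
(* the positive parts of the slopes up to [i] are what [cum] loses at [i] *)
pose l' i := (if i \in J then l i else 0) +
  \sum_(k < n | (k <= i)%N) Num.max (slope t p (t.2 k)) 0.
have sp' i : scoord t p' i = Num.min (slope t p (t.2 i)) 0.
  by rewrite /scoord mxE mulrA -expr2 sqrr_sign mul1r.
have max0 (i k : 'I_n) : i \notin I -> (k <= i)%N -> slope t p (t.2 k) < 0.
  rewrite inI => /andP[_ qi] ki.
  exact: le_lt_trans (slope_le JM pJ pM ki) qi.
exists p', l'; split.
- apply: (@cum_inj _ _ t) => i; rewrite xE !cumD !cum_lin.
  have -> : cum t p i = cum t p' i +
      \sum_(k < n | (k <= i)%N) Num.max (slope t p (t.2 k)) 0.
    rewrite /cum -big_split; apply: eq_bigr => k _ /=.
    by rewrite sp' addr_min_max addr0.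
  case: ifPn => iJ.
    have -> : i \in I by apply/negPn; rewrite inI iJ.
    by rewrite /l' iJ -addrA [X in _ + X]addrC.
  rewrite -addrA; congr (_ + _); case: ifPn => iI.
    by rewrite /l' (negbTE iJ) addr0 add0r.
  rewrite addr0 big1 // => k ki; apply/max_idPr/ltW.
  exact: (max0 i).
- move=> i iI; apply: addr_ge0; first by case: ifP => // /l0/ltW.
  by apply: sumr_ge0 => k _; rewrite le_max lexx orbT.
- move=> i; rewrite -[i \in I]negbK inI negb_and negbK => iI.
  rewrite dotv_chain_evec !sp'; case: ifPn => iN.
    have [iJ|iJ] := boolP (i \in J); first by rewrite (slope_in JM pJ) // subrr.
    move: iI; rewrite (negbTE iJ) /= -leNgt => qi.
    have := slope_out pM iN iJ => /(le_lt_trans qi) /ltW qS.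
    by rewrite !min_r // subr0.
  have iJ : i \notin J by apply: contra iN; exact: (walk_ltn JM).
  by move: iI; rewrite (negbTE iJ) /= -leNgt => qi; rewrite min_r // subr0.
- move=> i /finset.setDP[_]; rewrite inI => /andP[iJ qi].
  rewrite dotv_chain_evec !sp' (min_l (ltW qi)); case: ifPn => iN; last by rewrite subr0.
  by rewrite subr_lt0 lt_min qi andbT (slope_out pM).
Qed.

(** * Counting faces at a generic point of the coordinate space *)

Definition allowed n (B : bool) (e : {ffun 'I_n -> bool}) : bool :=
  B || (e == [ffun=> false]).

(** The first clause makes the multipliers of the projections of [x] nonzero,
    the second one the means over the cycles. *)
Definition walk_generic (R : realType) n (x : 'rV[R]_n) : Prop :=
  (forall (t : signed_perm n) (J : {set 'I_n}) i,
      dotv x (height (chain (evec R n) t) J i) != 0) /\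
  (forall (e : {ffun 'I_n -> bool}) (A : {set 'I_n}),
      A != finset.set0 -> \sum_(a in A) (-1) ^+ e a * x 0 a != 0).

Definition walk_joints (R : realType) n (x : 'rV[R]_n) (t : signed_perm n) :
    {set 'I_n} :=
  xget finset.set0 [set J | exists p l, walk t J x p l].

Definition walk_perm (R : realType) n (x : 'rV[R]_n) (t : signed_perm n) : 'S_n :=
  word_cycle t.2 (walk_joints x t).

Definition neg_cycle (R : realType) n (B : bool) (x : 'rV[R]_n)
    (e : {ffun 'I_n -> bool}) (g : 'S_n) : pred 'I_n :=
  fun a => ~~ B || (cycle_sum x e g a < 0).

Definition walk_face (R : realType) n (B : bool) (x : 'rV[R]_n)
    (t : signed_perm n) : {set 'I_n} :=
  joined B t.2 (walk_joints x t) (neg_cycle B x t.1 (walk_perm x t)).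

Lemma walk_jointsP (R : realType) n (x : 'rV[R]_n) (t : signed_perm n) :
  walk_generic x -> exists p l, walk t (walk_joints x t) x p l.
Proof.
move=> [gx _]; suff [J JP] : exists J, exists p l, walk t J x p l.
  by rewrite /walk_joints; case: xgetP => [J' _ //|/(_ J)].
have [J JM [p [l [xE l0 pJ pM]]]] :=
  region_exists x (@indep_chain_evec R n t (normals n false)).
exists J, p, l; split=> // i iJ; rewrite lt_neqAle l0 // andbT eq_sym.
have := gx t J i; rewrite xE dotv_height_in //.
by apply: contraNneq => ->; rewrite mul0r.
Qed.

Lemma neg_cycleE (R : realType) n (B : bool) (x p : 'rV[R]_n)
    (t : signed_perm n) l :
  walk t (walk_joints x t) x p l ->
  neg_cycle B x t.1 (walk_perm x t) = (fun a => ~~ B || (slope t p a < 0)).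
Proof.
move=> [JM xE l0 pJ pM]; apply/funext => a; rewrite /neg_cycle; congr (_ || _).
rewrite /cycle_sum -(slope_average JM xE pJ) pmulr_rlt0 // ltr0n.
by apply/card_gt0P; exists a; exact: porbit_id.
Qed.

Lemma walk_face_region (R : realType) n (B : bool) (x : 'rV[R]_n)
    (t : signed_perm n) (I : {set 'I_n}) :
  walk_generic x -> I \subset normals n B ->
  region (chain (evec R n) t) (normals n B) I x <-> I = walk_face B x t.
Proof.
move=> gx IM.
have faceM : walk_face B x t \subset normals n B by exact: joined_sub.
suff H : region (chain (evec R n) t) (normals n B) (walk_face B x t) x.
  by split=> [xI|->//]; exact: region_uniq xI H.
have [p [l W]] := walk_jointsP t gx.
rewrite /walk_face (neg_cycleE B W); case: B {IM faceM}; first exact: region_joined W.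
rewrite (joined_A W) //; case: W => JM xE l0 pJ pM.
by exists p, l; split=> // i iJ; apply/ltW/l0.
Qed.

Lemma walk_face_span (R : realType) n (B : bool) (x : 'rV[R]_n)
    (t : signed_perm n) :
  walk_generic x ->
  span_of (chain (evec R n) t) (walk_face B x t) =
    flat R n t.1 (walk_perm x t) (neg_cycle B x t.1 (walk_perm x t)) /\
  (#|walk_face B x t| +
   #|chi_cycles (walk_perm x t) (neg_cycle B x t.1 (walk_perm x t))|)%N = n.
Proof.
move=> gx; have [p [l W]] := walk_jointsP t gx.
have cle a b : slope t p a <= slope t p b ->
    ~~ B || (slope t p b < 0) -> ~~ B || (slope t p a < 0).
  by case: B => //= qab; exact: le_lt_trans.
have cA : ~~ B -> forall a, ~~ B || (slope t p a < 0) by move=> ->.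
rewrite /walk_face (neg_cycleE B W); split; first exact: (span_flat W cle cA).
exact: (card_joined W cle cA).
Qed.

Lemma walk_perm_inj (R : realType) n (x : 'rV[R]_n) :
  walk_generic x -> injective (fun t : signed_perm n => (t.1, walk_perm x t)).
Proof.
move=> gx [e s] [e' s'] [/= <-{e'} ss'].
have [p [l W]] := walk_jointsP (e, s) gx.
have [p' [l' W']] := walk_jointsP (e, s') gx.
by congr (_, _); exact: word_cycle_inj W W' ss'.
Qed.

(** Exactly one region of the cone of a signed permutation contains [x], and
    replacing the word by the permutation of its runs is a bijection. *)
Lemma count_generic (R : realType) n (B : bool) (x : 'rV[R]_n)
    (S : set 'rV[R]_n) r :
  walk_generic x ->
  #|[set f : signed_perm n * {set 'I_n} |
      [&& allowed B f.1.1, f.2 \subset normals n B, #|f.2| == r,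
          span_of (chain (evec R n) f.1) f.2 == S
        & `[< region (chain (evec R n) f.1) (normals n B) f.2 x >] ] ]%SET| =
  #|[set u : signed_perm n |
      [&& allowed B u.1,
          (r + #|chi_cycles u.2 (neg_cycle B x u.1 u.2)| == n)%N
        & flat R n u.1 u.2 (neg_cycle B x u.1 u.2) == S] ]%SET|.
Proof.
move=> gx.
apply: etrans (card_preimset _ (walk_perm_inj gx)).
rewrite -(card_imset _ (f := fun t => (t, walk_face B x t))); last by move=> t t' [].
apply: eq_card => -[t I]; rewrite !inE /=.
apply/idP/imsetP => [/and5P[aB IM /eqP Ir /eqP IS /asboolP]|[u]].
  move/(walk_face_region t gx IM) => IE; exists t; last by rewrite IE.
  have [spanE cardE] := walk_face_span B t gx.
  rewrite !inE aB /=; apply/andP; split; apply/eqP; last by rewrite -spanE -IE.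
  by rewrite -Ir IE.
rewrite !inE => /and3P[aB /eqP rn /eqP fS] [-> ->].
have [spanE cardE] := walk_face_span B u gx.
have IM : walk_face B x u \subset normals n B by exact: joined_sub.
rewrite aB IM spanE fS eqxx /=; apply/andP; split.
  by rewrite -(eqn_add2r #|chi_cycles (walk_perm x u) (neg_cycle B x u.1 (walk_perm x u))|) cardE rn.
by apply/asboolP/walk_face_region.
Qed.

(** A rule assigning a sign to every cycle of a signed permutation, which is
    reversed when the signs along the cycle are.  Flipping all signs on the
    cycles where two such rules differ exchanges the two rules. *)
Definition sign_rule n (chi : {ffun 'I_n -> bool} -> 'S_n -> pred 'I_n) : Prop :=
  (forall e (g : 'S_n) a, chi e g (g a) = chi e g a) /\
  (forall (e : {ffun 'I_n -> bool}) (g : 'S_n) (f : 'I_n -> bool), (forall a, f (g a) = f a) ->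
     forall a, chi [ffun a => e a (+) f a] g a = chi e g a (+) f a).

Lemma invariant_porbit n (T : Type) (g : 'S_n) (f : 'I_n -> T) :
  (forall a, f (g a) = f a) -> forall a b, b \in porbit g a -> f b = f a.
Proof.
move=> fg a b /porbitP[m ->]; elim: m => [|m IH]; first by rewrite expg0 perm1.
by rewrite expgSr permM fg.
Qed.

Lemma cycle_sum_flip (R : realType) n (c : 'rV[R]_n) (e : {ffun 'I_n -> bool})
    (g : 'S_n) (f : 'I_n -> bool) a :
  (forall a, f (g a) = f a) ->
  cycle_sum c [ffun a => e a (+) f a] g a = (-1) ^+ f a * cycle_sum c e g a.
Proof.
move=> fg; rewrite /cycle_sum mulr_sumr; apply: eq_bigr => b ba.
by rewrite ffunE signr_addb (invariant_porbit fg ba) mulrCA mulrA.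
Qed.

Lemma flat_flip (R : realType) n (e : {ffun 'I_n -> bool}) (g : 'S_n)
    (f : 'I_n -> bool) (chi : pred 'I_n) :
  (forall a, f (g a) = f a) ->
  flat R n [ffun a => e a (+) f a] g chi = flat R n e g chi.
Proof.
move=> fg; apply/seteqP; split=> c cP a chia; have := cP a chia;
  rewrite cycle_sum_flip // => /eqP; last by move/eqP->; rewrite mulr0.
by rewrite mulf_eq0 signr_eq0 => /eqP.
Qed.

(** The flip is constant on cycles, so it changes the signed sums over the cycles
    by a factor only, and with them no flat. *)
Lemma count_rule (R : realType) n (S : set 'rV[R]_n) r
    (chi chi' : {ffun 'I_n -> bool} -> 'S_n -> pred 'I_n) :
  sign_rule chi -> sign_rule chi' ->
  #|[set u : signed_perm n | (r + #|chi_cycles u.2 (chi u.1 u.2)| == n)%N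
                             && (flat R n u.1 u.2 (chi u.1 u.2) == S)]%SET| =
  #|[set u : signed_perm n | (r + #|chi_cycles u.2 (chi' u.1 u.2)| == n)%N
                             && (flat R n u.1 u.2 (chi' u.1 u.2) == S)]%SET|.
Proof.
move=> [c1 c2] [c1' c2'].
pose h (u : signed_perm n) a := chi u.1 u.2 a (+) chi' u.1 u.2 a.
pose f (u : signed_perm n) : signed_perm n := ([ffun a => u.1 a (+) h u a], u.2).
have inv u a : h u (u.2 a) = h u a by rewrite /h c1 c1'.
have chi'f u a : chi' (f u).1 u.2 a = chi u.1 u.2 a.
  by apply: etrans (c2' u.1 u.2 (h u) (inv u) a) _; rewrite /h addbCA addbb addbF.
have chif u a : chi (f u).1 u.2 a = chi' u.1 u.2 a.
  by apply: etrans (c2 u.1 u.2 (h u) (inv u) a) _; rewrite /h addbA addbb addFb.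
have finj : injective f.
  move=> [e g] [e' g'] fE; have gg : g = g' by case: fE.
  case: _ / gg fE => fE; congr (_, _); apply/ffunP => a.
  have E : h (e, g) a = h (e', g) a.
    have A : chi' (f (e, g)).1 g a = chi e g a := chi'f (e, g) a.
    have A' : chi' (f (e', g)).1 g a = chi e' g a := chi'f (e', g) a.
    have C : chi (f (e, g)).1 g a = chi' e g a := chif (e, g) a.
    have C' : chi (f (e', g)).1 g a = chi' e' g a := chif (e', g) a.
    by rewrite /h /= -A -C fE A' C'.
  have := congr1 (fun u : signed_perm n => u.1 a) fE.
  by rewrite /= !ffunE /= E => /addIb.
apply: etrans (card_preimset _ finj).
apply: eq_card => u; rewrite !inE.
have -> : chi' (f u).1 (f u).2 = chi u.1 u.2 by apply/funext => a; exact: chi'f.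
by rewrite /= flat_flip.
Qed.

(** Any choice of a letter that depends on the cycle only would do. *)
Definition cycle_root n (g : 'S_n) (a : 'I_n) : 'I_n :=
  odflt a [pick b in porbit g a].

Definition root_rule n (e : {ffun 'I_n -> bool}) (g : 'S_n) : pred 'I_n :=
  fun a => e (cycle_root g a).

Lemma root_ruleP n : sign_rule (@root_rule n).
Proof.
split=> [e g a|e g f fg a]; rewrite /root_rule /cycle_root.
  have -> : porbit g (g a) = porbit g a by rewrite -{2}(expg1 g) porbit_perm.
  by case: pickP => // /(_ a); rewrite porbit_id.
rewrite ffunE; congr (_ (+) _); case: pickP => // b ba.
exact: invariant_porbit fg _ _ ba.
Qed.

(** Flipping the signs along a cycle negates its mean, which is nonzero. *)
Lemma neg_ruleP (R : realType) n (x : 'rV[R]_n) :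
  walk_generic x -> sign_rule (neg_cycle true x).
Proof.
move=> [_ gx]; split=> [e g a|e g f fg a]; rewrite /neg_cycle /=.
  rewrite /cycle_sum; have -> // : porbit g (g a) = porbit g a.
  by rewrite -{2}(expg1 g) porbit_perm.
have nz : cycle_sum x e g a != 0.
  by apply: gx; apply/finset.set0Pn; exists a; exact: porbit_id.
rewrite cycle_sum_flip //; case: (f a) => /=; last by rewrite mul1r addbF.
by rewrite mulN1r oppr_lt0 addbT -leNgt le_eqVlt eq_sym (negbTE nz).
Qed.

Definition root_cycle n (B : bool) (e : {ffun 'I_n -> bool}) (g : 'S_n) :
  pred 'I_n := fun a => ~~ B || root_rule e g a.

Lemma count_root (R : realType) n (B : bool) (x : 'rV[R]_n)
    (S : set 'rV[R]_n) r :
  walk_generic x ->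
  #|[set f : signed_perm n * {set 'I_n} |
      [&& allowed B f.1.1, f.2 \subset normals n B, #|f.2| == r,
          span_of (chain (evec R n) f.1) f.2 == S
        & `[< region (chain (evec R n) f.1) (normals n B) f.2 x >] ] ]%SET| =
  #|[set u : signed_perm n |
      [&& allowed B u.1,
          (r + #|chi_cycles u.2 (root_cycle B u.1 u.2)| == n)%N
        & flat R n u.1 u.2 (root_cycle B u.1 u.2) == S] ]%SET|.
Proof.
move=> gx; rewrite count_generic //; case: B => //.
exact: (count_rule S r (neg_ruleP gx) (@root_ruleP n)).
Qed.

(** * Permutations counted by cycles *)

Lemma porbit_fix n (g : 'S_n) a : g a = a -> porbit g a = [set a]%SET.
Proof.
move=> ga; apply/setP => b; rewrite inE; apply/idP/eqP => [/porbitP[m ->]|->].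
  by elim: m => [|m IH]; rewrite ?expg0 ?perm1 // expgSr permM IH.
exact: porbit_id.
Qed.

Lemma card_porbits_le n (g : 'S_n) : (#|porbits g| <= n)%N.
Proof. by rewrite -[leqRHS](card_ord n); exact: leq_imset_card. Qed.

(** Building permutations by inserting the letters one at a time: the new
    letter [m] either forms a cycle of its own or is inserted behind one of the
    [m] earlier letters.  The factor [v ^+ m] in the induction accounts for the
    fixed letters that are yet to be inserted. *)
Lemma perm_cycles_poly (K : idomainType) n (u v : K) : v != 0 ->
  \sum_(g : 'S_n) u ^+ (n - #|porbits g|) * v ^+ #|porbits g| =
  \prod_(i < n) (v + u * i%:R).
Proof.
move=> v0; pose F (g : 'S_n) := u ^+ (n - #|porbits g|) * v ^+ #|porbits g|.
pose fixes m (g : 'S_n) := [forall i : 'I_n, (m <= i)%N ==> (g i == i)].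
suff H m : (m <= n)%N ->
    v ^+ m * \sum_(g | fixes m g) F g = v ^+ n * \prod_(i < m) (v + u * i%:R).
  have := H n (leqnn n) => /(mulfI (expf_neq0 n v0)) <-.
  apply: eq_bigl => g; apply/esym/forallP => i.
  by rewrite leqNgt ltn_ord.
elim: m => [_|m IH lt_mn].
  rewrite expr0 mul1r big_ord0 mulr1 (big_pred1 1%g) => [|g]; last first.
    apply/forallP/eqP => [gi|-> i]; last by rewrite perm1 eqxx implybT.
    by apply/permP => i; rewrite perm1; apply/eqP; have := gi i.
  rewrite /F; have -> : #|porbits (1%g : 'S_n)| = n; last by rewrite subnn mul1r.
  rewrite card_imset ?card_ord // => a b.
  by rewrite !porbit_fix ?perm1 // => /finset.set1_inj.
pose mm := Ordinal lt_mn.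
rewrite (partition_big (fun g : 'S_n => g^-1%g mm) (fun j : 'I_n => (j <= m)%N)) /=; last first.
  move=> g /forallP gf; rewrite leqNgt; apply/negP => mj.
  have /eqP := implyP (gf (g^-1%g mm)) mj; rewrite permKV => mE.
  by rewrite -mE /= ltnn in mj.
(* composing with the transposition of [m] and the letter [j] that is sent to
   [m] takes [m] out of its cycle *)
have step (j : 'I_n) : (j <= m)%N ->
    v * \sum_(g | fixes m.+1 g && (g^-1%g mm == j)) F g =
    (if j == mm then v else u) * \sum_(g | fixes m g) F g.
  move=> jm; rewrite (reindex_inj (mulgI (tperm mm j))) /= !mulr_sumr.
  apply: eq_big => g.
    apply/andP/forallP => [[/forallP gf /eqP gm] i|gf].
      apply/implyP; rewrite leq_eqVlt => /orP[/eqP mi|mi].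
        have -> : i = mm by apply: ord_inj; rewrite -mi.
        by rewrite -{2}(permKV (tperm mm j * g)%g mm) gm permM tpermR.
      have /eqP := implyP (gf i) mi; rewrite permM tpermD // => [->//||];
        apply: contraTneq mi => <-; rewrite -leqNgt //=.
    have gm : g mm = mm by apply/eqP/(implyP (gf mm)).
    split; last by rewrite (canF_eq (permKV _)) permM tpermR gm.
    apply/forallP => i; apply/implyP => mi; rewrite permM tpermD; last 2 first.
    - by apply: contraTneq mi => <-; rewrite -leqNgt.
    - by apply: contraTneq mi => <-; rewrite -leqNgt.
    by apply: (implyP (gf i)); exact: ltnW.
  move=> /andP[/forallP gf /eqP gm].
  have gmm : g mm = mm.
    by rewrite -{2}(permKV (tperm mm j * g)%g mm) gm permM tpermR.
  have := porbits_mul_tperm g mm j; rewrite /= porbit_sym (porbit_fix gmm) inE eq_sym.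
  have := card_porbits_le g; rewrite /F.
  case: eqVneq => [_ _|_ gn] /=; first by rewrite !addn0 => ->.
  rewrite addn1 addn2 => -[gE]; rewrite -gE in gn *.
  rewrite mulrCA -exprS; rewrite mulrA -exprS; congr (u ^+ _ * _).
  by rewrite -subSn.
rewrite exprSr -mulrA mulr_sumr (eq_bigr _ step) -mulr_suml mulrCA IH ?(ltnW lt_mn) //.
rewrite mulrCA big_ord_recr /= [X in _ = _ * X]mulrC; congr (_ * (_ * _)).
rewrite (bigD1 mm) //= eqxx; congr (_ + _).
rewrite (eq_bigr (fun=> u)) => [|j /andP[_ /negbTE->] //].
rewrite sumr_const -[LHS]mulr_natr; congr (_ * _%:R).
transitivity #|[set j : 'I_n | (j < m)%N]%SET|.
  apply: eq_card => j; rewrite !inE unfold_in /= -(inj_eq val_inj) /=.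
  by rewrite ltn_neqAle andbC.
by rewrite -sum1_card (eq_bigl (fun j : 'I_n => (j < m)%N)) => [|j];
  rewrite ?inE // -(@big_ord_widen _ _ addn m n (fun=> 1%N)) 1?ltnW // sum1_card card_ord.
Qed.

Definition cycle_roots n (g : 'S_n) : {set 'I_n} := [set cycle_root g a | a in 'I_n].

Lemma root_porbit n (g : 'S_n) a : cycle_root g a \in porbit g a.
Proof. by rewrite /cycle_root; case: pickP => [//|/(_ a)]; rewrite porbit_id. Qed.

Lemma porbit_root n (g : 'S_n) a : porbit g (cycle_root g a) = porbit g a.
Proof. by apply/eqP; rewrite eq_porbit_mem root_porbit. Qed.

Lemma root_eq n (g : 'S_n) a b : porbit g a = porbit g b -> cycle_root g a = cycle_root g b.
Proof.
by move=> ab; rewrite /cycle_root ab; case: pickP => // /(_ b); rewrite porbit_id.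
Qed.

Lemma porbit_roots_inj n (g : 'S_n) : {in cycle_roots g &, injective (porbit g)}.
Proof.
by move=> _ _ /imsetP[a _ ->] /imsetP[b _ ->]; rewrite !porbit_root => /root_eq.
Qed.

Lemma card_roots n (g : 'S_n) : #|cycle_roots g| = #|porbits g|.
Proof.
rewrite -(card_in_imset (@porbit_roots_inj n g)); apply: eq_card => O.
apply/imsetP/imsetP => [[_ /imsetP[a _ ->] ->]|[a _ ->]].
  by exists a => //; rewrite porbit_root.
by exists (cycle_root g a); rewrite ?porbit_root // imset_f.
Qed.

Lemma card_root_cycles n (e : {ffun 'I_n -> bool}) (g : 'S_n) :
  #|chi_cycles g (root_rule e g)| = #|[set r in cycle_roots g | e r]%SET|.
Proof.
rewrite -(card_in_imset (f := porbit g)) => [|r r']; last first.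
  by rewrite !inE => /andP[rr _] /andP[rr' _]; exact: porbit_roots_inj.
apply: eq_card => O; apply/imsetP/imsetP => [[a]|[r]].
  rewrite inE => ea ->; exists (cycle_root g a); last by rewrite porbit_root.
  by rewrite inE imset_f.
rewrite inE => /andP[/imsetP[a _ ->] er] ->; exists (cycle_root g a) => //.
rewrite inE /root_rule /=.
suff -> : cycle_root g (cycle_root g a) = cycle_root g a by [].
exact/root_eq/porbit_root.
Qed.

(** The signs at the roots of the cycles decide which cycles are selected, and
    the other signs are free. *)
Lemma sign_cycles_poly (K : comNzRingType) n (g : 'S_n) (X : K) :
  \sum_(e : {ffun 'I_n -> bool}) X ^+ #|chi_cycles g (root_rule e g)| =
  2 ^+ (n - #|porbits g|) * (1 + X) ^+ #|porbits g|.
Proof.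
pose G (a : 'I_n) (b : bool) : K := if (a \in cycle_roots g) && b then X else 1.
transitivity (\prod_(a < n) \sum_(b : bool) G a b).
  rewrite bigA_distr_bigA /=; apply: eq_bigr => e _.
  rewrite card_root_cycles -prodr_const [LHS]big_mkcond /=.
  by apply: eq_bigr => a _; rewrite inE.
rewrite (bigID (fun a => a \in cycle_roots g)) /= mulrC; congr (_ * _).
  rewrite (eq_bigr (fun=> 2)) => [|a /negbTE ar]; last first.
    by rewrite big_bool /G ar.
  rewrite prodr_const -(card_roots g); congr (2 ^+ _).
  by have := cardC (mem (cycle_roots g)); rewrite card_ord => H; rewrite -[X in (X - _)%N]H addKn.
rewrite (eq_bigr (fun=> 1 + X)) => [|a ar]; last by rewrite big_bool /G ar addrC.
by rewrite prodr_const card_roots.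
Qed.

(** The generating polynomial of the Stirling numbers of either type. *)
Definition cycle_poly (R : realType) n (B : bool) : {poly R} :=
  \prod_(i < n) ('X + ((if B then i.*2.+1 else i)%:R)%:P).

Lemma count_cycles (R : realType) n (B : bool) k :
  (#|[set u : signed_perm n |
       allowed B u.1 && (#|chi_cycles u.2 (root_cycle B u.1 u.2)| == k)]%SET|)%:R
  = (cycle_poly R n B)`_k.
Proof.
have -> : cycle_poly R n B = \sum_(u : signed_perm n | allowed B u.1)
    'X ^+ #|chi_cycles u.2 (root_cycle B u.1 u.2)|.
  transitivity (\sum_(e | allowed B e) \sum_(g : 'S_n)
      'X ^+ #|chi_cycles g (root_cycle B e g)| : {poly R}); last first.
    by rewrite pair_big_dep /=; apply: eq_bigl => u; rewrite andbT.
  rewrite exchange_big /=; case: B => /=; rewrite /allowed /root_cycle /=.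
    under [RHS]eq_bigr do rewrite (sign_cycles_poly _ 'X).
    rewrite perm_cycles_poly; last by rewrite addrC -size_poly_eq0 -polyC1 size_XaddC.
    apply: eq_bigr => i _; rewrite polyC_natr -addn1 -muln2 natrD natrM; ring.
  under [RHS]eq_bigr do rewrite big_pred1_eq.
  transitivity (\sum_(g : 'S_n) 1 ^+ (n - #|porbits g|) * 'X ^+ #|porbits g| : {poly R}).
    rewrite perm_cycles_poly ?polyX_eq0 //; apply: eq_bigr => i _.
    by rewrite mul1r polyC_natr.
  apply: eq_bigr => g _; rewrite expr1n mul1r; congr ('X ^+ _).
  by apply: eq_card => O; apply/imsetP/imsetP => -[a _ ->]; exists a; rewrite ?inE.
rewrite coef_sum -sum1_card natr_sum big_mkcond [RHS]big_mkcond /=.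
apply: eq_bigr => u _; rewrite inE; case: allowed => //=.
by rewrite coefXn eq_sym; case: eqP.
Qed.

(** * Counting faces at a generic point *)

(** The common form of the two notions of general position. *)
Definition in_gp (R : realType) d n (B : bool) (y : 'I_n -> 'rV[R]_d) : Prop :=
  forall t : signed_perm n, allowed B t.1 ->
  forall I : {set 'I_n}, I \subset normals n B -> (#|I| <= d)%N ->
  indep (chain y t) I.

Definition generic_for (R : realType) d n (B : bool) (y : 'I_n -> 'rV[R]_d)
    (x : 'rV[R]_d) : Prop :=
  forall t : signed_perm n, allowed B t.1 ->
  forall I : {set 'I_n}, I \subset normals n B -> (#|I| < d)%N ->
  {in normals n B, forall i, dotv x (height (chain y t) I i) != 0}.

Definition lin (R : realType) d n (y : 'I_n -> 'rV[R]_d) (c : 'rV[R]_n) :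
  'rV[R]_d := \sum_a c 0 a *: y a.

Definition adj (R : realType) d n (y : 'I_n -> 'rV[R]_d) (p : 'rV[R]_d) :
  'rV[R]_n := \row_a dotv p (y a).

Lemma linD (R : realType) d n (y : 'I_n -> 'rV[R]_d) c c' :
  lin y (c + c') = lin y c + lin y c'.
Proof. by rewrite /lin -big_split; apply: eq_bigr => a _; rewrite mxE scalerDl. Qed.

Lemma linZ (R : realType) d n (y : 'I_n -> 'rV[R]_d) k c :
  lin y (k *: c) = k *: lin y c.
Proof. by rewrite /lin scaler_sumr; apply: eq_bigr => a _; rewrite mxE scalerA. Qed.

Lemma lin_sum (R : realType) d n (y : 'I_n -> 'rV[R]_d) (I : {set 'I_n})
    (l : 'I_n -> R) (F : 'I_n -> 'rV[R]_n) :
  lin y (\sum_(i in I) l i *: F i) = \sum_(i in I) l i *: lin y (F i).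
Proof.
rewrite (big_morph (lin y) (linD y) (id1 := 0)) => [|].
  by apply: eq_bigr => i _; rewrite linZ.
by rewrite /lin big1 // => a _; rewrite mxE scale0r.
Qed.

Lemma lin_evec (R : realType) d n (y : 'I_n -> 'rV[R]_d) a :
  lin y (evec R n a) = y a.
Proof.
rewrite /lin (bigD1 a) //= big1 ?addr0 => [|b /negbTE ba]; rewrite mxE eqxx.
  by rewrite eqxx scale1r.
by rewrite /= ba scale0r.
Qed.

Lemma lin_chain (R : realType) d n (y : 'I_n -> 'rV[R]_d) (t : signed_perm n) i :
  lin y (chain (evec R n) t i) = chain y t i.
Proof.
rewrite /chain; case: ifP => _.
  by rewrite -!scalerN linD !linZ -[- evec _ _ _]scaleN1r -[- y _]scaleN1r linZ !lin_evec.
by rewrite !subr0 linZ lin_evec.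
Qed.

Lemma dotv_adj (R : realType) d n (y : 'I_n -> 'rV[R]_d) (p : 'rV[R]_d)
    (t : signed_perm n) i :
  dotv (adj y p) (chain (evec R n) t i) = dotv p (chain y t i).
Proof.
rewrite dotv_chain_evec /scoord !mxE /chain dotvBr dotvZr.
by case: ifP => _; rewrite ?dotvZr ?dotv0r ?mxE.
Qed.

Lemma decomposition_uniq (R : realType) d (K : finType) (b : K -> 'rV[R]_d)
    (I : {set K}) (p p' : 'rV[R]_d) (l l' : K -> R) :
  indep b I ->
  {in I, forall i, dotv p (b i) = 0} -> {in I, forall i, dotv p' (b i) = 0} ->
  p + \sum_(i in I) l i *: b i = p' + \sum_(i in I) l' i *: b i ->
  p = p' /\ {in I, l =1 l'}.
Proof.
move=> bI pI pI' E.
have dE : p - p' = \sum_(i in I) (l' i - l i) *: b i.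
  under eq_bigr do rewrite scalerBl; rewrite sumrB.
  have -> : p = p' + \sum_(i in I) l' i *: b i - \sum_(i in I) l i *: b i.
    by rewrite -E addrK.
  by rewrite [LHS](ACl (2*3*1*4)) /= addrK.
have pp' : p - p' = 0.
  apply/eqP; rewrite -dotvv_eq0 {2}dE dotv_span0 // => i iI.
  by rewrite dotvBl pI // pI' // subrr.
split; first by apply/eqP; rewrite -subr_eq0 pp'.
move=> i iI; apply/esym/eqP; rewrite -subr_eq0; apply/eqP.
by apply: (bI (fun i => l' i - l i)) iI; rewrite -dE.
Qed.

(** For a fixed face direction [S], the orthogonal decomposition of [x] along
    [lin y] of [S] lifts to one point [x'] of the coordinate space, common to
    all the signed permutations having a face with span [S]; the regions at
    [x] and at [x'] agree, and genericity lets one perturb [x']. *)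
Lemma transfer (R : realType) d n (B : bool) (y : 'I_n -> 'rV[R]_d)
    (x : 'rV[R]_d) (S : set 'rV[R]_n) r :
  in_gp B y -> generic_for B y x -> (r < d)%N ->
  exists2 x' : 'rV[R]_n, walk_generic x' &
    forall (t : signed_perm n) (I : {set 'I_n}), allowed B t.1 ->
      I \subset normals n B -> #|I| = r -> span_of (chain (evec R n) t) I = S ->
      region (chain y t) (normals n B) I x <->
      region (chain (evec R n) t) (normals n B) I x'.
Proof.
move=> gy gx rd.
pose flag (t : signed_perm n) (I : {set 'I_n}) := [&& allowed B t.1,
  I \subset normals n B, #|I| == r & span_of (chain (evec R n) t) I == S].
have [xS xSP] : exists xS : 'rV[R]_n, forall t I, flag t I ->
    exists p l, [/\ {in I, forall i, dotv p (chain y t i) = 0},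
                    x = p + \sum_(i in I) l i *: chain y t i
                  & xS = adj y p + \sum_(i in I) l i *: chain (evec R n) t i].
  have [[[t0 I0] /= f0]|noflag] := pselect (exists f : _ * _, flag f.1 f.2); last first.
    by exists 0 => t I f; case: noflag; exists (t, I).
  have /and4P[a0 I0M /eqP I0r /eqP I0S] := f0.
  pose p0 := residual (chain y t0) I0 x; pose l0 := proj_coef (chain y t0) I0 x.
  have xE0 : x = p0 + \sum_(i in I0) l0 i *: chain y t0 i by exact: residualK.
  have p0I : {in I0, forall i, dotv p0 (chain y t0 i) = 0}.
    by move=> i; exact: residual_orth.
  exists (adj y p0 + \sum_(i in I0) l0 i *: chain (evec R n) t0 i).
  move=> t I /and4P[a IM /eqP Ir /eqP IS].
  pose p := residual (chain y t) I x; pose l := proj_coef (chain y t) I x.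
  have xE : x = p + \sum_(i in I) l i *: chain y t i by exact: residualK.
  have pI : {in I, forall i, dotv p (chain y t i) = 0}.
    by move=> i; exact: residual_orth.
  have inS : S (\sum_(i in I) l i *: chain (evec R n) t i).
    by rewrite -IS; exists l.
  move: inS; rewrite -I0S => -[l' l'E].
  have pI0 : {in I0, forall i, dotv p (chain y t0 i) = 0}.
    move=> i iI0.
    have : S (chain (evec R n) t0 i).
      rewrite -I0S; exists (fun j => (j == i)%:R).
      rewrite (bigD1 i) //= eqxx scale1r big1 ?addr0 // => j /andP[_ /negbTE->].
      by rewrite scale0r.
    rewrite -IS => -[m mE]; rewrite -lin_chain mE lin_sum.
    by rewrite dotv_span0 // => j jI; rewrite lin_chain pI.
  have E : p + \sum_(i in I0) l' i *: chain y t0 i =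
           p0 + \sum_(i in I0) l0 i *: chain y t0 i.
    rewrite -xE0 [RHS]xE; congr (_ + _).
    have := congr1 (lin y) l'E; rewrite !lin_sum.
    under eq_bigr do rewrite lin_chain; under [RHS]eq_bigr do rewrite lin_chain.
    by move=> ->.
  have [|pp0 ll0] := decomposition_uniq _ pI0 p0I E.
    by apply: gy => //; rewrite I0r ltnW.
  exists p, l; split=> //; rewrite pp0 l'E; congr (_ + _).
  by apply: eq_bigr => i iI0; rewrite ll0.
(* both scalar products are the same coefficient, up to a positive factor *)
have signs t I i : flag t I -> i \in normals n B ->
    (dotv xS (height (chain (evec R n) t) I i) != 0) /\
    (dotv xS (height (chain (evec R n) t) I i) < 0) =
    (dotv x (height (chain y t) I i) < 0).
  move=> f iM; have [p [l [pI xE xSE]]] := xSP t I f.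
  have /and4P[a IM /eqP Ir _] := f.
  have adjI : {in I, forall j, dotv (adj y p) (chain (evec R n) t j) = 0}.
    by move=> j jI; rewrite dotv_adj pI.
  have nz : dotv x (height (chain y t) I i) != 0 by apply: gx; rewrite ?Ir.
  have [iI|iI] := boolP (i \in I); last first.
    have h1 := dotv_height_out l pI iI; have h2 := dotv_height_out l adjI iI.
    by move: nz; rewrite xE h1 xSE h2 dotv_adj.
  have h1 := dotv_height_in l pI iI; have h2 := dotv_height_in l adjI iI.
  move: nz; rewrite xE h1 xSE h2 mulf_eq0 negb_or => /andP[li0 hy0].
  have he0 : 0 < dotv (height (chain (evec R n) t) I i)
                      (height (chain (evec R n) t) I i).
    by rewrite dotvv_gt0; apply: height_neq0; exact: indep_chain_evec.
  rewrite mulf_eq0 negb_or li0 (gt_eqF he0) pmulr_llt0 // pmulr_llt0 //.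
  by rewrite lt_def hy0 dotvv_ge0.
(* the signs of the products with [us] are to be kept, those with [ws] are to
   become nonzero *)
pose us := [seq height (chain (evec R n) u.1.1) u.1.2 u.2 |
  u <- [seq u <- enum {: signed_perm n * {set 'I_n} * 'I_n} |
          flag u.1.1 u.1.2 && (u.2 \in normals n B)]].
pose ws := [seq height (chain (evec R n) u.1.1) u.1.2 u.2 |
  u <- enum {: signed_perm n * {set 'I_n} * 'I_n}] ++
  [seq \sum_(a in u.2) (-1) ^+ u.1 a *: evec R n a |
  u : {ffun 'I_n -> bool} * {set 'I_n} <-
    [seq u <- enum {: {ffun 'I_n -> bool} * {set 'I_n}} | u.2 != finset.set0]].
have dotS (z : 'rV[R]_n) (e : {ffun 'I_n -> bool}) (A : {set 'I_n}) :
    dotv z (\sum_(a in A) (-1) ^+ e a *: evec R n a) =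
    \sum_(a in A) (-1) ^+ e a * z 0 a.
  by rewrite dotv_sumr; apply: eq_bigr => a _; rewrite dotvZr dotv_evec.
have ws0 : all (fun w => w != 0) ws.
  rewrite all_cat; apply/andP; split; apply/allP => _ /mapP[u uP ->].
    by apply: height_neq0; exact: indep_chain_evec.
  move: uP; rewrite mem_filter => /andP[/finset.set0Pn[a aA] _].
  apply/eqP => E; have := dotS (\row_b (-1) ^+ u.1 b) u.1 u.2.
  rewrite E dotv0r (eq_bigr (fun=> 1)) => [|b _]; last first.
    by rewrite mxE -expr2 sqrr_sign.
  move/esym/eqP; rewrite sumr_const pnatr_eq0 => /eqP/finset.cards0_eq A0.
  by rewrite A0 inE in aA.
have us0 : all (fun u => dotv xS u != 0) us.
  apply/allP => _ /mapP[u uP ->]; move: uP; rewrite mem_filter => /andP[/andP[f iM] _].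
  exact: (signs _ _ _ f iM).1.
have [x' [x'ws x'us]] := perturb ws0 us0.
exists x'.
  split=> [t J i|e A A0].
    apply: (allP x'ws); rewrite mem_cat; apply/orP; left.
    by apply/mapP; exists (t, J, i) => //; rewrite mem_enum.
  rewrite -dotS; apply: (allP x'ws); rewrite mem_cat; apply/orP; right.
  by apply/mapP; exists (e, A) => //; rewrite mem_filter A0 mem_enum.
move=> t I a IM Ir IS.
have f : flag t I by rewrite /flag a IM Ir IS !eqxx.
have same i : i \in normals n B ->
    (dotv x' (height (chain (evec R n) t) I i) < 0) =
    (dotv x (height (chain y t) I i) < 0).
  move=> iM; rewrite -(signs t I i f iM).2; apply: (x'us _ _).2.
  by apply/mapP; exists (t, I, i) => //; rewrite mem_filter /= f iM mem_enum.
have gI : indep (chain y t) I by apply: gy; rewrite // Ir ltnW.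
rewrite (regionP _ _ gI) (regionP _ _ (@indep_chain_evec R n t I)).
split=> -[h1 h2]; split=> i iI.
- by rewrite leNgt same ?(fintype.subsetP IM) // -leNgt h1.
- by rewrite same ?h2 //; case/finset.setDP: iI.
- by rewrite leNgt -same ?(fintype.subsetP IM) // -leNgt h1.
- by rewrite -same ?h2 //; case/finset.setDP: iI.
Qed.

Lemma sum_card_fibers (T : finType) (V : eqType) (f : T -> V) (A : {set T})
    (s : seq V) :
  uniq s -> {in A, forall a, f a \in s} ->
  (\sum_(S <- s) #|[set a in A | f a == S]%SET|)%N = #|A|.
Proof.
move=> us As.
transitivity (\sum_(S <- s) \sum_(a in A) (f a == S))%N.
  apply: eq_bigr => S _; rewrite -sum1_card [RHS]big_mkcond [LHS]big_mkcond /=.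
  by apply: eq_bigr => a _; rewrite inE; case: (a \in A) => //=; case: eqP.
rewrite exchange_big /= -sum1_card; apply: eq_bigr => a aA.
have := count_uniq_mem (f a) us; rewrite As // -sum1_count big_mkcond /= => H.
rewrite -[RHS]H; apply: eq_bigr => S _.
by rewrite eq_sym; case: eqP.
Qed.

Lemma card_fibers (T U : finType) (V : eqType) (f : T -> V) (g : U -> V)
    (A : {set T}) (C : {set U}) :
  (forall S, #|[set a in A | f a == S]%SET| = #|[set c in C | g c == S]%SET|) ->
  #|A| = #|C|.
Proof.
move=> fg; pose s := undup ([seq f a | a in A] ++ [seq g c | c in C]).
rewrite -(@sum_card_fibers _ _ f A s) ?undup_uniq // => [|a aA]; last first.
  by rewrite mem_undup mem_cat fintype.image_f.
rewrite -(@sum_card_fibers _ _ g C s) ?undup_uniq // => [|c cC]; last first.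
  by rewrite mem_undup mem_cat (fintype.image_f g cC) orbT.
by apply: eq_bigr => S _.
Qed.

(** The faces of codimension [r] on whose relative interior [x] projects. *)
Definition good_flags (R : realType) d n (B : bool) (y : 'I_n -> 'rV[R]_d) r
    (x : 'rV[R]_d) : {set signed_perm n * {set 'I_n}} :=
  [set f : signed_perm n * {set 'I_n} | [&& allowed B f.1.1, f.2 \subset normals n B, #|f.2| == r
             & `[< region (chain y f.1) (normals n B) f.2 x >] ] ].

(** The spans of the active normals split both counts into fibers.  The point of
    the coordinate space depends on the fiber, but the number of signed
    permutations with a given flat does not depend on the point. *)
Lemma count_flags (R : realType) d n (B : bool) (y : 'I_n -> 'rV[R]_d)
    (x : 'rV[R]_d) r :
  in_gp B y -> generic_for B y x -> (r < d)%N -> (r <= n)%N ->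
  (#|good_flags B y r x|)%:R = (cycle_poly R n B)`_(n - r).
Proof.
move=> gy gx rd rn; rewrite -count_cycles; congr (_%:R).
apply: (@card_fibers _ _ (set 'rV[R]_n)
  (fun f => span_of (chain (evec R n) f.1) f.2)
  (fun u => flat R n u.1 u.2 (root_cycle B u.1 u.2))) => S.
have [x' gx' xx'] := transfer S gy gx rd.
apply: etrans (etrans (count_root B S r gx') _).
  apply: eq_card => -[t I]; rewrite [RHS]finset.in_set [LHS]finset.in_set.
  rewrite [_ \in good_flags B y r x]finset.in_set.
  apply/andP/and5P => [[/and4P[a IM Ir h1] h2]|[a IM Ir h1 h2]].
    split; [exact: a|exact: IM|exact: Ir|exact: h2|].
    by apply/asboolP/(xx' t I a IM (eqP Ir) (eqP h2)); exact: asboolW h1.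
  split; last exact: h1; apply/and4P; split; [exact: a|exact: IM|exact: Ir|].
  by apply/asboolP/(xx' t I a IM (eqP Ir) (eqP h1)); exact: asboolW h2.
apply: eq_card => u; rewrite !inE -andbA; congr [&& _, _ & _].
by move: #|_| => k; apply/eqP/eqP; move: rn; clear; lia.
Qed.

(** * Counting chambers *)

Definition open_cone (R : realType) d (K : finType) (b : K -> 'rV[R]_d)
    (M : {set K}) : set 'rV[R]_d :=
  [set v | {in M, forall i, dotv v (b i) < 0}].

Definition chambers (R : realType) d n (B : bool) (y : 'I_n -> 'rV[R]_d) :
    {set signed_perm n} :=
  [set t : signed_perm n |
    allowed B t.1 && `[< open_cone (chain y t) (normals n B) !=set0 >] ].

Lemma generic_exists (R : realType) d n (B : bool) (y : 'I_n -> 'rV[R]_d) :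
  in_gp B y -> exists ws : seq 'rV[R]_d, all (fun w => w != 0) ws /\
    forall x, all (fun w => dotv x w != 0) ws -> generic_for B y x.
Proof.
move=> gy.
exists [seq height (chain y u.1.1) u.1.2 u.2 |
  u : signed_perm n * {set 'I_n} * 'I_n <-
    [seq u : signed_perm n * {set 'I_n} * 'I_n <- enum {: signed_perm n * {set 'I_n} * 'I_n} |
    [&& allowed B u.1.1.1, u.1.2 \subset normals n B, (#|u.1.2| < d)%N
      & u.2 \in normals n B] ] ]; split.
  apply/allP => _ /mapP[u uP ->]; move: uP; rewrite mem_filter.
  move=> /andP[/and4P[a IM Id iM] _]; apply: height_neq0; apply: gy => //.
    by apply/fintype.subsetP => j; rewrite !inE => /orP[/eqP->|/(fintype.subsetP IM)];
      move: iM; rewrite ?inE.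
  by rewrite cardsU1; case: (_ \notin _) => //=; rewrite ?add1n // add0n ltnW.
move=> x xP t a I IM Id i iM; apply: (allP xP); apply/mapP; exists (t, I, i) => //.
by rewrite mem_filter /= a IM Id iM mem_enum.
Qed.

Lemma generic_opp (R : realType) d n (B : bool) (y : 'I_n -> 'rV[R]_d) x :
  generic_for B y x -> generic_for B y (- x).
Proof. by move=> gx t a I IM Id i iM; rewrite dotvNl oppr_eq0 gx. Qed.

Definition family_mx (R : realType) d (K : finType) (b : K -> 'rV[R]_d)
    (I : {set K}) : 'M[R]_(#|I|, d) := \matrix_(k, j) b (enum_val k) 0 j.

Lemma row_free_family (R : realType) d (K : finType) (b : K -> 'rV[R]_d)
    (I : {set K}) : indep b I -> row_free (family_mx b I).
Proof.
move=> bI; rewrite -kermx_eq0; apply/eqP/row_matrixP => k; rewrite row0.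
set u := row k _.
have uA : u *m family_mx b I = 0 by apply/sub_kermxP; exact: row_sub.
apply/rowP => j; rewrite [RHS]mxE.
have ej : enum_val j \in I by exact: enum_valP.
pose l i := u 0 (enum_rank_in ej i).
have := bI l _ _ ej; rewrite /l enum_valK_in; apply.
rewrite (big_enum_val (A := mem I)) /= -[RHS]uA mulmx_sum_row.
apply: eq_bigr => i _; rewrite enum_valK_in; congr (_ *: _).
by apply/rowP => j'; rewrite !mxE.
Qed.

Lemma indep_full (R : realType) d (K : finType) (b : K -> 'rV[R]_d)
    (I : {set K}) (p : 'rV[R]_d) :
  indep b I -> (d <= #|I|)%N -> {in I, forall i, dotv p (b i) = 0} -> p = 0.
Proof.
move=> bI Id pI; have fullA : row_full (family_mx b I).
  by rewrite /row_full eqn_leq rank_leq_col (eqP (row_free_family bI)).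
have /submxP[u pE] := submx_full p fullA.
apply/eqP; rewrite -dotvv_eq0 {2}pE mulmx_sum_row dotv_sumr big1 // => k _.
rewrite (_ : row k _ = b (enum_val k)); last by apply/rowP => j; rewrite !mxE.
by rewrite dotvZr pI ?mulr0 ?enum_valP.
Qed.

Lemma subset_of_size (K : finType) (A : {set K}) k :
  (k <= #|A|)%N -> exists2 I : {set K}, I \subset A & #|I| = k.
Proof.
elim: k => [_|k IH kA]; first by exists finset.set0; rewrite ?finset.sub0set ?cards0.
have [I IA Ik] := IH (ltnW kA).
have /finset.set0Pn[a] : A :\: I != finset.set0.
  by rewrite -card_gt0 cardsD (finset.setIidPr IA) Ik subn_gt0.
rewrite inE => /andP[aI aA]; exists (a |: I); last by rewrite cardsU1 aI Ik.
by apply/fintype.subsetP => j; rewrite !inE => /orP[/eqP->|/(fintype.subsetP IA)].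
Qed.

Lemma active_full (R : realType) d (K : finType) (b : K -> 'rV[R]_d)
    (M I : {set K}) (p : 'rV[R]_d) :
  (forall I : {set K}, I \subset M -> (#|I| <= d)%N -> indep b I) ->
  I \subset M -> (d <= #|I|)%N -> {in I, forall i, dotv p (b i) = 0} -> p = 0.
Proof.
move=> bM IM dI pI; have [I' I'I I'd] := subset_of_size dI.
have bI' : indep b I'.
  by apply: bM; [exact: fintype.subset_trans IM|rewrite I'd].
apply: (indep_full bI') => [|i iI']; first by rewrite I'd.
exact/pI/(fintype.subsetP I'I).
Qed.

(** A nonzero projection is active on fewer than [d] constraints, hence falls
    in exactly one region; the projection is zero on the polar cone. *)
Lemma polar_or_region (R : realType) d n (B : bool) (y : 'I_n -> 'rV[R]_d)
    (t : signed_perm n) (x : 'rV[R]_d) :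
  in_gp B y -> allowed B t.1 ->
  (forall q, gcone (chain y t) (normals n B) q -> dotv x q <= 0) \/
  exists I : {set 'I_n}, [/\ I \subset normals n B, (#|I| < d)%N
    & region (chain y t) (normals n B) I x].
Proof.
move=> gy a; have [p pC pmin] := gcone_nearest (chain y t) (normals n B) x.
pose I := [set i in normals n B | dotv p (chain y t i) == 0]%SET.
have IM : I \subset normals n B by apply/fintype.subsetP => i; rewrite inE => /andP[].
have [Id|dI] := ltnP #|I| d.
  right; exists I; split=> //; exists p; apply: nearest_projects => //.
  by apply: gy => //; exact: ltnW.
have p0 : p = 0.
  by apply: (active_full (gy t a) IM dI) => i; rewrite inE => /andP[_ /eqP].
left=> q qC; rewrite leNgt; apply/negP => xq.
have qq := dotvv_ge0 q; pose s := dotv x q / (1 + dotv q q).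
have s0 : 0 < s by rewrite divr_gt0 // ltr_pwDl.
have sE : s * (1 + dotv q q) = dotv x q by rewrite divfK // gt_eqF // ltr_pwDl.
have : gcone (chain y t) (normals n B) (s *: q).
  by move=> i iM; rewrite dotvZl pmulr_rle0 // qC.
move/pmin; rewrite p0 subr0 dotvBB dotvZl !dotvZr; nra.
Qed.

Lemma polar_region_disjoint (R : realType) d n (B : bool) (y : 'I_n -> 'rV[R]_d)
    (t : signed_perm n) (x : 'rV[R]_d) (I : {set 'I_n}) :
  (d <= #|normals n B|)%N ->
  (forall q, gcone (chain y t) (normals n B) q -> dotv x q <= 0) ->
  I \subset normals n B -> (#|I| < d)%N ->
  region (chain y t) (normals n B) I x -> False.
Proof.
move=> dM xpol IM Id [p xp]; have := projects_orth xp.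
have := xpol p (projects_gcone xp); rewrite dotvBl => xp0 /eqP.
rewrite subr_eq0 => /eqP xpE; rewrite xpE in xp0.
have p0 : p = 0 by apply/eqP; rewrite -dotvv_eq0 eq_le xp0 dotvv_ge0.
have := projects_active IM xp; rewrite p0 => IE.
move: Id; rewrite ltnNge => /negP; apply; apply: leq_trans dM _.
rewrite {1}IE; apply: subset_leq_card; apply/fintype.subsetP => i iM.
by rewrite inE iM dotv0l eqxx.
Qed.

(** A point of the face moved along the inward direction dual to the active
    normals enters the open cone. *)
Lemma region_chamber (R : realType) d n (B : bool) (y : 'I_n -> 'rV[R]_d)
    (t : signed_perm n) (x : 'rV[R]_d) (I : {set 'I_n}) :
  in_gp B y -> allowed B t.1 -> I \subset normals n B -> (#|I| < d)%N ->
  region (chain y t) (normals n B) I x -> t \in chambers B y.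
Proof.
move=> gy a IM Id [p [l [_ _ pI pM]]]; rewrite inE a; apply/asboolP.
have gI : indep (chain y t) I by apply: gy => //; exact: ltnW.
pose u := - \sum_(i in I) height (chain y t) I i.
have uI i : i \in I -> dotv u (chain y t i) < 0.
  move=> iI; rewrite dotvNl dotv_suml (bigD1 i) //= big1 => [|j /andP[jI ji]].
    rewrite addr0 height_self oppr_lt0 dotvv_gt0; apply: height_neq0.
    by rewrite (finset.setUidPr _) ?finset.sub1set.
  by rewrite height_orth // eq_sym.
have [s s0 sP] := @small_step R _ (normals n B :\: I)
  (fun i => dotv p (chain y t i)) (fun i => dotv u (chain y t i)) pM.
exists (p + s *: u) => i iM; rewrite dotvDl dotvZl.
have [iI|iI] := boolP (i \in I); first by rewrite pI // add0r pmulr_rlt0 // uI.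
by apply: sP; [rewrite lexx ltW|apply/finset.setDP].
Qed.

Definition polar_chambers (R : realType) d n (B : bool) (y : 'I_n -> 'rV[R]_d)
    (x : 'rV[R]_d) : {set signed_perm n} :=
  [set t in chambers B y |
    `[< forall q, gcone (chain y t) (normals n B) q -> dotv x q <= 0 >] ].

(** A chamber is counted once, either as having [x] in its polar cone or through
    the unique nonzero face on which [x] projects. *)
Lemma chambers_polar (R : realType) d n (B : bool) (y : 'I_n -> 'rV[R]_d)
    (x : 'rV[R]_d) :
  in_gp B y -> (d <= #|normals n B|)%N ->
  #|chambers B y| =
    (#|polar_chambers B y x| + \sum_(r < d) #|good_flags B y r x|)%N.
Proof.
move=> gy dM; rewrite -(cardsID (polar_chambers B y x) (chambers B y)).
have -> : chambers B y :&: polar_chambers B y x = polar_chambers B y x.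
  by apply/finset.setIidPr/fintype.subsetP => t; rewrite inE => /andP[].
congr addn.
pose F := [set f : signed_perm n * {set 'I_n} |
  [&& allowed B f.1.1, f.2 \subset normals n B, (#|f.2| < d)%N
    & `[< region (chain y f.1) (normals n B) f.2 x >] ] ]%SET.
transitivity #|F|; last first.
  rewrite -[LHS]sum1_card (partition_big (fun f : _ * {set 'I_n} => inord #|f.2| : 'I_n.+1) xpredT) //=.
  transitivity (\sum_(r < n.+1 | (r < d)%N) #|good_flags B y r x|)%N.
    rewrite [RHS]big_mkcond; apply: eq_bigr => r _; case: ifPn => rd.
      rewrite -sum1_card; apply: eq_bigl => f; rewrite !inE.
      have -> : (inord #|f.2| == r :> 'I_n.+1) = (#|f.2| == r).
        by rewrite -val_eqE /= inordK // ltnS -[leqRHS]card_ord max_card.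
      by case: eqVneq => [->|]; rewrite ?andbF ?andbT ?rd ?andTb.
    rewrite big_pred0 // => f; rewrite !inE.
    have -> : (inord #|f.2| == r :> 'I_n.+1) = (#|f.2| == r).
      by rewrite -val_eqE /= inordK // ltnS -[leqRHS]card_ord max_card.
    by case: eqVneq => [->|]; rewrite ?andbF // (negbTE rd) !andbF.
  have dn : (d <= n.+1)%N.
    by rewrite (leq_trans dM) // leqW // -[leqRHS](card_ord n) max_card.
  by rewrite (big_ord_widen n.+1 (fun r => #|good_flags B y r x|)).
have Fimg : [set f.1 | f in F]%SET = chambers B y :\: polar_chambers B y x.
  apply/setP => t; rewrite [RHS]inE; apply/imsetP/andP => [[[t' I]]|[npol tC]].
    rewrite inE /= => /and4P[a IM Id /asboolP tI] ->; split; last first.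
      exact: (region_chamber gy a IM Id tI).
    rewrite inE negb_and; apply/orP; right; apply/negP => /asboolP pol.
    exact: (polar_region_disjoint dM pol IM Id tI).
  have a : allowed B t.1 by move: tC; rewrite inE => /andP[].
  have [pol|[I [IM Id tI]]] := polar_or_region x gy a.
    by move: npol; rewrite inE tC /=; case/negP; apply/asboolP.
  by exists (t, I) => //; rewrite inE /= a IM Id; apply/asboolP.
rewrite -Fimg card_in_imset // => -[t I] [t' I']; rewrite !inE /=.
move=> /and4P[_ IM _ /asboolP tI] /and4P[_ IM' _ /asboolP tI'] tt'.
by move: tI'; rewrite -tt' => tI'; rewrite (region_uniq IM IM' tI tI').
Qed.

Definition cut_chambers (R : realType) d n (B : bool) (y : 'I_n -> 'rV[R]_d)
    (x : 'rV[R]_d) : {set signed_perm n} :=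
  [set t : signed_perm n | allowed B t.1 &&
    `[< exists2 v, open_cone (chain y t) (normals n B) v & dotv x v = 0 >] ].

(** On an open convex cone a nonzero linear functional is negative, is positive
    or vanishes somewhere. *)
Lemma chambers_cut (R : realType) d n (B : bool) (y : 'I_n -> 'rV[R]_d)
    (x : 'rV[R]_d) :
  x != 0 ->
  #|chambers B y| = (#|polar_chambers B y x| + #|polar_chambers B y (- x)|
                     + #|cut_chambers B y x|)%N.
Proof.
move=> x0.
have move_in t v (w : 'rV[R]_d) : open_cone (chain y t) (normals n B) v ->
    exists2 s : R, 0 < s & gcone (chain y t) (normals n B) (v + s *: w).
  move=> vO; have [s s0 sP] := @small_step R _ (normals n B)
    (fun i => dotv v (chain y t i)) (fun i => dotv w (chain y t i)) vO.
  exists s => // i iM; rewrite dotvDl dotvZl; apply/ltW/sP => //.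
  by rewrite lexx ltW.
have xx : 0 < dotv x x by rewrite dotvv_gt0.
have open_polar t v : open_cone (chain y t) (normals n B) v ->
    (forall q, gcone (chain y t) (normals n B) q -> dotv x q <= 0) -> dotv x v < 0.
  move=> vO pol; have [s s0 /pol] := move_in t v x vO.
  by rewrite dotvDr dotvZr; nra.
have open_polarN t v : open_cone (chain y t) (normals n B) v ->
    (forall q, gcone (chain y t) (normals n B) q -> dotv (- x) q <= 0) -> 0 < dotv x v.
  move=> vO pol; have [s s0 /pol] := move_in t v (- x) vO.
  by rewrite dotvDr dotvZr !dotvNl dotvNr opprK; nra.
rewrite -cardsUI; have -> : polar_chambers B y x :&: polar_chambers B y (- x) = finset.set0.
  apply/setP => t; rewrite !inE; apply/negP => /andP[/andP[/andP[_ /asboolP[v vO]] /asboolP p1]].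
  move=> /andP[_ /asboolP p2]; have := open_polar t v vO p1.
  by have := open_polarN t v vO p2; lra.
rewrite cards0 addn0 -cardsUI.
set U := polar_chambers B y x :|: _.
have -> : U :&: cut_chambers B y x = finset.set0.
  apply/setP => t; rewrite !inE; apply/negP => /andP[H /andP[_ /asboolP[v vO xv]]].
  case/orP: H => /andP[_ /asboolP p1].
    by have := open_polar t v vO p1; rewrite xv ltxx.
  by have := open_polarN t v vO p1; rewrite xv ltxx.
rewrite cards0 addn0; apply: eq_card => t; rewrite !inE -andb_orr.
have [a /=|//] := boolP (allowed B t.1); apply/idP/idP; last first.
  by move=> /orP[/andP[]//|/asboolP[v vO _]]; apply/asboolP; exists v.
move=> H; rewrite H /=; case/asboolP: H => v vO.
have [p1|np1] := pselect (forall q, gcone (chain y t) (normals n B) q -> dotv x q <= 0).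
  by rewrite (asboolT p1).
have [p2|np2] := pselect (forall q, gcone (chain y t) (normals n B) q -> dotv (- x) q <= 0).
  by rewrite (asboolT p2) orbT.
apply/orP; right; apply/asboolP.
have opening q : gcone (chain y t) (normals n B) q ->
    forall s : R, 0 < s -> open_cone (chain y t) (normals n B) (q + s *: v).
  move=> qC s s0 i iM; rewrite dotvDl dotvZl.
  by have := qC i iM; have := vO i iM; nra.
have strict (z : 'rV[R]_d) q : gcone (chain y t) (normals n B) q -> 0 < dotv z q ->
    exists2 q', open_cone (chain y t) (normals n B) q' & 0 < dotv z q'.
  move=> qC zq; pose s := dotv z q / (1 + `|dotv z v|).
  have den : 0 < 1 + `|dotv z v| by rewrite ltr_pwDl.
  have s0 : 0 < s by rewrite divr_gt0.
  have sE : s * (1 + `|dotv z v|) = dotv z q by rewrite divfK // gt_eqF.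
  exists (q + s *: v); first exact: opening.
  rewrite dotvDr dotvZr; have := ler_norm (- dotv z v); rewrite normrN; nra.
have [q1 q1O xq1] : exists2 q', open_cone (chain y t) (normals n B) q' & 0 < dotv x q'.
  apply: contrapT => no; apply: np1 => q qC; rewrite leNgt; apply/negP => xq.
  by apply: no; exact: strict xq.
have [q2 q2O] : exists2 q', open_cone (chain y t) (normals n B) q' & 0 < dotv (- x) q'.
  apply: contrapT => no; apply: np2 => q qC; rewrite leNgt; apply/negP => xq.
  by apply: no; exact: strict xq.
rewrite dotvNl oppr_gt0 => xq2.
(* the functional has opposite signs at [q1] and [q2] *)
exists ((- dotv x q2) *: q1 + dotv x q1 *: q2).
  move=> i iM; rewrite dotvDl !dotvZl.
  by have := q1O i iM; have := q2O i iM; nra.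
by rewrite dotvDr !dotvZr; ring.
Qed.

(** Coordinates on the hyperplane orthogonal to [x], obtained by solving for
    the coordinate [k], and the adjoint projection. *)
Definition hyp_emb (R : realType) d (x : 'rV[R]_d.+1) (k : 'I_d.+1)
    (u : 'rV[R]_d) : 'rV[R]_d.+1 :=
  \row_j (if unlift k j is Some j' then u 0 j'
          else - (\sum_i u 0 i * x 0 (lift k i)) / x 0 k).

Definition hyp_proj (R : realType) d (x : 'rV[R]_d.+1) (k : 'I_d.+1)
    (w : 'rV[R]_d.+1) : 'rV[R]_d :=
  \row_j (w 0 (lift k j) - w 0 k * x 0 (lift k j) / x 0 k).

Lemma dotv_lift (R : realType) d (k : 'I_d.+1) (u w : 'rV[R]_d.+1) :
  dotv u w = u 0 k * w 0 k + \sum_j u 0 (lift k j) * w 0 (lift k j).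
Proof. by rewrite /dotv (bigD1_ord k). Qed.

Lemma hyp_adj (R : realType) d (x : 'rV[R]_d.+1) (k : 'I_d.+1) u w :
  dotv (hyp_emb x k u) w = dotv u (hyp_proj x k w).
Proof.
rewrite (dotv_lift k) /hyp_emb !mxE unlift_none /dotv.
under [X in _ + X]eq_bigr do rewrite mxE liftK.
under [RHS]eq_bigr do rewrite mxE mulrBr.
rewrite sumrB addrC; congr (_ + _).
rewrite mulNr mulr_suml mulNr mulr_suml; congr (- _).
by apply: eq_bigr => j _; ring.
Qed.

Lemma hyp_embK (R : realType) d (x : 'rV[R]_d.+1) (k : 'I_d.+1) (v : 'rV[R]_d.+1) :
  x 0 k != 0 -> dotv x v = 0 -> v = hyp_emb x k (\row_j v 0 (lift k j)).
Proof.
move=> xk; rewrite (dotv_lift k) => /eqP; rewrite addr_eq0 => /eqP xv.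
apply/rowP => j; rewrite mxE; case: unliftP => [j' ->|->]; first by rewrite mxE.
under eq_bigr do rewrite mxE.
rewrite -[LHS](mulKf xk) xv mulrC; congr (- _ * _).
by apply: eq_bigr => i _; rewrite mulrC.
Qed.

Lemma hyp_emb_orth (R : realType) d (x : 'rV[R]_d.+1) (k : 'I_d.+1) u :
  x 0 k != 0 -> dotv x (hyp_emb x k u) = 0.
Proof.
move=> xk; rewrite dotvC hyp_adj /dotv big1 // => j _.
by rewrite mxE [X in _ - X]mulrAC divff // mul1r subrr mulr0.
Qed.

Lemma hyp_projD (R : realType) d (x : 'rV[R]_d.+1) (k : 'I_d.+1) w w' :
  hyp_proj x k (w + w') = hyp_proj x k w + hyp_proj x k w'.
Proof. by apply/rowP => j; rewrite !mxE; ring. Qed.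

Lemma hyp_projZ (R : realType) d (x : 'rV[R]_d.+1) (k : 'I_d.+1) a w :
  hyp_proj x k (a *: w) = a *: hyp_proj x k w.
Proof. by apply/rowP => j; rewrite !mxE; ring. Qed.

Lemma hyp_proj_sum (R : realType) d (x : 'rV[R]_d.+1) (k : 'I_d.+1)
    (K : finType) (I : {set K}) (l : K -> R) (F : K -> 'rV[R]_d.+1) :
  hyp_proj x k (\sum_(i in I) l i *: F i) =
  \sum_(i in I) l i *: hyp_proj x k (F i).
Proof.
rewrite (big_morph _ (hyp_projD x k) (id1 := 0)) => [|].
  by apply: eq_bigr => i _; rewrite hyp_projZ.
by apply/rowP => j; rewrite !mxE; ring.
Qed.

Lemma hyp_proj_ker (R : realType) d (x : 'rV[R]_d.+1) (k : 'I_d.+1) w :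
  x 0 k != 0 -> hyp_proj x k w = 0 -> w = (w 0 k / x 0 k) *: x.
Proof.
move=> xk w0; apply/rowP => j; rewrite mxE.
have [j' ->|->] := unliftP k j; last by rewrite divfK.
have := congr1 (fun u : 'rV[R]_d => u 0 j') w0; rewrite !mxE => /eqP.
by rewrite subr_eq0 => /eqP ->; rewrite mulrAC.
Qed.

Lemma chain_hyp (R : realType) d n (y : 'I_n -> 'rV[R]_d.+1) x k t i :
  chain (fun a => hyp_proj x k (y a)) t i = hyp_proj x k (chain y t i).
Proof.
rewrite /chain; case: ifP => _; last by rewrite !subr0 hyp_projZ.
by rewrite -!scaleNr hyp_projD !hyp_projZ.
Qed.

(** The trace of a chamber on the hyperplane is the chamber of the same signed
    permutation for the projected vectors. *)
Lemma cut_chambersE (R : realType) d n (B : bool) (y : 'I_n -> 'rV[R]_d.+1)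
    (x : 'rV[R]_d.+1) (k : 'I_d.+1) :
  x 0 k != 0 -> cut_chambers B y x = chambers B (fun a => hyp_proj x k (y a)).
Proof.
move=> xk; apply/setP => t; rewrite !inE; congr (_ && _).
apply/asboolP/asboolP => [[v vO xv]|[u uO]].
  exists (\row_j v 0 (lift k j)) => i iM.
  by rewrite chain_hyp -hyp_adj -hyp_embK // vO.
exists (hyp_emb x k u); last exact: hyp_emb_orth.
by move=> i iM; rewrite hyp_adj -chain_hyp uO.
Qed.

(** A vanishing combination of fewer than [d.+1] projected normals is a multiple
    of [x] in the span of these normals, hence orthogonal to a height to which a
    generic [x] is not. *)
Lemma in_gp_hyp (R : realType) d n (B : bool) (y : 'I_n -> 'rV[R]_d.+1)
    (x : 'rV[R]_d.+1) (k : 'I_d.+1) :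
  (d < #|normals n B|)%N -> in_gp B y -> generic_for B y x -> x 0 k != 0 ->
  in_gp B (fun a => hyp_proj x k (y a)).
Proof.
move=> dM gy gx xk t a I IM Id l l0.
have [i iMI] : exists i, i \in normals n B :\: I.
  apply/finset.set0Pn; rewrite -card_gt0 cardsD (finset.setIidPr IM) subn_gt0.
  exact: leq_ltn_trans dM.
move: iMI; rewrite inE => /andP[iI iM].
pose w := \sum_(j in I) l j *: chain y t j.
have : hyp_proj x k w = 0.
  by rewrite hyp_proj_sum -[RHS]l0; apply: eq_bigr => j _; rewrite chain_hyp.
move/(hyp_proj_ker xk); set c := _ / _ => wE.
have c0 : c = 0.
  have h := gx t a I IM Id i iM.
  have : dotv (height (chain y t) I i) w = 0.
    apply: dotv_span0 => j jI; apply: height_orth => //.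
    by apply: contraNneq iI => <-.
  by rewrite wE dotvZr dotvC => /eqP; rewrite mulf_eq0 (negbTE h) orbF => /eqP.
by apply: (gy t a I IM (leqW Id)); rewrite -/w wE c0 scale0r.
Qed.

(** * Sums of every other Stirling number *)

Definition stirling (R : realType) (B : bool) (n : nat) (k : int) : R :=
  if B then stirlingB R n k else stirlingA R n k.

Definition chamber_number (R : realType) (B : bool) (n d : nat) : R :=
  if B then DB R n d else DA R n d.

Lemma stirlingE (R : realType) B n (k : nat) :
  stirling R B n k%:Z = (cycle_poly R n B)`_k.
Proof. by case: B. Qed.

Lemma cycle_poly_big (R : realType) B n k : (n < k)%N -> (cycle_poly R n B)`_k = 0.
Proof.
move=> nk; apply: nth_default; apply: leq_trans nk.
have H c : size ('X + c%:P : {poly R}) = 2%N by rewrite size_XaddC.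
rewrite /cycle_poly size_prod => [|i _]; last by rewrite -size_poly_eq0 H.
rewrite (eq_bigr (fun=> 2%N)) => [|i _]; last exact: H.
by rewrite sum_nat_const card_ord; lia.
Qed.

Lemma chamber_numberE (R : realType) B n d : (d <= n)%N ->
  chamber_number R B n d =
  2 * \sum_(i < d) (cycle_poly R n B)`_(n - d + 1 + i.*2).
Proof.
move=> dn; have E (i : 'I_d) :
    n%:Z - d%:Z + 1 + 2 * i%:Z = (n - d + 1 + i.*2)%N%:Z :> int by lia.
rewrite /chamber_number /DA /DB; case: B; congr (_ * _); apply: eq_bigr => i _;
  by rewrite E -stirlingE.
Qed.

Lemma sum_even_odd (R : realType) (f : nat -> R) d :
  \sum_(i < d.+1) f i.*2 + \sum_(i < d) f (1 + i.*2)%N = \sum_(m < d.*2.+1) f m.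
Proof.
elim: d => [|d IH]; first by rewrite !big_ord1 big_ord0 addr0.
rewrite [\sum_(i < d.+2) _]big_ord_recr [\sum_(i < d.+1) f (1 + _)%N]big_ord_recr.
rewrite doubleS [RHS]big_ord_recr [X in _ = X + _]big_ord_recr /= -IH add1n; ring.
Qed.

(** The indices of two consecutive sums interleave. *)
Lemma chamber_number_rec (R : realType) B n d : (d < n)%N ->
  chamber_number R B n d.+1 + chamber_number R B n d =
  2 * \sum_(r < d.+1) (cycle_poly R n B)`_(n - r).
Proof.
move=> dn; rewrite !chamber_numberE ?(ltnW dn) // -mulrDr; congr (_ * _).
pose f m := (cycle_poly R n B)`_(n - d + m).
transitivity (\sum_(i < d.+1) f i.*2 + \sum_(i < d) f (1 + i.*2)%N).
  congr (_ + _); apply: eq_bigr => i _; rewrite /f; congr (_`_ _); lia.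
rewrite sum_even_odd; transitivity (\sum_(m < d.+1) f m).
  rewrite (@big_ord_widen _ _ _ d.+1 d.*2.+1 f) 1?ltnS -?addnn ?leq_addr //.
  rewrite [RHS]big_mkcond; apply: eq_bigr => m _; case: ifPn => // dm.
  by rewrite /f cycle_poly_big //; lia.
rewrite (reindex_inj rev_ord_inj); apply: eq_bigr => r _ /=; rewrite /f.
by congr (_`_ _); have := ltn_ord r; lia.
Qed.

(** For a generic [x] as many polar cones contain [x] as contain [- x], because
    the chambers on whose nonzero faces a generic point projects are equally
    many for all such points; the chambers that meet the hyperplane orthogonal
    to [x] are those of vectors in general position in one dimension less. *)
Lemma card_chambers (R : realType) d n (B : bool) (y : 'I_n -> 'rV[R]_d) :
  in_gp B y -> (0 < #|normals n B|)%N -> (d <= #|normals n B|)%N ->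
  (#|chambers B y|)%:R = chamber_number R B n d.
Proof.
elim: d y => [|d IH] y gy M0 dM.
  have -> : chambers B y = finset.set0.
    apply/setP => t; rewrite !inE; apply/negP => /andP[_ /asboolP[v vO]].
    move/card_gt0P: M0 => [i iM]; have := vO i iM.
    by rewrite /dotv big_ord0 ltxx.
  by rewrite cards0 /chamber_number /DA /DB; case: B {gy M0 dM}; rewrite big_ord0 mulr0.
have [ws [ws0 wsP]] := generic_exists gy.
have [x /wsP gx] := vector_avoid ws0.
have dn : (d < n)%N by rewrite (leq_trans dM) // -[leqRHS](card_ord n) max_card.
have x0 : x != 0.
  apply/eqP => x0; move/card_gt0P: M0 => [i iM].
  have [t a] : exists t : signed_perm n, allowed B t.1.
    by exists ([ffun=> false], 1%g); rewrite /allowed eqxx orbT.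
  have := gx t a finset.set0 (finset.sub0set _); rewrite cards0 => /(_ isT i iM).
  by rewrite x0 dotv0l eqxx.
have [k xk] : exists k, x 0 k != 0.
  apply/existsP; rewrite -negb_forall; apply: contraNN x0 => /forallP x0.
  by apply/eqP/rowP => k; rewrite mxE; apply/eqP.
have counts z : generic_for B y z ->
    (\sum_(r < d.+1) #|good_flags B y r z|)%:R =
    \sum_(r < d.+1) (cycle_poly R n B)`_(n - r).
  move=> gz; rewrite natr_sum; apply: eq_bigr => r _; apply: count_flags => //.
  by rewrite (leq_trans (ltnW (ltn_ord r))).
have e1 := chambers_polar x gy dM; have e2 := chambers_polar (- x) gy dM.
have e3 := chambers_cut B y x0.
have := IH _ (in_gp_hyp dM gy gx xk) M0 (ltnW dM); rewrite -cut_chambersE // => e4.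
have c1 := counts _ gx; have c2 := counts _ (generic_opp gx).
have := chamber_number_rec R B dn; rewrite -c1 -e4.
have c12 : (\sum_(r < d.+1) #|good_flags B y r x|)%:R =
           (\sum_(r < d.+1) #|good_flags B y r (- x)|)%:R :> R by rewrite c1 c2.
have {}e1 := congr1 (fun m => m%:R : R) e1; have {}e2 := congr1 (fun m => m%:R : R) e2.
have {}e3 := congr1 (fun m => m%:R : R) e3; rewrite /= !natrD in e1 e2 e3.
move=> rec; rewrite -c12 in e2; lra.
Qed.

(** * Faces of a cone in general position *)

Lemma sum_image (R : realType) (T : finType) (J : choiceType) (A : {set T})
    (h : T -> J) (F : J -> R) :
  {in A &, injective h} ->
  \sum_(j \in h @` [set` A]) F j = \sum_(i in A) F (h i).
Proof.
move=> hA; rewrite fsbig_image => [|i j]; last by rewrite !inE; exact: hA.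
rewrite (_ : [set` A] = [set` enum A]).
  by rewrite -fsbig_seq ?enum_uniq // big_enum.
by apply/seteqP; split => i /=; rewrite mem_enum.
Qed.

Definition gface (R : realType) d (K : finType) (b : K -> 'rV[R]_d)
    (M I : {set K}) : set 'rV[R]_d :=
  gcone b M `&` [set v | {in I, forall i, dotv v (b i) = 0}].

Definition strict_on (R : realType) d (K : finType) (b : K -> 'rV[R]_d)
    (M I : {set K}) (v : 'rV[R]_d) : Prop :=
  {in I, forall i, dotv v (b i) = 0} /\ {in M :\: I, forall i, dotv v (b i) < 0}.

Definition exact_face (R : realType) d (K : finType) (b : K -> 'rV[R]_d)
    (M I : {set K}) : Prop := exists v, strict_on b M I v.

Lemma strict_gface (R : realType) d (K : finType) (b : K -> 'rV[R]_d)
    (M I : {set K}) v : strict_on b M I v -> gface b M I v.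
Proof.
move=> [vI vM]; split=> // i iM; have [iI|iI] := boolP (i \in I).
  by rewrite vI.
by apply/ltW/vM/finset.setDP.
Qed.

Lemma hface_extreme (R : realType) d m (a : 'I_m -> 'rV[R]_d) (J : {set 'I_m}) u w :
  hcone a u -> hcone a w -> hface a J (u + w) -> hface a J u.
Proof.
move=> uC wC [_ uw]; split=> // i iJ; have := uw i iJ; rewrite dotvDl.
by have := uC i; have := wC i; lra.
Qed.

(** A face is an extreme subcone; choosing a point of it at which as few
    constraints as possible are active recovers it from its active set.  This
    makes the notion of face independent of the half-spaces chosen. *)
Lemma is_face_gface (R : realType) d (K : finType) (b : K -> 'rV[R]_d)
    (M : {set K}) (F : set 'rV[R]_d) :
  is_face (gcone b M) F ->
  exists I : {set K}, [/\ I \subset M, exact_face b M I & F = gface b M I].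
Proof.
case=> m [a [J [_ CE FE]]].
have FC v : F v -> gcone b M v by rewrite FE CE => -[].
have F0 : F 0 by rewrite FE; split=> i; rewrite dotv0l.
have FD u w : F u -> F w -> F (u + w).
  rewrite FE => -[uC uJ] [wC wJ]; split=> i; rewrite dotvDl.
    by have := uC i; have := wC i; lra.
  by move=> iJ; rewrite uJ // wJ // addr0.
have FZ (s : R) u : 0 <= s -> F u -> F (s *: u).
  move=> s0; rewrite FE => -[uC uJ]; split=> i; rewrite dotvZl.
    by rewrite mulr_ge0_le0.
  by move=> iJ; rewrite uJ // mulr0.
have Fext u w : gcone b M u -> gcone b M w -> F (u + w) -> F u.
  by rewrite FE CE; exact: hface_extreme.
pose I := [set i in M | `[< forall w, F w -> dotv w (b i) = 0 >] ]%SET.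
have IM : I \subset M by apply/fintype.subsetP => i; rewrite inE => /andP[].
have witness i : exists w, F w /\ (i \in M :\: I -> dotv w (b i) < 0).
  have [|iI] := boolP (i \in M :\: I); last by exists 0.
  rewrite !inE => /andP[+ iM]; rewrite iM /= => /asboolPn/existsNP[w /not_implyP[Fw /eqP wi]].
  by exists w; split=> // _; rewrite lt_neqAle wi FC.
have [w wP] := choice witness.
pose v := \sum_(i in M :\: I) w i.
have Fv : F v.
  by rewrite /v; elim/big_ind : _ => // i _; exact: (wP i).1.
have vI : strict_on b M I v.
  split=> i iI; first by move: (iI); rewrite inE => /andP[_ /asboolP]; apply.
  rewrite /v dotv_suml (bigD1 i) //= ltr_wnDr //; last exact: (wP i).2.
  apply: sumr_le0 => j _; apply: FC; first exact: (wP j).1.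
  by case/finset.setDP: iI.
exists I; split=> //; first by exists v.
apply/seteqP; split=> u; first by move=> Fu; split;
  [exact: FC|move=> i; rewrite inE => /andP[_ /asboolP]; apply].
case=> uC uI; have [s s0 sP] := @small_step R _ (M :\: I)
  (fun i => dotv v (b i)) (fun i => - dotv u (b i)) vI.2.
have vsC : gcone b M (v - s *: u).
  move=> i iM; rewrite dotvBl dotvZl -mulrN; have [iI|iI] := boolP (i \in I).
    by rewrite vI.1 // uI // oppr0 mulr0 addr0.
  by apply/ltW/sP; [rewrite lexx ltW|apply/finset.setDP].
have suF : F (s *: u).
  apply: (Fext _ (v - s *: u)) => //; last by rewrite addrC subrK.
  by move=> i iM; rewrite dotvZl pmulr_rle0 // uC.
by rewrite -[u](scalerK (lt0r_neq0 s0)); apply: FZ => //; rewrite invr_ge0 ltW.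
Qed.

Lemma gface_is_face (R : realType) d (K : finType) (b : K -> 'rV[R]_d)
    (M I : {set K}) :
  {in M, forall i, b i != 0} -> I \subset M -> is_face (gcone b M) (gface b M I).
Proof.
move=> b0 IM; exists #|M|, (fun k => b (enum_val k)),
  [set k : 'I_#|M| | enum_val k \in I]%SET.
have CE : gcone b M = hcone (fun k : 'I_#|M| => b (enum_val k)).
  apply/seteqP; split=> v vC => [k|i iM]; first by apply: vC; exact: enum_valP.
  by have := vC (enum_rank_in iM i); rewrite enum_rankK_in.
split=> //; first by move=> k; apply: b0; exact: enum_valP.
rewrite /hface /gface CE; congr (_ `&` _).
apply/seteqP; split=> v /= vI => [k|i iI]; first by rewrite inE => /vI.
have iM := fintype.subsetP IM i iI.
by have := vI (enum_rank_in iM i); rewrite inE enum_rankK_in // => /(_ iI).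
Qed.

(** The space orthogonal to the vectors indexed by [I], as the kernel of the
    family of their scalar products. *)
Definition orth_map (R : realType) d (K : finType) (b : K -> 'rV[R]_d)
    (I : {set K}) : 'Hom('rV[R]_d, 'rV[R]_#|I|) :=
  linfun (mulmxr (family_mx b I)^T).

Definition orth (R : realType) d (K : finType) (b : K -> 'rV[R]_d)
    (I : {set K}) : {vspace 'rV[R]_d} :=
  lker (orth_map b I).

Lemma orthP (R : realType) d (K : finType) (b : K -> 'rV[R]_d)
    (I : {set K}) (v : 'rV[R]_d) :
  v \in orth b I <-> {in I, forall i, dotv v (b i) = 0}.
Proof.
have E k : (v *m (family_mx b I)^T) 0 k = dotv v (b (enum_val k)).
  by rewrite mxE; apply: eq_bigr => j _; rewrite !mxE.
rewrite /orth memv_ker /orth_map lfunE /=; split=> [/eqP v0 i iI|vI].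
  by rewrite -(enum_rankK_in iI iI) -E v0 mxE.
by apply/eqP/rowP => k; rewrite E mxE vI // enum_valP.
Qed.

Lemma dim_orth (R : realType) d (K : finType) (b : K -> 'rV[R]_d)
    (I : {set K}) : indep b I -> \dim (orth b I) = (d - #|I|)%N.
Proof.
move=> bI; have fullA : row_full (family_mx b I)^T.
  by rewrite /row_full mxrank_tr; exact: row_free_family.
have := limg_ker_dim (orth_map b I) fullv; rewrite capfv -/(orth b I).
have -> : limg (orth_map b I) = fullv.
  apply/vspaceP => u; rewrite memvf; have /submxP[v ->] := submx_full u fullA.
  have -> : v *m (family_mx b I)^T = orth_map b I v by rewrite lfunE.
  by rewrite memv_img // memvf.
rewrite !dimvf !dim_matrix !mul1r.
by move/(congr1 (subn^~ #|I|)); rewrite addnK.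
Qed.

Section SimpleCone.
Context (R : realType) (d : nat) (K : finType) (b : K -> 'rV[R]_d) (M : {set K}).
Context (bM : forall I : {set K}, I \subset M -> (#|I| <= d)%N -> indep b I).
Context (dM : (d <= #|M|)%N) (d0 : (0 < d)%N).

Lemma dim_orth_sub (I : {set K}) : I \subset M -> \dim (orth b I) = (d - #|I|)%N.
Proof.
move=> IM; have [Id|dI] := leqP #|I| d; first by apply: dim_orth; exact: bM.
have -> : (d - #|I|)%N = 0%N by apply/eqP; rewrite subn_eq0 ltnW.
apply/eqP; rewrite dimv_eq0; apply/eqP/vspaceP => v; rewrite memv0.
apply/idP/eqP => [/orthP vI|->]; last exact: mem0v.
exact: (active_full bM IM (ltnW dI)).
Qed.

(** A point at which exactly the constraints of [I] are active can be moved a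
    little in all the directions orthogonal to the vectors of [I]. *)
Lemma hull_gface (I : {set K}) : exact_face b M I -> linear_hull (gface b M I) = orth b I.
Proof.
move=> [v vI]; have vF := strict_gface vI.
have sub (V : {vspace 'rV[R]_d}) : gface b M I `<=` [set` V] -> (orth b I <= V)%VS.
  move=> FV; apply/subvP => u /orthP uI.
  have [s s0 sP] := @small_step R _ (M :\: I)
    (fun i => dotv v (b i)) (fun i => dotv u (b i)) vI.2.
  have : gface b M I (v + s *: u).
    apply: strict_gface; split=> i iI; rewrite dotvDl dotvZl.
      by rewrite vI.1 // uI // mulr0 addr0.
    by apply: sP; rewrite ?lexx ?ltW.
  move/FV => /= vsu; have vV : v \in V by exact: FV vF.
  have : s *: u \in V by rewrite -(addKr v (s *: u)) rpredD // rpredN.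
  by move/(memvZ s^-1); rewrite scalerK // gt_eqF.
have F_orth : gface b M I `<=` [set` orth b I] by move=> u [_ uI]; exact/orthP.
apply: xget_unique => [|U [FU Umin]]; first by split.
by apply/eqP; rewrite eqEsubv Umin //= sub.
Qed.

Lemma set_dim_gface (I : {set K}) :
  I \subset M -> exact_face b M I -> set_dim (gface b M I) = (d - #|I|)%N.
Proof. by move=> IM eI; rewrite /set_dim hull_gface // dim_orth_sub. Qed.

Lemma relint_gface (I : {set K}) p :
  exact_face b M I -> relint (gface b M I) p <-> strict_on b M I p.
Proof.
move=> eI; case: (eI) => v vI; split=> [[pF pnear]|pI].
  case: (pF) => pC pI; split=> // i /[dup] /finset.setDP[iM iI] iMI.
  rewrite lt_neqAle pC // andbT; apply/eqP => pi0.
  (* step slightly from [v] through [p] and beyond *)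
  move: pnear => /nbhs_ballP[e /= e0 eP].
  pose s := e / 2 / (1 + `|p - v|).
  have den : 0 < 1 + `|p - v| by rewrite ltr_pwDl.
  have s0 : 0 < s by rewrite !divr_gt0.
  have := eP (p + s *: (p - v)); rewrite -ball_normE /ball_ /= opprD addrA subrr.
  rewrite sub0r normrN normrZ gtr0_norm //.
  have se : s * `|p - v| < e.
    apply: (@le_lt_trans _ _ (e / 2)); last by rewrite ltr_pdivrMr // ltr_pMr // ltr1n.
    rewrite /s -mulrA ler_piMr ?divr_ge0 ?(ltW e0) // mulrC ler_pdivrMr //.
    by rewrite mul1r lerDr.
  move=> /(_ se); rewrite hull_gface // => H; have : gface b M I (p + s *: (p - v)).
    by apply: H; apply/orthP => j jI; rewrite dotvDl dotvZl dotvBl pI // vI.1 // subrr mulr0 addr0.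
  move=> [/(_ i iM)]; rewrite dotvDl dotvZl dotvBl pi0 sub0r add0r => h _.
  by have := vI.2 i iMI; nra.
split; first exact: strict_gface.
rewrite hull_gface //.
have each i : nbhs p [set y | i \in M :\: I -> dotv y (b i) < 0].
  have [iMI|iMI] := boolP (i \in M :\: I); last first.
    by apply: (filterS _ (@filterT _ (nbhs p) _)) => y _ /=.
  have : nbhs p [set y | dotv y (b i) < 0].
    have := @continuous_dotvl R d (b i) p [set r | r < 0].
    by apply; apply: open_nbhs_nbhs; split; [exact: open_lt|exact: pI.2].
  by apply: filterS => y yi _.
have all_i : nbhs p [set y | forall i, i \in M :\: I -> dotv y (b i) < 0].
  exact: filter_forall each.
by apply: (filterS _ all_i) => y yM /orthP yI; apply: strict_gface.
Qed.

End SimpleCone.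

Lemma gface_inj (R : realType) d (K : finType) (b : K -> 'rV[R]_d)
    (M I I' : {set K}) :
  I \subset M -> I' \subset M -> exact_face b M I -> exact_face b M I' ->
  gface b M I = gface b M I' -> I = I'.
Proof.
have half (J J' : {set K}) : J' \subset M -> exact_face b M J ->
    gface b M J = gface b M J' -> J' \subset J.
  move=> J'M [v vJ] JJ'; have : gface b M J' v by rewrite -JJ'; exact: strict_gface.
  case=> _ vJ'; apply/fintype.subsetP => i iJ'; apply/negPn/negP => iJ.
  have := vJ.2 i; rewrite inE iJ (fintype.subsetP J'M) // => /(_ isT).
  by rewrite vJ' // ltxx.
move=> IM I'M eI eI' E; apply/eqP; rewrite finset.eqEsubset.
by rewrite (half I' I IM eI' (esym E)) (half I I' I'M eI E).
Qed.

(** By Pythagoras' inequality, a point satisfying the Karush-Kuhn-Tucker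
    conditions is the strict minimizer of the distance. *)
Lemma mproj_projects (R : realType) d (K : finType) (b : K -> 'rV[R]_d)
    (M I : {set K}) (x p : 'rV[R]_d) :
  I \subset M -> projects b M I x p -> mproj (gcone b M) x = p.
Proof.
move=> IM xp.
have key q : gcone b M q ->
    dotv (x - p) (x - p) + dotv (p - q) (p - q) <= dotv (x - q) (x - q).
  move=> qC; have := projects_polar IM xp qC; have := projects_orth xp.
  rewrite !dotvBB !dotvBl; lra.
apply: xget_unique => [|p' [p'C p'min]].
  split; first exact: projects_gcone xp.
  move=> q qC; rewrite ler_sqrt ?dotvv_ge0 //; have := key q qC.
  by have := dotvv_ge0 (p - q); lra.
have := p'min p (projects_gcone xp); rewrite ler_sqrt ?dotvv_ge0 // => le.
apply/esym/eqP; rewrite -subr_eq0 -dotvv_eq0 eq_le dotvv_ge0 andbT.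
by have := key p' p'C; lra.
Qed.

Lemma mproj_nearest (R : realType) d (K : finType) (b : K -> 'rV[R]_d)
    (M : {set K}) (x : 'rV[R]_d) (p := mproj (gcone b M) x) :
  gcone b M p /\
  forall q, gcone b M q -> dotv (x - p) (x - p) <= dotv (x - q) (x - q).
Proof.
have [p0 p0C p0min] := gcone_nearest b M x.
have [pC pmin] : gcone b M p /\ forall q, gcone b M q -> enorm (x - p) <= enorm (x - q).
  apply: (@xgetI _ 0 [set p | gcone b M p /\
    forall q, gcone b M q -> enorm (x - p) <= enorm (x - q)] p0).
  by split=> // q qC; rewrite ler_sqrt ?dotvv_ge0 // p0min.
by split=> // q qC; have := pmin q qC; rewrite ler_sqrt ?dotvv_ge0.
Qed.

Section SimpleConeFaces.
Context (R : realType) (d : nat) (K : finType) (b : K -> 'rV[R]_d) (M : {set K}).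
Context (bM : forall I : {set K}, I \subset M -> (#|I| <= d)%N -> indep b I).
Context (dM : (d <= #|M|)%N) (d0 : (0 < d)%N).

Lemma normals_neq0 : {in M, forall i, b i != 0}.
Proof.
move=> i iM; apply/eqP => bi0; have := bM (I := [set i]%SET).
rewrite finset.sub1set cards1 => /(_ iM d0) /(_ (fun=> 1)).
rewrite big_set1 scale1r bi0 => /(_ erefl i); rewrite inE eqxx => /(_ isT)/eqP.
by rewrite oner_eq0.
Qed.

Definition face_sets (j : nat) : {set {set K}} :=
  [set I : {set K} | [&& I \subset M, #|I| == (d - j)%N & `[< exact_face b M I >] ] ].

Lemma facesE (j : nat) : (0 < j <= d)%N ->
  faces j (gcone b M) = gface b M @` [set` face_sets j].
Proof.
move=> /andP[j0 jd]; apply/seteqP; split=> F.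
  case=> /is_face_gface[I [IM eI ->]]; rewrite (set_dim_gface bM) // => Ij.
  exists I => //=; rewrite inE IM asboolT // andbT /=; apply/eqP.
  by move: Ij j0 jd; clear; lia.
case=> I /=; rewrite inE => /and3P[IM /eqP Ij /asboolP eI] <-; split.
  exact: gface_is_face normals_neq0 IM.
by rewrite (set_dim_gface bM) // Ij subKn.
Qed.

Lemma faces0E : faces 0 (gcone b M) = [set [set 0]].
Proof.
have zero (I : {set K}) : I \subset M -> (d <= #|I|)%N -> gface b M I = [set 0].
  move=> IM dI; apply/seteqP; split=> v; first by case=> _; exact: active_full bM IM dI.
  by move=> ->; split=> i _; rewrite dotv0l.
apply/seteqP; split=> F.
  case=> /is_face_gface[I [IM eI ->]]; rewrite (set_dim_gface bM) // => /eqP.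
  by rewrite subn_eq0 => dI; rewrite zero.
move=> ->; rewrite -(zero M) //; split.
  by apply: gface_is_face => //; exact: normals_neq0.
have eM : exact_face b M M.
  by exists 0; split=> i; [rewrite dotv0l|rewrite finset.setDv inE].
by rewrite (set_dim_gface bM) //; apply/eqP; rewrite subn_eq0.
Qed.

Lemma mproj_region (I : {set K}) x : I \subset M -> (#|I| <= d)%N ->
  strict_on b M I (mproj (gcone b M) x) <-> region b M I x.
Proof.
move=> IM Id; split=> [pI|[p xp]]; last first.
  by rewrite (mproj_projects IM xp); case: xp => l [].
have [pC pmin] := mproj_nearest b M x.
have IE : [set i in M | dotv (mproj (gcone b M) x) (b i) == 0]%SET = I.
  apply/setP => i; rewrite inE; apply/andP/idP => [[iM /eqP pi0]|iI].
    apply/negPn/negP => iI; have := pI.2 i; rewrite inE iI iM => /(_ isT).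
    by rewrite pi0 ltxx.
  by rewrite (fintype.subsetP IM) // pI.1.
exists (mproj (gcone b M) x); rewrite -{1}IE; apply: nearest_projects => //.
by rewrite IE; exact: bM.
Qed.

(** In general position [d] active constraints force a point to be 0. *)
Lemma mproj_eq0 x : mproj (gcone b M) x = 0 <->
  forall I : {set K}, I \subset M -> (#|I| < d)%N -> ~ region b M I x.
Proof.
split=> [p0 I IM Id xI|noreg].
  have := (mproj_region x IM (ltnW Id)).2 xI; rewrite p0 => -[_ sI].
  have [i iMI] : exists i, i \in M :\: I.
    apply/finset.set0Pn; rewrite -card_gt0 cardsD (finset.setIidPr IM) subn_gt0.
    exact: leq_trans dM.
  by have := sI i iMI; rewrite dotv0l ltxx.
pose p := mproj (gcone b M) x; have [pC pmin] := mproj_nearest b M x.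
pose I := [set i in M | dotv p (b i) == 0]%SET.
have IM : I \subset M by apply/fintype.subsetP => i; rewrite inE => /andP[].
have [Id|dI] := ltnP #|I| d; last first.
  by apply: (active_full bM IM dI) => i; rewrite inE => /andP[_ /eqP].
exfalso; apply: (noreg I IM Id); exists p; apply: nearest_projects => //.
by apply: bM => //; exact: ltnW.
Qed.

End SimpleConeFaces.

(** * Gaussian measure *)

Lemma normal_point (R : realType) (a : R) : normal_prob 0 1 [set a] = 0%E.
Proof.
have ma : measurable ([set a] : set (measurableTypeR R)) by exact: measurable_set1.
apply: (@normal_prob_dominates R 0 1 [set a]) => //.
by apply/measure0_null_setP => //; exact: lebesgue_measure_set1.
Qed.

Lemma measurable_dotv (R : realType) d (w : 'rV[R]_d) :
  measurable_fun setT
    (fun g : d.-tuple (measurableTypeR R) => dotv (row_of_tuple g) w).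
Proof.
rewrite /dotv; apply: measurable_sum => k.
under eq_fun do rewrite mxE.
apply: measurable_realfun.measurable_funM; last exact: measurable_cst.
exact: measurable_tnth.
Qed.

Lemma dotv_row_cons (R : realType) d (x : R) (g : d.-tuple R) (w : 'rV[R]_d.+1) :
  dotv (row_of_tuple [tuple of x :: g]) w =
  x * w 0 ord0 + dotv (row_of_tuple g) (\row_j w 0 (lift ord0 j)).
Proof.
rewrite /dotv big_ord_recl; congr (_ + _); first by rewrite mxE tnth0.
by apply: eq_bigr => k _; rewrite !mxE tnthS.
Qed.

(** By Fubini: if the section of the hyperplane by the first coordinate is again
    a hyperplane, induction applies; otherwise the equation only involves the
    first coordinate, whose law has no atoms. *)
Lemma gaussian_hyperplane (R : realType) d (w : 'rV[R]_d) (c : R) :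
  w != 0 -> std_gaussian R d [set g | dotv (row_of_tuple g) w = c] = 0%E.
Proof.
elim: d w c => [|d IH] w c w0.
  by case/eqP: w0; apply/rowP => -[].
rewrite [std_gaussian _ _]/= /distribution /pushforward /=.
set w' : 'rV[R]_d := \row_j w 0 (lift ord0 j).
have BE : @cons_pair R d @^-1` [set g | dotv (row_of_tuple g) w = c] =
    [set p | p.1 * w 0 ord0 + dotv (row_of_tuple p.2) w' = c].
  by apply/seteqP; split=> p /=; rewrite dotv_row_cons.
rewrite BE; have [w'0|w'0] := eqVneq w' 0; last first.
  rewrite /product_measure1; apply: integral0_eq => x _ /=.
  rewrite (_ : xsection _ _ = [set g | dotv (row_of_tuple g) w' = c - x * w 0 ord0]).
    exact: IH.
  apply/seteqP; split=> g; rewrite /xsection /= inE /=.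
    by move=> <-; rewrite addrAC subrr add0r.
  by move=> ->; rewrite addrCA subrr addr0.
have w00 : w 0 ord0 != 0.
  apply: contraNneq w0 => w00; apply/eqP/rowP => j; rewrite [RHS]mxE.
  have [j' ->|->//] := unliftP ord0 j.
  by have := congr1 (fun u : 'rV[R]_d => u 0 j') w'0; rewrite !mxE.
rewrite (_ : [set p | _] = [set c / w 0 ord0] `*` setT); last first.
  rewrite w'0; apply/seteqP; split=> -[x g] /=; rewrite dotv0r addr0.
    by move=> <-; split=> //; rewrite mulfK.
  by move=> [-> _]; rewrite divfK.
rewrite product_measure1E //.
apply: etrans (mul0e (std_gaussian R d setT)).
exact: (congr1 (fun z => z * std_gaussian R d setT)%E (normal_point _)).
Qed.

Lemma gaussian_generic (R : realType) d (ws : seq 'rV[R]_d) :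
  all (fun w => w != 0) ws ->
  {ae std_gaussian R d, forall g, all (fun w => dotv (row_of_tuple g) w != 0) ws}.
Proof.
elim: ws => [_|w ws IH /= /andP[w0 /IH wsP]]; first by apply: aeW.
have : {ae std_gaussian R d, forall g, dotv (row_of_tuple g) w != 0}.
  exists [set g | dotv (row_of_tuple g) w = 0]; split.
  - rewrite -[X in measurable X]setTI.
    exact: (measurable_dotv w measurableT (measurable_set1 0)).
  - exact: gaussian_hyperplane.
  - by move=> g /= /negP; rewrite negbK => /eqP.
move: wsP; apply: (@filterS2 _ _ (ae_filter_ringOfSetsType (std_gaussian R d))).
by move=> g -> ->.
Qed.

(** Integrate the sum of the indicator functions. *)
Lemma sum_probability (dT : measure_display) (T : measurableType dT)
    (R : realType) (P : probability T R) (I : finType) (S : {set I})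
    (E : I -> set T) (N : R) :
  (forall i, measurable (E i)) ->
  {ae P, forall x, (#|[set i in S | `[< E i x >] ]%SET|)%:R = N} ->
  \sum_(i in S) fine (P (E i)) = N.
Proof.
move=> mE aeN.
have sumE x : (\sum_(i in S) (\1_(E i) x)%:E =
    ((#|[set i in S | `[< E i x >] ]%SET|)%:R : R)%:E)%E.
  rewrite sumEFin -sum1_card natr_sum; congr (_%:E).
  rewrite [LHS]big_mkcond [RHS]big_mkcond /=; apply: eq_bigr => i _.
  rewrite inE; case: (i \in S) => //=; rewrite indicE.
  by case: asboolP => Ex; [rewrite mem_set|rewrite memNset].
have H : (\sum_(i in S) P (E i) = N%:E)%E.
  transitivity (\int[P]_x (\sum_(i in S) (\1_(E i) x)%:E))%E.
    under [RHS]eq_integral do rewrite -big_enum.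
    rewrite ge0_integral_sum //=.
    - by rewrite big_enum /=; apply: eq_bigr => i _; rewrite integral_indic // setIT.
    - by move=> i; apply/measurable_realfun.measurable_EFinP; exact: measurable_realfun.measurable_indic.
  transitivity (\int[P]_x (cst N%:E x))%E.
    apply: ae_eq_integral => //.
    - under eq_fun do rewrite -big_enum.
      apply: emeasurable_sum => i; apply/measurable_realfun.measurable_EFinP; exact: measurable_realfun.measurable_indic.
    - by apply: filterS aeN => x xN _; rewrite sumE xN.
  by rewrite integral_cst //= probability_setT mule1.
rewrite -[RHS]/(fine N%:E) -H -sum_fine // => i _.
exact: fin_num_measure.
Qed.

Lemma measurable_region (R : realType) d (K : finType) (b : K -> 'rV[R]_d)
    (M I : {set K}) : indep b I ->
  measurable [set g : d.-tuple (measurableTypeR R) |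
                region b M I (row_of_tuple g)].
Proof.
move=> bI.
have mh i (D : set R) : measurable (D : set (measurableTypeR R)) ->
    measurable [set g : d.-tuple (measurableTypeR R) |
                  D (dotv (row_of_tuple g) (height b I i))].
  move=> mD; rewrite -[X in measurable X]setTI.
  exact: (measurable_dotv (height b I i) measurableT mD).
rewrite (_ : [set g | _] =
  (\bigcap_(i in [set` I])
     [set g | `[0, +oo[%classic (dotv (row_of_tuple g) (height b I i))]) `&`
  (\bigcap_(i in [set` M :\: I])
     [set g | `]-oo, 0[%classic (dotv (row_of_tuple g) (height b I i))])).
  apply: measurableI; apply: fin_bigcap_measurable => [|i _].
  - exact: finite_finset.
  - by apply: mh; exact: measurable_itv.
  - exact: finite_finset.
  - by apply: mh; exact: measurable_itv.
apply/seteqP; split=> g /=.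
  move/(regionP _ _ bI) => [h1 h2]; split=> i iI /=; rewrite in_itv /= ?andbT.
    exact: h1.
  exact: h2.
move=> [h1 h2]; apply/(regionP _ _ bI); split=> i iI.
  by have := h1 i iI; rewrite /= in_itv /= andbT.
by have := h2 i iI; rewrite /= in_itv /=.
Qed.

(** * Intrinsic volumes of the chambers *)

Section SimpleConeVolumes.
Context (R : realType) (d : nat) (K : finType) (b : K -> 'rV[R]_d) (M : {set K}).
Context (bM : forall I : {set K}, I \subset M -> (#|I| <= d)%N -> indep b I).
Context (dM : (d <= #|M|)%N) (d0 : (0 < d)%N).

Local Notation event I :=
  [set g : d.-tuple (measurableTypeR R) | region b M I (row_of_tuple g)].

Definition codim_sets (r : nat) : {set {set K}} :=
  [set I : {set K} | (I \subset M) && (#|I| == r)].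

Lemma intrinsic_volumeE (j : nat) : (0 < j <= d)%N ->
  intrinsic_volume j (gcone b M) =
  \sum_(I in codim_sets (d - j)) fine (std_gaussian R d (event I)).
Proof.
move=> jd; rewrite /intrinsic_volume (facesE bM d0 jd) sum_image => [|I I'].
  rewrite [LHS]big_mkcond [RHS]big_mkcond /=; apply: eq_bigr => I _; rewrite !inE.
  have [IM|//] := boolP (I \subset M); have [Ij|//] := eqVneq #|I| (d - j)%N.
  rewrite /=; case: asboolP => [eI|neI].
    congr (fine (_ _)); apply/seteqP; split=> g /=.
      by move/(relint_gface _ eI)/(mproj_region bM); apply; rewrite ?Ij ?leq_subr.
    move=> gI; apply/(relint_gface _ eI)/(mproj_region bM) => //.
    by rewrite Ij leq_subr.
  rewrite (_ : event I = set0) ?measure0 //; apply/seteqP; split=> // g /= gI.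
  apply: neI; exists (mproj (gcone b M) (row_of_tuple g)).
  by apply/(mproj_region bM) => //; rewrite Ij leq_subr.
rewrite !inE => /and3P[IM _ /asboolP eI] /and3P[I'M _ /asboolP eI'].
exact: gface_inj.
Qed.

Lemma relint0 p : relint [set (0 : 'rV[R]_d)] p <-> p = 0.
Proof.
have eM : exact_face b M M.
  by exists 0; split=> i; [rewrite dotv0l|rewrite finset.setDv inE].
have <- : gface b M M = [set 0].
  apply/seteqP; split=> v.
    by case=> _ vM; exact: (active_full bM _ dM vM).
  by move=> ->; split=> i _; rewrite dotv0l.
split=> [/(relint_gface _ eM)[pM _]|->]; first exact: (active_full bM _ dM pM).
by apply/(relint_gface _ eM); split=> i; [rewrite dotv0l|rewrite finset.setDv inE].
Qed.

(** The regions of the nonzero faces and the polar cone, on which the projection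
    is 0, partition the space. *)
Lemma intrinsic_volume0E :
  intrinsic_volume 0 (gcone b M) =
  1 - \sum_(r < d) intrinsic_volume (d - r) (gcone b M).
Proof.
pose F := [set I : {set K} | (I \subset M) && (#|I| < d)%N]%SET.
pose A := [set g : d.-tuple (measurableTypeR R) |
             mproj (gcone b M) (row_of_tuple g) = 0].
have -> : intrinsic_volume 0 (gcone b M) = fine (std_gaussian R d A).
  rewrite /intrinsic_volume (faces0E bM dM d0) fsbig_set1; congr (fine (_ _)).
  by apply/seteqP; split=> g /relint0.
have indepF I : I \in F -> indep b I.
  by rewrite inE => /andP[IM Id]; apply: bM => //; exact: ltnW.
have mev I : I \in F -> measurable (event I).
  by move=> IF; apply: measurable_region; exact: indepF.
have AE : A = ~` \bigcup_(I in [set` F]) event I.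
  apply/seteqP; split=> g /=.
    move/(mproj_eq0 bM dM) => noI [I /=]; rewrite inE => /andP[IM Id].
    exact: noI.
  move=> noI; apply/(mproj_eq0 bM dM) => I IM Id gI.
  by apply: noI; exists I => //=; rewrite inE IM.
have mA : measurable A.
  rewrite AE; apply: measurableC; apply: fin_bigcup_measurable.
    exact: finite_finset.
  by move=> I /= IF; exact: mev.
have -> : \sum_(r < d) intrinsic_volume (d - r) (gcone b M) =
    \sum_(I in F) fine (std_gaussian R d (event I)).
  pose phi I := fine (std_gaussian R d (event I)).
  transitivity (\sum_(r < d) \sum_(I : {set K} | I \subset M)
      (if #|I| == r then phi I else 0)).
    apply: eq_bigr => r _; rewrite intrinsic_volumeE; last first.
      by rewrite subn_gt0 ltn_ord leq_subr.
    rewrite subKn ?(ltnW (ltn_ord r)) // [LHS]big_mkcond [RHS]big_mkcond /=.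
    by apply: eq_bigr => I _; rewrite inE; case: (I \subset M).
  rewrite exchange_big /= [LHS]big_mkcond [RHS]big_mkcond /=.
  apply: eq_bigr => I _; rewrite inE; case: (I \subset M) => //=.
  case: ifPn => Id; last first.
    by rewrite big1 // => r _; case: eqP => // Ir; rewrite Ir ltn_ord in Id.
  rewrite (bigD1 (Ordinal Id)) //= eqxx big1 ?addr0 // => r.
  by rewrite -val_eqE /= eq_sym => /negbTE->.
(* almost every, in fact every, point lies in the polar cone or in one region *)
pose E (o : option {set K}) := if o is Some J then
  (if J \in F then event J else set0) else A.
pose S : {set option {set K}} := (None |: [set Some J | J in F])%SET.
have mE o : measurable (E o).
  by case: o => [I|] //=; case: ifP => // IF; exact: mev.
have : \sum_(o in S) fine (std_gaussian R d (E o)) = 1.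
  apply: sum_probability => //; apply: aeW => g.
  suff: exists o, [set o in S | `[< E o g >] ]%SET = [set o]%SET.
    by case=> o ->; rewrite cards1.
  have SE o : (o \in S) = if o is Some J then J \in F else true.
    rewrite finset.in_setU finset.in_set1; case: o => [J|] //=.
    by apply/imsetP/idP => [[J' J'F [->]]|JF] //; exists J.
  have [Ag|nA] := pselect (A g).
    exists None; apply/setP => o; rewrite finset.in_set finset.in_set1 SE.
    case: o => [J|]; last by rewrite eqxx; apply/asboolP.
    apply/negbTE/negP => /andP[JF /asboolP]; rewrite /E JF => gJ.
    by move: Ag; rewrite AE; apply; exists J.
  have [I IF gI] : exists2 I, I \in F & event I g.
    by move: nA; rewrite AE /setC /= => /contrapT[I IF gI]; exists I.
  exists (Some I); apply/setP => o; rewrite finset.in_set finset.in_set1 SE.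
  case: o => [J|]; last by apply/negbTE/negP => /asboolP.
  apply/andP/eqP => [[JF /asboolP]|[->]]; last first.
    by split=> //; apply/asboolP; rewrite /E IF.
  rewrite /E JF => gJ; congr Some; move: IF JF.
  rewrite !finset.in_set => /andP[IM _] /andP[JM _].
  exact: (region_uniq JM IM gJ gI).
rewrite big_setU1 /=; last by apply/negP => /imsetP[].
rewrite big_imset /=; last by move=> I J _ _ [].
rewrite (eq_bigr (fun I => fine (std_gaussian R d (event I)))) => [<-|I ->//].
by rewrite addrK.
Qed.

End SimpleConeVolumes.

Lemma sum_intrinsic_volume (R : realType) d n (B : bool) (y : 'I_n -> 'rV[R]_d) j :
  in_gp B y -> (d <= #|normals n B|)%N -> (0 < j <= d)%N ->
  \sum_(t in chambers B y) intrinsic_volume j (gcone (chain y t) (normals n B)) =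
  (cycle_poly R n B)`_(n - d + j).
Proof.
move=> gy dM jd; have d0 : (0 < d)%N by case/andP: jd => j0; exact: leq_trans.
have dn : (d <= n)%N by rewrite (leq_trans dM) // -[leqRHS](card_ord n) max_card.
pose S := [set f : signed_perm n * {set 'I_n} |
  [&& allowed B f.1.1, f.2 \subset normals n B & #|f.2| == (d - j)%N] ]%SET.
pose E (f : signed_perm n * {set 'I_n}) :=
  if f \in S then [set g : d.-tuple (measurableTypeR R) |
    region (chain y f.1) (normals n B) f.2 (row_of_tuple g)] else set0.
have dj : (d - j < d)%N by rewrite -subn_gt0 subKn; case/andP: jd.
have mE f : measurable (E f).
  rewrite /E; case: ifP => //; rewrite inE => /and3P[a fM /eqP fj].
  by apply: measurable_region; apply: gy => //; rewrite fj ltnW.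
have -> : (n - d + j)%N = (n - (d - j))%N by case/andP: jd; lia.
transitivity (\sum_(f in S) fine (std_gaussian R d (E f))); last first.
  apply: sum_probability => //; have [ws [ws0 wsP]] := generic_exists gy.
  have := gaussian_generic ws0.
  apply: (@filterS _ _ (ae_filter_ringOfSetsType (std_gaussian R d))) => g /wsP gg.
  rewrite -(count_flags gy gg dj); last by rewrite (leq_trans (leq_subr _ _)).
  congr (_%:R); apply: eq_card => f; rewrite [RHS]inE [LHS]inE /E.
  rewrite inE; have [a|] := boolP (allowed B f.1.1); rewrite ?andFb //.
  by case: (f.2 \subset _) => //=; case: (#|f.2| == _).
have -> : \sum_(f in S) fine (std_gaussian R d (E f)) =
    \sum_(t | allowed B t.1) \sum_(I in codim_sets (normals n B) (d - j))
      fine (std_gaussian R d (E (t, I))).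
  rewrite pair_big_dep /=; apply: eq_big => [[t I]|[t I] _] //=.
  by rewrite !inE.
rewrite [LHS]big_mkcond [RHS]big_mkcond /=; apply: eq_bigr => t _.
have [tC|tC] := boolP (t \in chambers B y).
  have a : allowed B t.1 by move: tC; rewrite inE => /andP[].
  rewrite a (intrinsic_volumeE (gy t a) d0 jd); apply: eq_bigr => I.
  by rewrite inE /E inE a /= => ->.
case: ifP => // a; rewrite big1 // => I; rewrite inE => Ij.
rewrite /E inE a Ij (_ : [set g | _] = set0) ?measure0 //.
apply/seteqP; split=> // g /= gI; move/negP: tC; apply.
case/andP: Ij => IM /eqP Ij.
by apply: (region_chamber gy a IM _ gI); rewrite Ij.
Qed.

(** The total mass of the chambers is their number, and by the recursion the
    volumes of positive index carry the half sum of two consecutive numbers of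
    chambers. *)
Lemma sum_intrinsic_volume0 (R : realType) d n (B : bool) (y : 'I_n -> 'rV[R]_d) :
  in_gp B y -> (0 < d)%N -> (d <= #|normals n B|)%N ->
  \sum_(t in chambers B y) intrinsic_volume 0 (gcone (chain y t) (normals n B)) =
  (chamber_number R B n d - chamber_number R B n d.-1) / 2.
Proof.
move=> gy d0 dM.
have dn : (d <= n)%N by rewrite (leq_trans dM) // -[leqRHS](card_ord n) max_card.
have vol t : t \in chambers B y ->
    intrinsic_volume 0 (gcone (chain y t) (normals n B)) =
    1 - \sum_(r < d) intrinsic_volume (d - r) (gcone (chain y t) (normals n B)).
  rewrite inE => /andP[a _]; exact: (intrinsic_volume0E (gy t a) dM d0).
rewrite (eq_bigr _ vol) sumrB exchange_big /= sumr_const.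
rewrite (card_chambers gy) //; last exact: leq_trans dM.
rewrite (eq_bigr (fun r : 'I_d => (cycle_poly R n B)`_(n - r))) => [|r _]; last first.
  rewrite sum_intrinsic_volume ?subn_gt0 ?ltn_ord ?leq_subr //.
  by congr (_`_ _); have := ltn_ord r; lia.
have := @chamber_number_rec R B n d.-1; rewrite (prednK d0) => /(_ dn).
lra.
Qed.

(** * The chambers as cones of the Weyl tessellation *)

Lemma open_open_cone (R : realType) d (K : finType) (b : K -> 'rV[R]_d)
    (M : {set K}) : open (open_cone b M).
Proof.
rewrite openE => v vM; rewrite /interior /=.
apply: (@filterS _ _ _ [set w | forall i, i \in M -> dotv w (b i) < 0]).
  by move=> w wM i iM; exact: wM.
apply: (@filter_forall _ _ (fun i w => i \in M -> dotv w (b i) < 0) (nbhs v)) => i.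
have [iM|_] := boolP (i \in M); last by apply: filterE.
have vi : nbhs v [set w | dotv w (b i) < 0].
  exact: (@continuous_dotvl R d (b i) v _ (lt_nbhsl (vM i iM))).
by apply: (@filterS _ _ _ _ _ _ vi) => w wi _.
Qed.

Lemma connected_open_cone (R : realType) d (K : finType) (b : K -> 'rV[R]_d)
    (M : {set K}) : connected (open_cone b M).
Proof.
have [[x xM]|/set0P/negP] := pselect (open_cone b M !=set0); last first.
  by move=> /negPn/eqP->; exact: connected0.
pose seg v := [set x + s *: (v - x) | s in `[(0 : R), 1]%classic].
have -> : open_cone b M = \bigcup_(v in open_cone b M) seg v.
  apply/seteqP; split=> [v vM|w [v vM [s /=]]].
    by exists v => //; exists 1; rewrite /= ?in_itv /= ?ler01 ?lexx // scale1r addrC subrK.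
  rewrite in_itv /= => /andP[s0 s1] <- i iM.
  have := xM i iM; have := vM i iM; rewrite dotvDl dotvZl dotvBl; nra.
have scal v : continuous (fun s : R => x + s *: (v - x)).
  move=> s; apply: (@continuousD _ _ _ (fun=> x) (fun s : R => s *: (v - x))).
    exact: cst_continuous.
  exact: scalel_continuous.
refine (@bigcup_connected _ _ seg (open_cone b M) _ _).
  by exists x => v _; exists 0; rewrite /= ?in_itv /= ?ler01 ?lexx // scale0r addr0.
move=> v _; refine (@connected_continuous_connected _ _ _
  (fun s : R => x + s *: (v - x)) (@segment_connected R 0 1) _).
exact/continuous_subspaceT/scal.
Qed.

(** A point of the closed cone is the limit of points of the segments that join
    it to an interior point. *)
Lemma closure_open_cone (R : realType) d (K : finType) (b : K -> 'rV[R]_d)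
    (M : {set K}) : open_cone b M !=set0 -> closure (open_cone b M) = gcone b M.
Proof.
move=> [x xM]; apply/seteqP; split=> v.
  move=> /(@closure_subset _ _ (gcone b M)); rewrite -(closure_id _).1.
    by apply; move=> w wM i iM; exact/ltW/wM.
  exact: closed_gcone.
move=> vM U Uv.
have cont : continuous (fun s : R => v + s *: x).
  move=> s; apply: (@continuousD _ _ _ (fun=> v) (fun s : R => s *: x)).
    exact: cst_continuous.
  exact: scalel_continuous.
have /nbhs_ballP[e /= e0 eU] : nbhs (0 : R) [set s | U (v + s *: x)].
  by apply: (cont 0); rewrite /= scale0r addr0.
exists (v + (e / 2) *: x); split.
  move=> i iM; have := xM i iM; have := vM i iM; rewrite dotvDl dotvZl.
  have : 0 < e / 2 by rewrite divr_gt0.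
  nra.
apply: eU; rewrite /ball /= sub0r normrN gtr0_norm ?divr_gt0 //.
by rewrite ltr_pdivrMr // ltr_pMr // ltr1n.
Qed.

Definition walls (R : realType) d n (B : bool) (y : 'I_n -> 'rV[R]_d) :
    set 'rV[R]_d :=
  if B then hyperplanes_B y else hyperplanes_A y.

(** A form of the complement of the walls in which the pairs are not ordered. *)
Definition off_walls (R : realType) d n (B : bool) (y : 'I_n -> 'rV[R]_d)
    (v : 'rV[R]_d) : Prop :=
  (forall a c, a != c -> dotv v (y a) != dotv v (y c) /\
     (B -> dotv v (y a) != - dotv v (y c))) /\
  (B -> forall a, dotv v (y a) != 0).

Lemma wallsP (R : realType) d n (B : bool) (y : 'I_n -> 'rV[R]_d) (v : 'rV[R]_d) :
  (~` walls B y) v <-> off_walls B y v.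
Proof.
have sym (Q : 'I_n -> 'I_n -> Prop) : (forall a c, Q a c -> Q c a) ->
    (forall a c : 'I_n, (a < c)%N -> Q a c) -> forall a c, a != c -> Q a c.
  move=> Qsym Qlt a c; rewrite -val_eqE neq_ltn => /orP[|ca]; first exact: Qlt.
  exact/Qsym/Qlt.
rewrite /walls; case: B; split.
- move=> nH; split=> [|_ a]; last first.
    by apply/eqP => va; apply: nH; right; exists a.
  apply: sym => [a c [ac ac']|a c ac].
    by split=> [|_]; rewrite eq_sym // eqr_oppLR ac'.
  split=> [|_]; apply/eqP => va; apply: nH; left; exists (a, c) => //=.
    by right; rewrite /hyperplane /= dotvBr va subrr.
  by left; rewrite /hyperplane /= dotvDr va addNr.
- move=> [off off0] [[[a c] /= ac]|[a _]]; last first.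
    by move/eqP; rewrite (negbTE (off0 isT a)).
  have ac' : a != c by rewrite -val_eqE neq_ltn ac.
  have [/negP ne1 /(_ isT)/negP ne2] := off a c ac'.
  rewrite /hyperplane /= => -[/eqP|/eqP].
    by rewrite dotvDr addr_eq0.
  by rewrite dotvBr subr_eq0.
- move=> nH; split=> //; apply: sym => [a c [ac _]|a c ac]; first by rewrite eq_sym.
  split=> //; apply/eqP => va; apply: nH; exists (a, c) => //=.
  by rewrite /hyperplane /= dotvBr va subrr.
- move=> [off _] [[a c] /= ac].
  have ac' : a != c by rewrite -val_eqE neq_ltn ac.
  have [/negP ne1 _] := off a c ac'.
  by rewrite /hyperplane /= => /eqP; rewrite dotvBr subr_eq0.
Qed.

Lemma dotv_chain (R : realType) d n (y : 'I_n -> 'rV[R]_d) (v : 'rV[R]_d)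
    (t : signed_perm n) i :
  dotv v (chain y t i) = scoord t (adj y v) i -
    (if (i.+1 < n)%N then scoord t (adj y v) (ordS i) else 0).
Proof. by rewrite -dotv_adj dotv_chain_evec. Qed.

Section ChamberCones.
Context (R : realType) (d n : nat) (B : bool) (y : 'I_n -> 'rV[R]_d).

Local Notation cone t := (gcone (chain y t) (normals n B)).
Local Notation chamber t := (open_cone (chain y t) (normals n B)).

Lemma chamber_incr t v (i j : 'I_n) :
  chamber t v -> (i < j)%N -> scoord t (adj y v) i < scoord t (adj y v) j.
Proof.
move=> tv ij; have [m jE] : exists m, j = (i + m).+1 :> nat.
  by exists (j - i.+1)%N; rewrite -addSn subnKC.
elim: m => [|m IH] in j jE {ij} *.
  have i1 : (i.+1 < n)%N by have := ltn_ord j; rewrite jE addn0.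
  have := tv i; rewrite inE i1 orbT => /(_ isT); rewrite dotv_chain i1 subr_lt0.
  by congr (_ < scoord _ _ _); apply/val_inj/(etrans (ordS_val i1)); rewrite /= jE addn0.
have lt_n : ((i + m).+1 < n)%N.
  by rewrite ltnW //; have := ltn_ord j; rewrite jE addnS.
pose k := Ordinal lt_n; have k1 : (k.+1 < n)%N.
  by have := ltn_ord j; rewrite jE addnS.
apply: lt_trans (IH k erefl) _.
have := tv k; rewrite inE k1 orbT => /(_ isT); rewrite dotv_chain k1 subr_lt0.
by congr (_ < scoord _ _ _); apply/val_inj/(etrans (ordS_val k1)); rewrite /= jE addnS.
Qed.

Lemma chamber_neg t v (i : 'I_n) : B -> chamber t v -> scoord t (adj y v) i < 0.
Proof.
move=> b tv; have n0 : (n.-1 < n)%N by rewrite prednK // (leq_trans _ (ltn_ord i)).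
pose l := Ordinal n0; have l0 : scoord t (adj y v) l < 0.
  have := tv l; rewrite inE b => /(_ isT); rewrite dotv_chain /=.
  by rewrite (ltn_predK n0) ltnn subr0.
have [<-|il] := eqVneq l i; first by [].
apply: lt_trans l0; apply: (chamber_incr tv).
rewrite ltn_neqAle eq_sym il /=; have := ltn_ord i; lia.
Qed.

(** In type B all signed scalar products are negative on an open chamber, which
    determines the signs. *)
Lemma chamber_sign t v : allowed B t.1 -> chamber t v ->
  t.1 = [ffun a => B && (0 < dotv v (y a))].
Proof.
move=> a tv; apply/ffunP => c; rewrite ffunE; case: (boolP B) => [b|nb] /=; last first.
  by move: a; rewrite /allowed (negbTE nb) => /eqP->; rewrite ffunE.
have := chamber_neg ((t.2)^-1%g c) b tv; rewrite /scoord permKV mxE.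
case: (t.1 c); first by rewrite expr1 mulN1r oppr_lt0 => ->.
by rewrite expr0 mul1r => /ltW; rewrite leNgt => /negbTE->.
Qed.

(** A strictly increasing arrangement of pairwise distinct numbers is unique:
    the position of an entry is the number of smaller entries. *)
Lemma rank_incr (g : 'I_n -> R) (s : 'S_n) :
  (forall i j : 'I_n, (i < j)%N -> g (s i) < g (s j)) ->
  forall i, #|[set c | g c < g (s i)]%SET| = i.
Proof.
move=> sg i; have -> : [set c | g c < g (s i)]%SET = s @: [set j : 'I_n | (j < i)%N]%SET.
  apply/setP => c; rewrite inE; apply/idP/imsetP => [gc|[j]]; last first.
    by rewrite inE => /sg gj ->.
  exists ((s^-1)%g c); rewrite ?permKV // inE ltnNge; apply/negP.
  rewrite leq_eqVlt => /orP[/eqP/val_inj iE|/sg].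
    by move: gc; rewrite iE permKV ltxx.
  by rewrite permKV ltNge (ltW gc).
rewrite card_imset; last exact: perm_inj.
by rewrite -sum1dep_card big_ord_narrow ?(ltnW (ltn_ord i)) // sum1_card card_ord.
Qed.

Lemma chamber_uniq t t' v : allowed B t.1 -> allowed B t'.1 ->
  chamber t v -> chamber t' v -> t = t'.
Proof.
move=> a a' tv tv'; have E : t.1 = t'.1 by rewrite (chamber_sign a tv) (chamber_sign a' tv').
pose g c : R := (-1) ^+ t.1 c * dotv v (y c).
have gE i : scoord t (adj y v) i = g (t.2 i) by rewrite /scoord mxE.
have gE' i : scoord t' (adj y v) i = g (t'.2 i) by rewrite /scoord -E mxE.
have r i : #|[set c | g c < g (t.2 i)]%SET| = i.
  by apply: rank_incr => j k jk; rewrite -!gE; exact: chamber_incr.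
have r' i : #|[set c | g c < g (t'.2 i)]%SET| = i.
  by apply: rank_incr => j k jk; rewrite -!gE'; exact: chamber_incr.
case: t t' E {a a' tv tv' gE gE'} g r r' => e s [e' s'] /= -> g r r'.
congr pair; apply/permP => i; pose j := (s'^-1)%g (s i).
have sE : s i = s' j by rewrite permKV.
by rewrite sE; congr (s' _); apply: val_inj; rewrite /= -(r' j) -sE r.
Qed.

Lemma chamber_off t v : allowed B t.1 -> chamber t v -> off_walls B y v.
Proof.
move=> a tv; pose g c : R := (-1) ^+ t.1 c * dotv v (y c).
have gE i : scoord t (adj y v) i = g (t.2 i) by rewrite /scoord mxE.
have gne c c' : c != c' -> g c != g c'.
  rewrite -(permKV t.2 c) -(permKV t.2 c') -!gE (inj_eq perm_inj).
  rewrite -val_eqE neq_ltn => /orP[]/(chamber_incr tv) lt.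
    by rewrite lt_eqF.
  by rewrite gt_eqF.
have g0 c : B -> g c < 0.
  by move=> b; rewrite -(permKV t.2 c) -gE; exact: chamber_neg.
have gA c : B -> g c = - `|dotv v (y c)|.
  move=> b; have := g0 c b; rewrite /g (chamber_sign a tv) ffunE b /=.
  case: (ltrP 0 (dotv v (y c))) => [p|p]; first by rewrite expr1 mulN1r gtr0_norm.
  by rewrite expr0 mul1r ler0_norm ?opprK.
split=> [c c' cc'|b c]; last first.
  by have := g0 c b; rewrite gA // oppr_lt0 normr_gt0.
have [b|nb] := boolP B; last first.
  have := gne _ _ cc'; rewrite /g; move: a; rewrite /allowed (negbTE nb) => /eqP->.
  by rewrite !ffunE !expr0 !mul1r.
have := gne _ _ cc'; rewrite !gA // eqr_opp => ne.
by split=> [|_]; apply: contraNneq ne => ->; rewrite ?normrN.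
Qed.

Lemma off_cone t v : allowed B t.1 -> off_walls B y v -> cone t v -> chamber t v.
Proof.
move=> a [off off0] vt i iM; rewrite lt_neqAle vt // andbT dotv_chain /scoord !mxE.
case: ifP => i1; last first.
  move: iM; rewrite inE i1 orbF => b.
  by rewrite subr0 mulf_neq0 ?signr_eq0 // off0.
have ne : t.2 i != t.2 (ordS i).
  have lt_i : (i < ordS i)%N by rewrite (ordS_val i1).
  by rewrite (inj_eq perm_inj) -val_eqE ltn_eqF.
have [ne1 ne2] := off _ _ ne; rewrite subr_eq0.
have [b|nb] := boolP B; last first.
  by move: a; rewrite /allowed (negbTE nb) => /eqP->; rewrite !ffunE !expr0 !mul1r.
have := ne2 b; case: (t.1 (t.2 i)); case: (t.1 (t.2 (ordS i)));
  by rewrite ?expr0 ?expr1 ?mulN1r ?mul1r ?eqr_opp // eqr_oppLR ?opprK.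
Qed.

(** The chamber of a point is found by sorting its scalar products with the
    vectors, with signs that make them negative in type B. *)
Lemma off_chamber v : off_walls B y v ->
  exists2 t : signed_perm n, allowed B t.1 & chamber t v.
Proof.
move=> [off off0].
pose e : {ffun 'I_n -> bool} := [ffun a => B && (0 < dotv v (y a))].
have a : allowed B e.
  rewrite /allowed; case: (boolP B) => //= nb; apply/eqP/ffunP => c.
  by rewrite !ffunE (negbTE nb).
pose g c : R := (-1) ^+ e c * dotv v (y c).
have gA c : B -> g c = - `|dotv v (y c)|.
  move=> b; rewrite /g ffunE b /=.
  case: (ltrP 0 (dotv v (y c))) => [p|p]; first by rewrite expr1 mulN1r gtr0_norm.
  by rewrite expr0 mul1r ler0_norm ?opprK.
have gne c c' : c != c' -> g c != g c'.
  move=> cc'; have [ne1 ne2] := off _ _ cc'.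
  have [b|nb] := boolP B; last by rewrite /g !ffunE (negbTE nb) !expr0 !mul1r.
  rewrite !gA // eqr_opp; apply/negP => /eqP.
  by move/eqP; rewrite eqr_norm2 (negbTE ne1) (negbTE (ne2 b)).
have ggt0 c : B -> g c < 0 by move=> b; rewrite gA // oppr_lt0 normr_gt0 off0.
pose le := [rel c c' | g c <= g c'].
have le_total : total le by move=> c c'; exact: le_total.
have /tuple_permP[s sE] : perm_eq (sort le (enum 'I_n)) (ord_tuple n).
  by rewrite perm_sort val_ord_tuple.
have sorted_s : sorted le [tuple tnth (ord_tuple n) (s i) | i < n].
  by rewrite -sE; exact: sort_sorted.
exists (e, s) => // i iM; rewrite dotv_chain.
have gE j : scoord (e, s) (adj y v) j = g (s j) by rewrite /scoord mxE.
rewrite !gE; case: ifP => i1; last first.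
  by rewrite subr0 ggt0 //; move: iM; rewrite inE i1 orbF.
rewrite subr_lt0 lt_neqAle gne /=; last first.
  have lt_i : (i < ordS i)%N by rewrite (ordS_val i1).
  by rewrite (inj_eq perm_inj) -val_eqE ltn_eqF.
have := sortedP (s i) sorted_s i; rewrite size_tuple => /(_ i1) /=.
have nthE (j : 'I_n) :
    nth (s i) [seq tnth (ord_tuple n) (s i) | i <- enum 'I_n] j = s j.
  by rewrite (nth_map i) ?size_enum_ord // nth_ord_enum tnth_ord_tuple.
by rewrite nthE -(ordS_val i1) nthE.
Qed.

(** An open chamber is convex, and relatively open and closed in the complement
    of the walls, so it is a connected component. *)
Lemma tessellation_walls :
  tessellation (walls B y) = (fun t => cone t) @` [set` chambers B y].
Proof.
have comp t v : allowed B t.1 -> chamber t v ->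
    closure (connected_component (~` walls B y) v) = cone t.
  move=> a tv; rewrite -closure_open_cone; last by exists v.
  have sub : chamber t `<=` ~` walls B y.
    by move=> w tw; apply/wallsP; exact: chamber_off tw.
  congr closure; apply/seteqP; split=> w; last first.
    apply: connected_component_max => //; exact: connected_open_cone.
  move=> [C [Cv CX Cc] Cw].
  suff CE : C `&` chamber t = C by move: Cw; rewrite -{1}CE => -[].
  apply: Cc; first by exists v.
    by exists (chamber t); [exact: open_open_cone|].
  exists (cone t); first exact: closed_gcone.
  apply/seteqP; split=> u [Cu ut]; split=> //.
    by move=> i iM; exact/ltW/ut.
  by apply: off_cone => //; apply/wallsP; exact: CX.
apply/seteqP; split=> [_ [v /wallsP vX <-]|_ [t /= tC <-]].
  have [t a tv] := off_chamber vX; exists t; last by rewrite (comp t).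
  by rewrite /= inE a; apply/asboolP; exists v.
move: tC; rewrite inE => /andP[a /asboolP[v tv]].
exists v; last exact: comp.
by apply/wallsP; exact: chamber_off tv.
Qed.

Lemma cone_inj : {in chambers B y &, injective (fun t => cone t)}.
Proof.
move=> t t'; rewrite !inE => /andP[a /asboolP[v tv]] /andP[a' _] E.
apply: (chamber_uniq a a' tv); apply: off_cone => //; first exact: chamber_off tv.
by rewrite -E => i iM; exact/ltW/tv.
Qed.

End ChamberCones.

(** * Expectation of an almost surely constant function *)

(** Integrals of nonnegative functions are suprema over the simple functions
    below, so monotonicity holds for arbitrary functions; the average over the
    tessellation is only known to be almost surely constant. *)
Lemma le_ge0_integral (dT : measure_display) (T : measurableType dT)
    (R : realType) (mu : {measure set T -> \bar R}) (f g : T -> \bar R) :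
  (forall x, 0 <= f x)%E -> (forall x, f x <= g x)%E ->
  (\int[mu]_x f x <= \int[mu]_x g x)%E.
Proof.
move=> f0 fg; rewrite !ge0_integralTE // => [|x].
  apply: ereal_sup_le => _ /= [h hf <-]; exists h => // x.
  exact: le_trans (hf x) (fg x).
exact: le_trans (f0 x) (fg x).
Qed.

Import HBNNSimple.

Lemma ge0_integral_ae_cst (dT : measure_display) (T : measurableType dT)
    (R : realType) (P : probability T R) (f : T -> \bar R) (c : R) :
  (forall x, 0 <= f x)%E -> 0 <= c -> {ae P, forall x, f x = c%:E} ->
  (\int[P]_x f x = c%:E)%E.
Proof.
move=> f0 c0 fc.
have cstE : (\int[P]_x (cst c%:E) x = c%:E)%E.
  by rewrite integral_cst //= probability_setT mule1.
have c0' : (0 <= c%:E)%E by rewrite lee_fin.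
apply/eqP; rewrite eq_le; apply/andP; split.
  rewrite ge0_integralTE //; apply: ge_ereal_sup => _ [h /= hf <-].
  rewrite -integralT_nnsfun -{1}cstE; apply: ae_ge0_le_integral => //.
  - by move=> x _; rewrite lee_fin; exact: fun_ge0.
  - by apply/measurable_realfun.measurable_EFinP.
  - by apply: (@filterS _ _ (ae_filter_ringOfSetsType P)) fc => x <- _.
have [N [mN N0 fN]] := fc.
rewrite -{1}cstE.
rewrite (@ae_eq_integral _ _ _ _ _ (fun x => (c * \1_(~` N) x)%:E)) //.
- apply: le_ge0_integral => x; first by rewrite lee_fin mulr_ge0 // indicE ler0n.
  rewrite indicE; have [xN|xN] := boolP (x \in ~` N); last by rewrite mulr0.
  rewrite mulr1 (_ : f x = c%:E) //; apply: contrapT => fx.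
  by move: xN; rewrite inE; apply; exact: fN.
- apply/measurable_realfun.measurable_EFinP/measurable_realfun.measurable_funM => //.
  by apply/measurable_realfun.measurable_indic/measurableC.
- exists N; split=> // x /=; apply: contra_notP => xN _.
  by rewrite indicE mem_set // mulr1.
Qed.

Lemma expectation_ae_cst (dT : measure_display) (T : measurableType dT)
    (R : realType) (P : probability T R) (X : T -> R) (c : R) :
  {ae P, forall x, X x = c} -> ('E_P[X] = c%:E)%E.
Proof.
move=> Xc; rewrite unlock integralE.
rewrite (@ge0_integral_ae_cst _ _ _ _ _ (Num.max c 0)) //.
- rewrite (@ge0_integral_ae_cst _ _ _ _ _ (Num.max (- c) 0)) //.
  + rewrite -EFinB; congr (_%:E); case: (lerP c 0); case: (lerP (- c) 0); lra.
  + by rewrite le_max lexx orbT.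
  + apply: (@filterS _ _ (ae_filter_ringOfSetsType P)) Xc => x Xx.
    by rewrite funenegE Xx -EFinN EFin_max.
- by rewrite le_max lexx orbT.
- apply: (@filterS _ _ (ae_filter_ringOfSetsType P)) Xc => x Xx.
  by rewrite funeposE Xx EFin_max.
Qed.

(** * General position and the expected intrinsic volumes *)

Lemma free_indep (R : realType) d (K : finType) (b : K -> 'rV[R]_d) (S : {set K}) :
  free [seq b i | i in S] -> indep b S.
Proof.
move=> freeS l l0 i iS.
have /(@freeP _ _ _ (image_tuple b (mem S))) fr := freeS.
rewrite -(enum_rankK_in iS iS).
apply: (fr (fun k => l (enum_val k))); rewrite -[RHS]l0 [RHS]big_enum_val /=.
by apply: eq_bigr => k _; rewrite nth_image.
Qed.

Lemma eq_in_indep (R : realType) d (K : finType) (b b' : K -> 'rV[R]_d)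
    (I : {set K}) : {in I, b =1 b'} -> indep b I -> indep b' I.
Proof.
move=> bb' bI l l0; apply: bI; rewrite -[RHS]l0.
by apply: eq_bigr => i /bb'->.
Qed.

Lemma superset_of_size (K : finType) (I M : {set K}) k :
  I \subset M -> (#|I| <= k <= #|M|)%N ->
  exists J : {set K}, [/\ I \subset J, J \subset M & #|J| = k].
Proof.
move=> IM /andP[Ik kM].
have [|J JM Jk] := @subset_of_size _ (M :\: I) (k - #|I|).
  by rewrite cardsD (finset.setIidPr IM) leq_sub2r.
exists (I :|: J); split; first exact: finset.subsetUl.
  by rewrite finset.subUset IM (fintype.subset_trans JM) ?finset.subsetDl.
rewrite cardsU Jk (_ : I :&: J = finset.set0) ?cards0 ?subn0 ?subnKC //.
apply/setP => i; rewrite !inE; apply/negbTE/negP => /andP[iI /(fintype.subsetP JM)].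
by rewrite inE iI.
Qed.

Lemma card_normals n B : #|normals n B| = (n - ~~ B)%N.
Proof.
case: B; first by rewrite subn0 -[RHS](card_ord n); apply: eq_card => i; rewrite !inE.
case: n => [|n]; first by apply: eq_card0 => -[].
rewrite subn1 /= -sum1dep_card -[RHS]card_ord -sum1_card.
by rewrite (big_ord_narrow (leqnSn n)).
Qed.

(** The independence of [d] vectors of a chain passes to fewer vectors, after
    completing these to [d] of them.  In the hypothesis the signs are indexed by
    the positions, in a chain by the letters. *)
Lemma general_position_gp (R : realType) d n (B : bool) (y : 'I_n -> 'rV[R]_d) :
  (if B then general_position_B y else general_position_A y) ->
  in_gp B y /\ (d <= #|normals n B|)%N.
Proof.
move=> gy; have dM : (d <= #|normals n B|)%N.
  rewrite card_normals; case: B gy => -[dn _]; first by rewrite subn0.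
  by rewrite /=; lia.
split=> // t a I IM Id.
have [|J [IJ JM Jd]] := superset_of_size IM (k := d); first by rewrite Id.
apply: (indepS IJ); case: B gy a JM {dM IM} => -[_ gy] a JM.
  exact: (free_indep (gy (fun i => t.1 (t.2 i)) t.2 J Jd)).
have JM' i : i \in J -> (i.+1 < n)%N.
  by move/(fintype.subsetP JM); rewrite inE.
apply: eq_in_indep (free_indep (gy t.2 J Jd JM')) => i /JM' i1.
by move: a; rewrite /allowed /= /chain i1 => /eqP->; rewrite !ffunE !expr0 !scale1r.
Qed.

Lemma cone_average_walls (R : realType) d n (B : bool) (y : 'I_n -> 'rV[R]_d)
    (phi : set 'rV[R]_d -> R) :
  cone_average (tessellation (walls B y)) phi =
  (#|chambers B y|%:R)^-1 *
    \sum_(t in chambers B y) phi (gcone (chain y t) (normals n B)).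
Proof.
have coneI := @cone_inj R d n B y.
rewrite /cone_average tessellation_walls (sum_image _ coneI); congr (_^-1 * _).
set W := _ @` _; have finW : finite_set W.
  exact/finite_image/finite_finset.
transitivity (\sum_(C \in W) (1 : R)); last by rewrite sum_image // sumr_const.
by rewrite fsbig_finite // big_const_seq count_predT iter_addr_0.
Qed.

Lemma expected_intrinsic_volume (R : realType) d n (B : bool)
    (dO : measure_display) (Omega : measurableType dO)
    (P : probability Omega R) (Y : 'I_n -> Omega -> 'rV[R]_d) :
  (0 < d)%N ->
  {ae P, forall w, if B then general_position_B (Y^~ w)
                   else general_position_A (Y^~ w)} ->
  expectation_cone P (fun w => tessellation (walls B (Y^~ w)))
      (@intrinsic_volume R d 0) =
    ((chamber_number R B n d - chamber_number R B n d.-1) /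
     (2 * chamber_number R B n d))%:E /\
  forall j, (1 <= j <= d)%N ->
    expectation_cone P (fun w => tessellation (walls B (Y^~ w)))
        (@intrinsic_volume R d j) =
      ((chamber_number R B n d)^-1 *
       stirling R B n (n%:Z - d%:Z + j%:Z))%:E.
Proof.
move=> d0 gpY.
have gp : {ae P, forall w, in_gp B (Y^~ w) /\ (d <= #|normals n B|)%N}.
  apply: (@filterS _ _ (ae_filter_ringOfSetsType P)) gpY => w.
  exact: general_position_gp.
have card (y : 'I_n -> 'rV[R]_d) : in_gp B y -> (d <= #|normals n B|)%N ->
    #|chambers B y|%:R = chamber_number R B n d.
  by move=> gy dM; apply: card_chambers => //; exact: leq_trans dM.
split=> [|j jd]; apply: expectation_ae_cst;
  apply: (@filterS _ _ (ae_filter_ringOfSetsType P)) gp => w [gy dM].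
  rewrite cone_average_walls card // sum_intrinsic_volume0 //.
  by rewrite mulrC -mulrA invfM.
rewrite cone_average_walls card // sum_intrinsic_volume //; congr (_ * _).
rewrite -stirlingE; congr stirling.
have dn : (d <= n)%N by rewrite (leq_trans dM) // card_normals leq_subr.
by rewrite PoszD subzn.
Qed.

Theorem corollary1p10 (R : realType) (d : nat) (hd : (2 <= d)%N) :
  (forall (n : nat) (dO : measure_display) (Omega : measurableType dO)
      (P : probability Omega R) (Y : 'I_n -> Omega -> 'rV[R]_d),
    (forall i, random_vector (Y i)) ->
    {ae P, forall w, general_position_A (fun i => Y i w)} ->
    expectation_cone P (fun w => weyl_A (fun i => Y i w))
        (@intrinsic_volume R d 0)
      = ((DA R n d - DA R n d.-1) / (2 * DA R n d))%:E
    /\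
    forall j : nat, (1 <= j <= d)%N ->
      expectation_cone P (fun w => weyl_A (fun i => Y i w))
          (@intrinsic_volume R d j)
        = ((DA R n d)^-1 * stirlingA R n (n%:Z - d%:Z + j%:Z))%:E)
  /\
  (forall (n : nat) (dO : measure_display) (Omega : measurableType dO)
      (P : probability Omega R) (Y : 'I_n -> Omega -> 'rV[R]_d),
    (forall i, random_vector (Y i)) ->
    {ae P, forall w, general_position_B (fun i => Y i w)} ->
    expectation_cone P (fun w => weyl_B (fun i => Y i w))
        (@intrinsic_volume R d 0)
      = ((DB R n d - DB R n d.-1) / (2 * DB R n d))%:E
    /\
    forall j : nat, (1 <= j <= d)%N ->
      expectation_cone P (fun w => weyl_B (fun i => Y i w))
          (@intrinsic_volume R d j)
        = (stirlingB R n (n%:Z - d%:Z + j%:Z) / DB R n d)%:E).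
Proof.
have d0 : (0 < d)%N by exact: ltnW.
split=> n dO Omega P Y _ gpY.
  exact: (@expected_intrinsic_volume R d n false dO Omega P Y d0 gpY).
have [E0 Ej] := @expected_intrinsic_volume R d n true dO Omega P Y d0 gpY.
split; first exact: E0.
by move=> j jd; rewrite [(_ / _)%R]mulrC; exact: Ej.
Qed.
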